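(* (a) Let $P$ be a simple closed $n$-gon in $\mathbb{R}^2$, $n\ge3$. Then $\mathrm{poldiam}(\mathrm{int}P)\le\lfloor n/2\rfloor$ and $\mathrm{poldiam}(\mathrm{ext}P)\le\lceil n/2\rceil$. (b) For every $n\ge3$ there is a simple closed $n$-gon $P_n$ in $\mathbb{R}^2$ with $\mathrm{poldiam}(\mathrm{int}P_n)=\lfloor n/2\rfloor$ and $\mathrm{poldiam}(\mathrm{ext}P_n)=\lceil n/2\rceil$.
   Context: A simple closed $n$-gon is $P=\bigcup_{i=1}^n[p_{i-1},p_i]$ with distinct vertices $p_0,\dots,p_{n-1}$, $p_n=p_0$, whose edges meet only in common endpoints of consecutive edges. $\mathrm{int}P$ and $\mathrm{ext}P$ are the bounded and the unbounded component of $\mathbb{R}^2\setminus P$. For $S\subset\mathbb{R}^2$ and $a,b\in S$, $\pi_S(a,b)$ is the smallest number of edges of a polygonal path connecting $a$ to $b$ within $S$ ($\infty$ if none exists), and $\mathrm{poldiam}(S)=\sup\{\pi_S(a,b):a,b\in S\}$. *)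

(* Defs.v *)
From HB Require Import structures.
From mathcomp Require Import all_boot all_order all_algebra.
From mathcomp Require Import all_classical all_reals all_analysis.
Set Implicit Arguments. Unset Strict Implicit. Unset Printing Implicit Defensive.
Import Order.TTheory GRing.Theory Num.Theory.
Import numFieldNormedType.Exports.
Local Open Scope classical_set_scope.
Local Open Scope ring_scope.

Section Polygons.
Variable R : realType.

Definition pt := 'rV[R]_2.

Definition segment (a b : pt) : set pt :=
  [set x | exists2 t : R, 0 <= t <= 1 & x = (1 - t) *: a + t *: b].

Definition vtx (n : nat) (p : nat -> pt) (i : nat) : pt := p (i %% n)%N.

Definition edge (n : nat) (p : nat -> pt) (i : nat) : set pt :=
  segment (vtx n p i.-1) (vtx n p i).

Definition polygon (n : nat) (p : nat -> pt) : set pt :=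
  \bigcup_(i in [set i : nat | (1 <= i <= n)%N]) edge n p i.

(* simple closed n-gon: distinct vertices p_0..p_{n-1}; distinct edges meet
   only in the common endpoint of consecutive edges (edges i and i+1 share
   p_i, edges n and 1 share p_0 = p_n) *)
Definition simple_closed_polygon (n : nat) (p : nat -> pt) : Prop :=
  (forall i j, (i < n)%N -> (j < n)%N -> p i = p j -> i = j) /\
  (forall i j, (1 <= i <= n)%N -> (1 <= j <= n)%N -> i <> j ->
     edge n p i `&` edge n p j =
       (if (j == i %% n + 1)%N then [set vtx n p i]
        else if (i == j %% n + 1)%N then [set vtx n p j]
        else set0)).

(* interior: union of the bounded components of R^2 \ P (there is exactly one
   by the Jordan curve theorem); exterior: union of the unbounded ones *)
Definition int_poly (P : set pt) : set pt :=
  [set x | ~ P x /\ bounded_set (connected_component (~` P) x)].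
Definition ext_poly (P : set pt) : set pt :=
  [set x | ~ P x /\ ~ bounded_set (connected_component (~` P) x)].

Definition polygonal_path (S : set pt) (a b : pt) (k : nat) : Prop :=
  exists q : nat -> pt, [/\ q 0%N = a, q k = b &
    forall i, (1 <= i <= k)%N -> segment (q i.-1) (q i) `<=` S].

(* pi_S(a,b): least number of edges (+oo if no path) *)
Definition polpi (S : set pt) (a b : pt) : \bar R :=
  ereal_inf [set (k%:R)%:E | k in [set k : nat | polygonal_path S a b k]].

Definition poldiam (S : set pt) : \bar R :=
  ereal_sup [set polpi S a b | a in S & b in S].

End Polygons.

(* Main.v *)
Require Import Defs.
From mathcomp Require Import all_boot all_order all_algebra.
From mathcomp Require Import all_classical all_reals all_analysis.
From mathcomp Require Import ring lra zify.
Import Order.TTheory GRing.Theory Num.Theory.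
Import numFieldNormedType.Exports.
Local Open Scope classical_set_scope.
Local Open Scope ring_scope.
Set Implicit Arguments. Unset Strict Implicit. Unset Printing Implicit Defensive.

(* Upper bounds: for a polygon in general position they are proved by induction on the number
   of vertices, cutting the interior along a diagonal and the exterior along a hull segment that
   is not an edge. The parity of the cuts is absorbed by counting half links: a point reaches an
   edge in an odd number of half steps if it reaches both ends, in an even number if it reaches
   one. Inside, every edge is reached in n such steps and passing from one edge to another costs
   n - 2 more; outside, where only hull edges are considered, n + 1 and n - 1. An arbitrary
   polygon is first replaced by one in general position lying in the component in question,
   each vertex being pushed slightly to that side of both its edges.
   Interior and exterior are recognised by the parity of crossings with a vertical ray.

   Lower bounds: the points u_i = +-2^i on the cubic x = y^3, with signs + - - + + - - ..., joined
   as u_0 u_1, u_i u_(i+2) and u_(n-2) u_(n-1), form a thin double spiral around the origin.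
   Its edges cut the line x = 0 into intervals; a link contained in the interior or in the
   exterior meets at most one of them, while a path from end to end meets all floor(n/2) of the
   relevant ones. Outside, for odd n >= 5, the path must moreover spend an extra link to get from
   the mouth of the spiral around its blunt outer end. *)

(** * Orientation, segments and crossings *)

Section Coordinates.
Variable R : realType.
Implicit Types a b c d u v w x y z m : pt R.

(** The Jordan curve theorem is not assumed. That crossing parity is constant along a segment
    missing the polygon comes from a double count of segment against segment, and that all even
    points lie in one component is a by-product of the exterior upper bound. The inductions work in
    closed regions, boundary included, so that links may run along edges and cuts. This is harmless
    because the polygon in general position already lies inside the open component. General position
    is needed because a diagonal could otherwise run into a vertex, and the half-planes beyond two
    parallel hull sides need not meet. Half links make the bookkeeping exact: cutting an n-gon into
    an n1-gon and an n2-gon gives n1 + n2 = n + 2, so the transfer costs n1 - 2 and n2 - 2 add up to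
    n - 2, whereas whole links would have to be rounded at every cut. Outside, one part of the cut
    is a pocket treated by the interior bound and the other is the polygon with that pocket filled,
    which explains why the exterior invariant is larger by one. *)

Definition px a : R := a ord0 ord0.
Definition py a : R := a ord0 (lift ord0 ord0).

Definition mkpt (s t : R) : pt R := \row_j (if j == ord0 then s else t).

Lemma px_mk s t : px (mkpt s t) = s. Proof. by rewrite /px mxE. Qed.
Lemma py_mk s t : py (mkpt s t) = t. Proof. by rewrite /py mxE. Qed.
Lemma pxD a b : px (a + b) = px a + px b. Proof. by rewrite /px mxE. Qed.
Lemma pyD a b : py (a + b) = py a + py b. Proof. by rewrite /py mxE. Qed.
Lemma pxN a : px (- a) = - px a. Proof. by rewrite /px mxE. Qed.
Lemma pyN a : py (- a) = - py a. Proof. by rewrite /py mxE. Qed.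
Lemma pxZ t a : px (t *: a) = t * px a. Proof. by rewrite /px mxE. Qed.
Lemma pyZ t a : py (t *: a) = t * py a. Proof. by rewrite /py mxE. Qed.
Definition pE := (px_mk, py_mk, pxD, pyD, pxN, pyN, pxZ, pyZ).

Lemma pt_eq a b : px a = px b -> py a = py b -> a = b.
Proof.
move=> hx hy; apply/rowP => j; have [->//|] := eqVneq j ord0.
move=> hj; suff -> : j = lift ord0 ord0 by [].
by case: j hj => -[|[|?]]//= ? _; apply/val_inj.
Qed.

Definition orient a b c : R :=
  (px b - px a) * (py c - py a) - (py b - py a) * (px c - px a).

Lemma orient_cyc a b c : orient a b c = orient b c a.
Proof. rewrite /orient; ring. Qed.
Lemma orient_swap a b c : orient b a c = - orient a b c.
Proof. rewrite /orient; ring. Qed.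
Lemma orient_swapr a b c : orient a c b = - orient a b c.
Proof. rewrite /orient; ring. Qed.
Lemma orient_aab a b : orient a a b = 0.
Proof. rewrite /orient; ring. Qed.
Lemma orient_aba a b : orient a b a = 0.
Proof. rewrite /orient; ring. Qed.
Lemma orient_abb a b : orient a b b = 0.
Proof. rewrite /orient; ring. Qed.

Lemma orient_conv a b x y t :
  orient a b ((1 - t) *: x + t *: y) = (1 - t) * orient a b x + t * orient a b y.
Proof. rewrite /orient !pE; ring. Qed.

Lemma segmentP a b x : segment a b x <->
  exists t : R, [/\ 0 <= t, t <= 1, px x = (1 - t) * px a + t * px b &
    py x = (1 - t) * py a + t * py b].
Proof.
split=> [[t /andP[t0 t1] ->]|[t [t0 t1 hx hy]]].
  by exists t; rewrite !pE.
by exists t; [rewrite t0|apply: pt_eq; rewrite !pE].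
Qed.

Lemma segment_sym a b : segment a b = segment b a.
Proof.
apply/seteqP; split=> x /segmentP[t [t0 t1 hx hy]]; apply/segmentP;
  exists (1 - t); split; rewrite ?hx ?hy; try lra; ring.
Qed.
Lemma segment_l a b : segment a b a.
Proof. by apply/segmentP; exists 0; split; try lra; ring. Qed.
Lemma segment_r a b : segment a b b.
Proof. by rewrite segment_sym; exact: segment_l. Qed.
Lemma segment_xx a x : segment a a x -> x = a.
Proof. by case/segmentP=> t [? ? hx hy]; apply: pt_eq; rewrite ?hx ?hy; ring. Qed.

Lemma segment_conv a b x y : segment a b x -> segment a b y ->
  segment x y `<=` segment a b.
Proof.
move=> /segmentP[s [s0 s1 sx sy]] /segmentP[t [t0 t1 tx ty]] z.
move=> /segmentP[r [r0 r1 rx ry]]; apply/segmentP.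
exists ((1 - r) * s + r * t); split.
- by apply: addr_ge0; apply: mulr_ge0 => //; lra.
- have h1 : (1 - r) * s <= (1 - r) * 1 by apply: ler_wpM2l => //; lra.
  have h2 : r * t <= r * 1 by apply: ler_wpM2l.
  lra.
- rewrite rx sx tx; ring.
- rewrite ry sy ty; ring.
Qed.

Lemma segment_orient0 a b x : segment a b x -> orient a b x = 0.
Proof. move=> /segmentP[t [? ? hx hy]]; rewrite /orient hx hy; ring. Qed.

Lemma orient_seg_gt0 u v a b x : 0 < orient u v a -> 0 < orient u v b ->
  segment a b x -> 0 < orient u v x.
Proof.
move=> ha hb [t /andP[t0 t1] ->]; rewrite orient_conv.
have [->|tn] := eqVneq t 0; first by lra.
have h1 : 0 < t * orient u v b by rewrite mulr_gt0// lt_def tn.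
have h2 : 0 <= (1 - t) * orient u v a by rewrite mulr_ge0//; lra.
lra.
Qed.
Lemma orient_seg_ge0 u v a b x : 0 <= orient u v a -> 0 <= orient u v b ->
  segment a b x -> 0 <= orient u v x.
Proof.
move=> ha hb [t /andP[t0 t1] ->]; rewrite orient_conv.
by apply: addr_ge0; apply: mulr_ge0 => //; lra.
Qed.

Lemma px_seg_ge (k : R) a b x : k <= px a -> k <= px b -> segment a b x -> k <= px x.
Proof.
move=> ha hb /segmentP[t [t0 t1 -> _]].
have h1 : 0 <= (1 - t) * (px a - k) by rewrite mulr_ge0//; lra.
have h2 : 0 <= t * (px b - k) by rewrite mulr_ge0//; lra.
lra.
Qed.
Lemma px_seg_le (k : R) a b x : px a <= k -> px b <= k -> segment a b x -> px x <= k.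
Proof.
move=> ha hb /segmentP[t [t0 t1 -> _]].
have h1 : 0 <= (1 - t) * (k - px a) by rewrite mulr_ge0//; lra.
have h2 : 0 <= t * (k - px b) by rewrite mulr_ge0//; lra.
lra.
Qed.

Lemma on_segment a b z : px a < px b -> orient a b z = 0 ->
  px a <= px z -> px z <= px b -> segment a b z.
Proof.
move=> hab h0 h1 h2; apply/segmentP; exists ((px z - px a) / (px b - px a)).
have hn : px b - px a != 0 by lra.
split.
- by rewrite divr_ge0//; lra.
- by rewrite ler_pdivrMr; lra.
- by field.
- apply/eqP; rewrite -subr_eq0; apply/eqP.
  apply: (mulfI hn); rewrite mulr0 -h0 /orient; by field.
Qed.

(** The affine function [orient a b] changes sign along [x, y]; its zero lies on the line of [a] and
    [b], and the abscissa bounds place it on the segment. *)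
Lemma segment_meet a b x y : px a < px b ->
  px a <= px x -> px x <= px b -> px a <= px y -> px y <= px b ->
  orient a b x <= 0 -> 0 <= orient a b y ->
  exists2 z, segment x y z & segment a b z.
Proof.
move=> hab ax xb ay yb hx hy.
have [e|ne] := eqVneq (orient a b x) 0.
  by exists x; [exact: segment_l|apply: on_segment].
have hx' : orient a b x < 0 by rewrite lt_neqAle ne.
pose t := orient a b x / (orient a b x - orient a b y).
have hd : orient a b x - orient a b y < 0 by lra.
have ht0 : 0 <= t by rewrite /t -mulrNN -invrN divr_ge0//; lra.
have ht1 : t <= 1 by rewrite /t -mulrNN -invrN ler_pdivrMr//; lra.
have hs : segment x y ((1 - t) *: x + t *: y) by exists t; rewrite ?ht0.
exists ((1 - t) *: x + t *: y) => //; apply: on_segment => //.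
- rewrite orient_conv /t; field; lra.
- exact: px_seg_ge hs.
- exact: px_seg_le hs.
Qed.

(* [ray a b x]: the upward vertical ray from [x] meets [a, b]; a point with the abscissa
   of [x] counts as lying to the left of [x]. [cor x y v] is the dual count:
   the downward ray from [v] meets [x, y], with the opposite convention. *)
Definition ray a b x : bool :=
  [|| [&& px a <= px x, px x < px b & orient a b x < 0] |
      [&& px b <= px x, px x < px a & orient b a x < 0]].
Definition cor x y v : bool :=
  [|| [&& px x < px v, px v <= px y & 0 < orient x y v] |
      [&& px y < px v, px v <= px x & 0 < orient y x v]].

Lemma rayC a b x : ray a b x = ray b a x. Proof. by rewrite /ray orbC. Qed.
Lemma corC a b x : cor a b x = cor b a x. Proof. by rewrite /cor orbC. Qed.

Lemma orientK a b x y :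
  orient a b y - orient a b x = orient x y a - orient x y b.
Proof. rewrite /orient; ring. Qed.

Lemma at_abscissa x y (q : R) : px x <= q -> q <= px y -> px x < px y ->
  exists2 z, segment x y z & px z = q.
Proof.
move=> h1 h2 h3; pose t := (q - px x) / (px y - px x).
have hn : px y - px x != 0 by lra.
exists ((1 - t) *: x + t *: y).
  exists t => //; apply/andP; split; first by rewrite divr_ge0//; lra.
  by rewrite ler_pdivrMr; lra.
by rewrite !pE /t; field.
Qed.

(** Over the common abscissae, from [px x] to [px b], disjoint segments keep their vertical order,
    so [x] is below [a, b] exactly when [b] is above [x, y]. *)
Lemma ray_cor_stag a b x y : px a <= px x -> px x < px b -> px b <= px y ->
  (forall z, segment a b z -> segment x y z -> False) ->
  (orient a b x < 0) = (0 < orient x y b).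
Proof.
move=> h1 h2 h3 hd.
have [z sz ez] : exists2 z, segment x y z & px z = px b by apply: at_abscissa; lra.
have hz : orient a b z = (px b - px a) * (py z - py b) by rewrite /orient ez; ring.
have hb : orient x y b = (px y - px x) * (py b - py z).
  move: (segment_orient0 sz); rewrite /orient ez; lra.
have sub z' : segment x z z' -> segment x y z'.
  by apply: segment_conv => //; apply: segment_l.
have ab0 : 0 < px b - px a by lra.
have xy0 : 0 < px y - px x by lra.
apply/idP/idP => h.
  rewrite ltNge; apply/negP => hb'.
  have hz0 : 0 <= orient a b z.
    by rewrite hz mulr_ge0 ?(ltW ab0)//; move: hb'; rewrite hb pmulr_rle0//; lra.
  have [|||||||w w1 w2] := @segment_meet a b x z; try lra.
  exact: (hd w w2 (sub _ w1)).
rewrite ltNge; apply/negP => hb'.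
have hz0 : orient a b z <= 0.
  by rewrite hz pmulr_rle0//; move: h; rewrite hb pmulr_rgt0//; lra.
have [|||||||w w1 w2] := @segment_meet a b z x; try lra.
by apply: (hd w w2 (sub _ _)); rewrite segment_sym.
Qed.

Lemma ray_cor_stag' a b x y : px x < px a -> px a <= px y -> px y < px b ->
  (forall z, segment a b z -> segment x y z -> False) ->
  (orient a b y < 0) = (0 < orient x y a).
Proof.
move=> h1 h2 h3 hd.
have [z sz ez] : exists2 z, segment x y z & px z = px a by apply: at_abscissa; lra.
have hz : orient a b z = (px b - px a) * (py z - py a) by rewrite /orient ez; ring.
have hb : orient x y a = (px y - px x) * (py a - py z).
  move: (segment_orient0 sz); rewrite /orient ez; lra.
have sub z' : segment z y z' -> segment x y z'.
  by apply: segment_conv => //; apply: segment_r.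
have ab0 : 0 < px b - px a by lra.
have xy0 : 0 < px y - px x by lra.
apply/idP/idP => h.
  rewrite ltNge; apply/negP => hb'.
  have hz0 : 0 <= orient a b z.
    by rewrite hz mulr_ge0 ?(ltW ab0)//; move: hb'; rewrite hb pmulr_rle0//; lra.
  have [|||||||w w1 w2] := @segment_meet a b y z; try lra.
  by apply: (hd w w2 (sub _ _)); rewrite segment_sym.
rewrite ltNge; apply/negP => hb'.
have hz0 : orient a b z <= 0.
  by rewrite hz pmulr_rle0//; move: h; rewrite hb pmulr_rgt0//; lra.
have [|||||||w w1 w2] := @segment_meet a b z y; try lra.
exact: (hd w w2 (sub _ w1)).
Qed.

Definition sdisj a b x y := forall z, segment a b z -> segment x y z -> False.

Lemma ray_cor_sorted a b x y : px a <= px b -> px x <= px y -> sdisj a b x y ->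
  ray a b x (+) ray a b y = cor x y a (+) cor x y b.
Proof.
move=> pq rt hd.
have rayE z : ray a b z = [&& px a <= px z, px z < px b & orient a b z < 0].
  rewrite /ray; case: (boolP [&& px b <= px z, px z < px a & orient b a z < 0]).
    by move=> /and3P[]; lra.
  by rewrite orbF.
have corE z : cor x y z = [&& px x < px z, px z <= px y & 0 < orient x y z].
  rewrite /cor; case: (boolP [&& px y < px z, px z <= px x & 0 < orient y x z]).
    by move=> /and3P[]; lra.
  by rewrite orbF.
rewrite !rayE !corE.
have [p_r|r_p] := leP (px a) (px x).
  have p_t := le_trans p_r rt; rewrite p_t /=.
  have [q_r|r_q] := leP (px b) (px x); first by rewrite (ltNge (px y)) (le_trans q_r rt).
  have [q_t|t_q] := leP (px b) (px y); rewrite /=.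
    by rewrite addbF; apply: ray_cor_stag.
  have [hx|hx] := ltP (orient a b x) 0; have [hy|hy] := ltP (orient a b y) 0 => //=.
    by have [|||||||w w1 w2] := @segment_meet a b x y; try lra; case: (hd w).
  have [|||||||w w1 w2] := @segment_meet a b y x; try lra.
  by case: (hd w) => //; rewrite segment_sym.
have r_q := lt_le_trans r_p pq; rewrite r_q /=.
have [p_t|t_p] := leP (px a) (px y) => /=; last first.
  by rewrite (leNgt (px b)) (lt_le_trans t_p pq).
have [q_t|t_q] := leP (px b) (px y) => /=; last first.
  by rewrite addbF; apply: ray_cor_stag'.
have rt' : px x < px y by lra.
have [hx|hx] := ltP 0 (orient x y a); have [hy|hy] := ltP 0 (orient x y b) => //=.
  have [|||||||w w1 w2] := @segment_meet x y b a; try lra.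
  by case: (hd w) => //; rewrite segment_sym.
by have [|||||||w w1 w2] := @segment_meet x y a b; try lra; case: (hd w).
Qed.

Lemma sdisjC a b x y : sdisj a b x y -> sdisj x y a b.
Proof. by move=> h z ? ?; apply: (h z). Qed.
Lemma sdisj_swapl a b x y : sdisj a b x y -> sdisj b a x y.
Proof. by rewrite /sdisj (segment_sym b a). Qed.
Lemma sdisj_swapr a b x y : sdisj a b x y -> sdisj a b y x.
Proof. by rewrite /sdisj (segment_sym y x). Qed.

(** The overlap of the two abscissa intervals has two ends, each the abscissa of one of the four
    points; the left side sees those of [x] and [y], the right side those of [a] and [b]. Disjoint
    segments have the same vertical order at both ends, so the total is even. *)
Lemma ray_cor a b x y : sdisj a b x y ->
  ray a b x (+) ray a b y = cor x y a (+) cor x y b.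
Proof.
move=> hd; wlog pq : a b hd / px a <= px b => [hw|].
  have [|/ltW] := leP (px a) (px b); first exact: hw.
  by move=> /hw-/(_ (sdisj_swapl hd)); rewrite !(rayC b a) addbC (addbC (cor _ _ b)) addbC.
wlog rt : x y hd / px x <= px y => [hw|]; last exact: ray_cor_sorted.
have [|/ltW] := leP (px x) (px y); first exact: hw.
by move=> /hw-/(_ (sdisj_swapr hd)); rewrite !(corC y x) addbC.
Qed.

Lemma mul_lt0_cases (s t : R) : s * t < 0 -> (s < 0 /\ 0 < t) \/ (0 < s /\ t < 0).
Proof.
have [s0|s0|->] := ltgtP s 0; last by rewrite mul0r ltxx.
  by rewrite nmulr_rlt0//; left.
by rewrite pmulr_rlt0//; right.
Qed.

Definition pcross a b x y :=
  orient a b x * orient a b y < 0 /\ orient x y a * orient x y b < 0.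

Lemma pcross_swapl a b x y : pcross a b x y -> pcross b a x y.
Proof. by case=> h1 h2; split; rewrite ?(orient_swap a b) ?mulrNN// mulrC. Qed.
Lemma pcross_swapr a b x y : pcross a b x y -> pcross a b y x.
Proof. by case=> h1 h2; split; rewrite ?(orient_swap x y) ?mulrNN// mulrC. Qed.

(** Cramer's rule; by [orientK] both parameters have the denominator [d], which is nonzero because
    its two terms have opposite signs. *)
Lemma pcross_point a b x y : pcross a b x y -> exists s t : R,
  [/\ 0 < s < 1, 0 < t < 1,
      (1 - t) * px a + t * px b = (1 - s) * px x + s * px y &
      (1 - t) * py a + t * py b = (1 - s) * py x + s * py y].
Proof.
case=> /mul_lt0_cases h1 /mul_lt0_cases h2.
pose d := orient x y a - orient x y b; have hK := orientK a b x y.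
have hd : orient a b y - orient a b x = d by rewrite hK.
have dn : d != 0 by rewrite /d; apply/negP => /eqP; lra.
exists (- orient a b x / d), (orient x y a / d).
have pos (p q : R) : (p < 0 /\ 0 < q) \/ (0 < p /\ q < 0) -> 0 < p / (p - q) < 1.
  case=> -[h h']; last by rewrite divr_gt0 ?ltr_pdivrMr; lra.
  by rewrite -mulrNN -invrN divr_gt0 ?ltr_pdivrMr; lra.
split.
- have -> : - orient a b x / d = orient a b x / (orient a b x - orient a b y).
    by rewrite -hd -[orient a b y - _]opprB invrN mulrNN.
  exact: pos.
- exact: pos.
- have : d * ((1 - orient x y a / d) * px a + orient x y a / d * px b -
          ((1 - - orient a b x / d) * px x + - orient a b x / d * px y)) = 0.
    rewrite /d /orient; field; exact: dn.
  by move/eqP; rewrite mulf_eq0 (negbTE dn) /= subr_eq0 => /eqP.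
- have : d * ((1 - orient x y a / d) * py a + orient x y a / d * py b -
          ((1 - - orient a b x / d) * py x + - orient a b x / d * py y)) = 0.
    rewrite /d /orient; field; exact: dn.
  by move/eqP; rewrite mulf_eq0 (negbTE dn) /= subr_eq0 => /eqP.
Qed.

(** If [x, y] started where [a, b] ends, the crossing point, interior to both, would force both
    segments onto one vertical line, and all orientations would vanish. *)
Lemma pcross_shadow a b x y : px a <= px b -> px x <= px y -> pcross a b x y ->
  px x < px b.
Proof.
move=> pq rt hc; rewrite ltNge; apply/negP => qr.
case: (pcross_point hc) => s [t [/andP[s0 s1] /andP[t0 t1] hx _]].
have h1 : 0 <= (1 - t) * (px b - px a) by rewrite mulr_ge0; lra.
have h2 : 0 <= s * (px y - px x) by rewrite mulr_ge0; lra.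
have /eqP : (1 - t) * (px b - px a) = 0 by lra.
have /eqP : s * (px y - px x) = 0 by lra.
rewrite !mulf_eq0; have /negbTE -> : s != 0 by lra.
have /negbTE -> : 1 - t != 0 by lra.
move=> /= /eqP e1 /eqP e2; case: hc; rewrite /orient.
have -> : px b - px a = 0 by lra.
have -> : px x - px a = 0 by lra.
by rewrite !(mul0r, mulr0) subrr mul0r ltxx.
Qed.

(** At a proper crossing the vertical order is reversed between the two ends of the overlap, so the
    count behind [ray_cor] becomes odd. *)
Lemma ray_cor_cross a b x y : pcross a b x y ->
  ray a b x (+) ray a b y = ~~ (cor x y a (+) cor x y b).
Proof.
move=> hc; wlog pq : a b hc / px a <= px b => [hw|].
  have [|/ltW] := leP (px a) (px b); first exact: hw.
  move=> /hw-/(_ (pcross_swapl hc)).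
  by rewrite !(rayC b a) (addbC (cor _ _ b)).
wlog rt : x y hc / px x <= px y => [hw|].
  have [|/ltW] := leP (px x) (px y); first exact: hw.
  move=> /hw-/(_ (pcross_swapr hc)).
  by rewrite !(corC y x) addbC.
have rayE z : ray a b z = [&& px a <= px z, px z < px b & orient a b z < 0].
  rewrite /ray; case: (boolP [&& px b <= px z, px z < px a & orient b a z < 0]).
    by move=> /and3P[]; lra.
  by rewrite orbF.
have corE z : cor x y z = [&& px x < px z, px z <= px y & 0 < orient x y z].
  rewrite /cor; case: (boolP [&& px y < px z, px z <= px x & 0 < orient y x z]).
    by move=> /and3P[]; lra.
  by rewrite orbF.
rewrite !rayE !corE.
have hK := orientK a b x y.
have h0 := pcross_shadow pq rt hc.
have h3 : px a < px y.
  by apply: (@pcross_shadow x y a b) => //; case: hc; split.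
case: hc => /mul_lt0_cases h1 /mul_lt0_cases h2.
rewrite h0 /=.
have [q_t|t_q] := leP (px b) (px y); have [p_r|r_p] := leP (px a) (px x);
 rewrite ?(ltW h3) ?andbT ?andbF //=; case: h1 => -[x0 y0]; case: h2 => -[a0 b0]; try lra;
 rewrite ?x0 ?y0 ?a0 ?b0 ?(ltNge 0) ?(ltNge _ 0) ?(ltW x0) ?(ltW y0) ?(ltW a0) ?(ltW b0) //.
Qed.
End Coordinates.
Arguments px {R} a.
Arguments py {R} a.
Arguments mkpt {R} s t.

(** * Parity of an edge list *)

Section Parity.
Variable R : realType.
Implicit Types a b c d u v w x y z m : pt R.
Local Notation edge := (pt R * pt R)%type.
Implicit Types (E : seq edge) (e f : edge).

Definition on E z : Prop := exists2 e, e \in E & segment e.1 e.2 z.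
Definition par E z : bool := \big[addb/false]_(e <- E) ray e.1 e.2 z.
(* Every point is an end of an even number of edges, tested against all 0-1 functions. *)
Definition cyc E : Prop :=
  forall g : pt R -> bool, \big[addb/false]_(e <- E) (g e.1 (+) g e.2) = false.
Definition off E x y : Prop := forall z, segment x y z -> ~ on E z.

Lemma on_nil z : ~ on [::] z. Proof. by case. Qed.
Lemma on_cons e E z : on (e :: E) z <-> segment e.1 e.2 z \/ on E z.
Proof.
split=> [[f]|[h|[f fE h]]].
- by rewrite inE => /orP[/eqP ->|fE h]; [left|right; exists f].
- by exists e => //; rewrite inE eqxx.
- by exists f => //; rewrite inE fE orbT.
Qed.
Lemma on_cat E1 E2 z : on (E1 ++ E2) z <-> on E1 z \/ on E2 z.
Proof.
split=> [[f]|[[f fE h]|[f fE h]]].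
- by rewrite mem_cat => /orP[fE h|fE h]; [left|right]; exists f.
- by exists f => //; rewrite mem_cat fE.
- by exists f => //; rewrite mem_cat fE orbT.
Qed.
Lemma on_perm E1 E2 z : perm_eq E1 E2 -> on E1 z <-> on E2 z.
Proof. by move=> /perm_mem h; split=> -[f fE ?]; exists f => //; rewrite (h, =^~ h). Qed.

Lemma par_cons e E z : par (e :: E) z = ray e.1 e.2 z (+) par E z.
Proof. by rewrite /par big_cons. Qed.
Lemma par_cat E1 E2 z : par (E1 ++ E2) z = par E1 z (+) par E2 z.
Proof. by rewrite /par big_cat. Qed.
Lemma par_perm E1 E2 z : perm_eq E1 E2 -> par E1 z = par E2 z.
Proof. exact: perm_big. Qed.
Lemma cyc_perm E1 E2 : perm_eq E1 E2 -> cyc E1 -> cyc E2.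
Proof. by move=> h c g; rewrite -(perm_big _ h) c. Qed.

(** The cycle condition for the test function [cor x y] makes the added terms vanish, so each edge
    can be charged with its ray change together with its dual count. *)
Lemma par_move E x y : cyc E -> par E x (+) par E y =
  \big[addb/false]_(e <- E)
    ((ray e.1 e.2 x (+) ray e.1 e.2 y) (+) (cor x y e.1 (+) cor x y e.2)).
Proof.
by move=> c; rewrite /par big_split /= (c (cor x y)) addbF big_split.
Qed.

Lemma off_sdisj E x y e : off E x y -> e \in E -> sdisj e.1 e.2 x y.
Proof. by move=> h eE z h1 h2; apply: (h z h2); exists e. Qed.

Lemma off_sub E x y x' y' : off E x y -> segment x y x' -> segment x y y' ->
  off E x' y'.
Proof. by move=> h hx hy z hz; apply: h; apply: (segment_conv hx hy). Qed.
Lemma offC E x y : off E x y -> off E y x.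
Proof. by rewrite /off segment_sym. Qed.

Lemma par_const E x y : cyc E -> off E x y -> par E x = par E y.
Proof.
move=> c h; have : par E x (+) par E y = false.
  rewrite (par_move _ _ c) big_seq big1 => // e eE.
  by rewrite ray_cor ?addbb//; apply: off_sdisj h eE.
by case: (par E x); case: (par E y).
Qed.

Lemma par_flip E e E' x y : cyc E -> perm_eq E (e :: E') ->
  pcross e.1 e.2 x y -> off E' x y -> par E x = ~~ par E y.
Proof.
move=> c p hc h; have : par E x (+) par E y = true.
  rewrite (par_move _ _ c) (perm_big _ p) big_cons (ray_cor_cross hc) addNb addbb /=.
  rewrite big_seq big1 => // f fE.
  by rewrite ray_cor ?addbb//; apply: off_sdisj h fE.
by case: (par E x); case: (par E y).
Qed.

Definition inbox (M : R) E := forall e, e \in E ->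
  [/\ `|px e.1| <= M, `|py e.1| <= M, `|px e.2| <= M & `|py e.2| <= M].

Lemma inbox_ex E : exists2 M, 0 < M & inbox M E.
Proof.
elim: E => [|e E [M M0 h]]; first by exists 1.
exists (Num.max M (Num.max (Num.max `|px e.1| `|py e.1|) (Num.max `|px e.2| `|py e.2|))).
  by rewrite lt_max M0.
move=> f; rewrite inE => /orP[/eqP ->|fE].
  by rewrite !le_max !lexx !orbT.
by have [h1 h2 h3 h4] := h f fE; rewrite !le_max h1 h2 h3 h4.
Qed.

Lemma ray_hi a b z (M : R) : py a <= M -> py b <= M -> M < py z -> ray a b z = false.
Proof.
have main a' b' : py a' <= M -> py b' <= M -> M < py z ->
    [&& px a' <= px z, px z < px b' & orient a' b' z < 0] = false.
  move=> ha hb hz; apply/negP => /and3P[h1 h2]; rewrite /orient.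
  have : 0 <= (px b' - px z) * (py z - py a') + (px z - px a') * (py z - py b').
    by apply: addr_ge0; apply: mulr_ge0; lra.
  by lra.
by move=> ha hb hz; rewrite /ray !main.
Qed.

Lemma ray_lo a b z (M : R) : M <= py a -> M <= py b -> py z < M ->
  ray a b z = (px a <= px z) (+) (px b <= px z).
Proof.
have main a' b' : M <= py a' -> M <= py b' -> py z < M -> px a' <= px z -> px z < px b' ->
    orient a' b' z < 0.
  move=> ha hb hz h1 h2; rewrite /orient.
  have : 0 < (px b' - px z) * (py a' - py z) + (px z - px a') * (py b' - py z).
    by rewrite ltr_pwDl ?mulr_gt0 ?mulr_ge0; lra.
  by lra.
move=> ha hb hz; rewrite /ray.
have [h1|h1] := leP (px a) (px z); have [h2|h2] := leP (px b) (px z) => //=.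
- by rewrite main.
- by rewrite main.
Qed.

Lemma par_far (M : R) E z : cyc E -> inbox M E -> M < `|px z| \/ M < `|py z| ->
  par E z = false.
Proof.
move=> c hM; rewrite !ltr_normr /par => -[] /orP[h|h].
- rewrite big_seq big1 // => e /hM[]; rewrite !ler_norml /ray => /andP[? ?] _ /andP[? ?] _.
  by apply/negP => /orP[] /and3P[]; lra.
- rewrite big_seq big1 // => e /hM[]; rewrite !ler_norml /ray => /andP[? ?] _ /andP[? ?] _.
  by apply/negP => /orP[] /and3P[]; lra.
- rewrite big_seq big1 // => e /hM[]; rewrite !ler_norml => _ /andP[? ?] _ /andP[? ?].
  by apply: (@ray_hi _ _ _ M); lra.
(* Below the box an edge is hit exactly when its ends lie on different sides of the vertical through
   [z], so the cycle condition for this indicator applies. *)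
- rewrite -[RHS](c (fun v => px v <= px z)) !big_seq; apply: eq_bigr => e /hM[].
  rewrite !ler_norml => _ /andP[? ?] _ /andP[? ?]; apply: (@ray_lo _ _ _ (- M)); lra.
Qed.

Lemma far_along (M : R) z w : w != 0 ->
  exists2 T : R, 0 < T & M < `|px (z + T *: w)| \/ M < `|py (z + T *: w)|.
Proof.
have far (p q : R) : q != 0 -> exists2 T : R, 0 < T & M < `|p + T * q|.
  move=> q0; have q0' : 0 < `|q| by rewrite normr_gt0.
  exists ((`|M| + `|p| + 1) / `|q|).
    by rewrite divr_gt0//; have := normr_ge0 M; have := normr_ge0 p; lra.
  have h := lerB_dist ((`|M| + `|p| + 1) / `|q| * q) (- p).
  rewrite opprK normrN [_ + p]addrC in h; apply: (lt_le_trans _ h).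
  rewrite normrM normf_div normr_id divfK ?gt_eqF// ger0_norm; last first.
    by have := normr_ge0 M; have := normr_ge0 p; lra.
  by have := ler_norm M; lra.
move=> w0; have [wx|wx] := eqVneq (px w) 0.
  have wy : py w != 0.
    by apply: contra_neq w0 => wy; apply: pt_eq; rewrite ?wx ?wy /px /py mxE.
  by have [T T0 h] := far (py z) (py w) wy; exists T; rewrite ?pE; auto.
by have [T T0 h] := far (px z) (px w) wx; exists T; rewrite ?pE; auto.
Qed.

Lemma segment_ray z w (T : R) y : 0 < T -> segment z (z + T *: w) y ->
  exists2 t : R, 0 <= t <= T & y = z + t *: w.
Proof.
move=> T0 [t /andP[t0 t1] ->]; exists (t * T).
  by rewrite mulr_ge0 ?(ltW T0)//= ler_piMl// ltW.
apply: pt_eq; rewrite !pE; ring.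
Qed.

(** Parity is defined by vertical rays, but a ray in any direction that avoids [E] leads to distant
    points, where the parity is even. *)
Lemma par_ray0 E x w : cyc E -> w != 0 ->
  (forall t : R, 0 <= t -> ~ on E (x + t *: w)) -> par E x = false.
Proof.
move=> c w0 h; have [M M0 hM] := inbox_ex E.
have [T T0 hT] := far_along M x w0.
rewrite (@par_const _ _ (x + T *: w)) // ?(par_far c hM)// => z.
by move=> /(segment_ray T0)[t /andP[t0 _] ->]; apply: h.
Qed.

Lemma par_right E u v x : cyc E -> u != v ->
  (forall e, e \in E -> 0 <= orient u v e.1 /\ 0 <= orient u v e.2) ->
  orient u v x <= 0 -> ~ on E x -> par E x = false.
Proof.
move=> c uv hE hx nx.
(* The normal pointing to the right of [u v]: moving along it lowers [orient u v], hence leads away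
   from [E]. *)
pose w := mkpt (py v - py u) (px u - px v).
have ow t : orient u v (x + t *: w) =
    orient u v x - t * ((px v - px u) ^+ 2 + (py v - py u) ^+ 2).
  rewrite /orient /w !pE; ring.
have d0 : 0 < (px v - px u) ^+ 2 + (py v - py u) ^+ 2.
  rewrite lt_def addr_ge0 ?sqr_ge0// andbT paddr_eq0 ?sqr_ge0// !sqrf_eq0 !subr_eq0.
  by apply: contra_neqN uv => /andP[/eqP h1 /eqP h2]; apply: pt_eq.
apply: (@par_ray0 _ _ w) => //.
  apply: contra_neq uv => w0; apply: pt_eq.
    by have := congr1 py w0; rewrite /w py_mk /py mxE; lra.
  by have := congr1 px w0; rewrite /w px_mk /px mxE; lra.
move=> t t0; have [->|tn] := eqVneq t 0; first by rewrite scale0r addr0.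
case=> e eE he; have [h1 h2] := hE e eE.
have := orient_seg_ge0 h1 h2 he; rewrite ow.
have : 0 < t * ((px v - px u) ^+ 2 + (py v - py u) ^+ 2) by rewrite mulr_gt0// lt_def tn.
lra.
Qed.

Lemma px_continuous : continuous (px : pt R -> R). Proof. exact: coord_continuous. Qed.
Lemma py_continuous : continuous (py : pt R -> R). Proof. exact: coord_continuous. Qed.

Lemma segment_compact_pt a b : compact (segment a b : set (pt R)).
Proof.
have -> : segment a b = (fun t : R => (1 - t) *: a + t *: b) @` `[0, 1]%classic.
  apply/seteqP; split=> x; first by case=> t t01 ->; exists t.
  by case=> t t01 <-; exists t.
apply: continuous_compact; last exact: segment_compact.
apply: continuous_subspaceT => t; apply: cvgD; apply: cvgZr_tmp.
  by apply: cvgB; [exact: cvg_cst|exact: cvg_id].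
exact: cvg_id.
Qed.

Lemma segment_closed a b : closed (segment a b : set (pt R)).
Proof. by apply: compact_closed; [exact: norm_hausdorff|exact: segment_compact_pt]. Qed.

Lemma on_closed E : closed (on E : set (pt R)).
Proof.
elim: E => [|e E h].
  suff -> : (on [::] : set (pt R)) = set0 by exact: closed0.
  by apply/seteqP; split=> x // /on_nil.
suff -> : (on (e :: E) : set (pt R)) = segment e.1 e.2 `|` on E.
  by apply: closedU => //; exact: segment_closed.
by apply/seteqP; split=> x /on_cons.
Qed.

Lemma off_near E x : ~ on E x -> \forall z \near x, ~ on E z.
Proof. by move=> h; apply: (open_nbhs_nbhs (conj (closed_openC (@on_closed E)) h)). Qed.

Lemma segment_normlt x m z : segment x m z -> z != m -> `|z - x| < `|m - x|.
Proof.
move=> [t /andP[t0 t1] ->] ne.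
have -> : (1 - t) *: x + t *: m - x = t *: (m - x).
  by apply: pt_eq; rewrite !pE; ring.
rewrite normrZ ger0_norm// gtr_pMl.
  by rewrite lt_neqAle t1 andbT; apply: contra_neq ne => ->; apply: pt_eq; rewrite !pE; ring.
rewrite normr_gt0 subr_eq0; apply: contra_neq ne => ->.
apply: pt_eq; rewrite !pE; ring.
Qed.

Lemma norm_sub_continuous x : continuous (fun z => `|z - x|).
Proof.
by move=> z; apply: (@cvg_norm _ _ _ (nbhs z)); apply: cvgB; [exact: cvg_id|exact: cvg_cst].
Qed.

(** The part of [x, y] on [E] is compact; its point nearest to [x] is the first one met. *)
Lemma first_hit E x y : off E x y \/
  exists m, [/\ segment x y m, on E m & forall z, segment x m z -> z != m -> ~ on E z].
Proof.
pose K := segment x y `&` on E.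
have cK : compact K by apply: compact_closedI; [exact: segment_compact_pt|exact: on_closed].
have [[k Kk]|nK] := pselect (exists k, K k); last first.
  by left => z hz hE; apply: nK; exists z.
right; have [|||m Km hm] := @EVT_min_rV R _ (fun z => `|z - x|) K.
- by exists k.
- exact: cK.
- apply: continuous_subspaceT; exact: norm_sub_continuous.
move: Km; rewrite inE => -[Km1 Km2].
exists m; split=> // z hz zm hE.
have := hm z; rewrite inE => /(_ (conj (segment_conv (segment_l _ _) Km1 hz) hE)).
by rewrite leNgt segment_normlt.
Qed.

End Parity.

(** * Cutting a polygon along a segment *)

Section Split.
Variable R : realType.
Implicit Types a b c d u v w x y z m : pt R.
Local Notation edge := (pt R * pt R)%type.
Implicit Types (E : seq edge) (e f : edge).

(** Both regions contain the boundary, so that links may run along edges. Strictness is recovered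
    only once the polygon has been placed inside an open component. *)
Definition inner E : set (pt R) := [set z | on E z \/ par E z].
Definition outer E : set (pt R) := [set z | on E z \/ ~~ par E z].

Lemma segment_lin u v m : segment u v m -> exists2 t : R, 0 <= t <= 1 & m = u + t *: (v - u).
Proof. by case=> t t01 ->; exists t => //; apply: pt_eq; rewrite !pE; ring. Qed.

Lemma lin_inj u v (s t : R) : u != v -> u + s *: (v - u) = u + t *: (v - u) -> s = t.
Proof.
move=> uv h; have hx := congr1 px h; have hy := congr1 py h; rewrite !pE in hx hy.
have [ex|nx] := eqVneq (px v - px u) 0; last by apply: (mulIf nx); lra.
have [ey|ny] := eqVneq (py v - py u) 0; last by apply: (mulIf ny); lra.
by case/eqP: uv; apply: pt_eq; lra.
Qed.

Lemma segment_open u v m z : u != v -> segment u v m -> segment u v z ->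
  m != u -> z != u -> ~ segment m z u.
Proof.
move=> uv /segment_lin[s /andP[s0 _] ->] /segment_lin[t /andP[t0 _] ->].
have u0 : u = u + 0 *: (v - u) by rewrite scale0r addr0.
move=> hs ht /segment_lin[r /andP[r0 r1]].
have -> : u + s *: (v - u) + r *: (u + t *: (v - u) - (u + s *: (v - u))) =
    u + ((1 - r) * s + r * t) *: (v - u) by apply: pt_eq; rewrite !pE; ring.
rewrite [X in X = _]u0 => /(lin_inj uv).
have sp : 0 < s by rewrite lt_def s0 andbT; apply: contra_neq hs => ->.
have tp : 0 < t by rewrite lt_def t0 andbT; apply: contra_neq ht => ->.
have [->|rn] := eqVneq r 0; first by lra.
have : 0 < r * t by rewrite mulr_gt0// lt_def rn.
have : 0 <= (1 - r) * s by rewrite mulr_ge0//; lra.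
lra.
Qed.

(** Off the line of [u] and [v] a parallel works; on the line one walks away from the segment. *)
Lemma ray_avoid u v x : u != v -> ~ segment u v x ->
  exists2 w, w != 0 & forall t : R, 0 <= t -> ~ segment u v (x + t *: w).
Proof.
move=> uv nx.
have [h0|h0] := eqVneq (orient u v x) 0; last first.
  exists (v - u) => [|t t0 /segment_orient0]; first by rewrite subr_eq0 eq_sym.
  have -> : orient u v (x + t *: (v - u)) = orient u v x by rewrite /orient !pE; ring.
  by move/eqP; rewrite (negbTE h0).
have [s xs] : exists s : R, x = u + s *: (v - u).
  move: h0; rewrite /orient => h0.
  have [ex|nz] := eqVneq (px v - px u) 0; last first.
    exists ((px x - px u) / (px v - px u)); apply: pt_eq; rewrite !pE; first by field.
    apply: (mulfI nz); rewrite -[LHS]subr0 -h0; field; exact: nz.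
  have ny : py v - py u != 0.
    by apply: contra_neq uv => ey; apply: pt_eq; lra.
  exists ((py x - py u) / (py v - py u)); apply: pt_eq; rewrite !pE; last by field.
  by rewrite ex mulr0 addr0; apply: (mulfI ny); move: h0; rewrite ex; lra.
have [s1|s1] := ltP 1 s.
  exists (v - u) => [|t t0]; first by rewrite subr_eq0 eq_sym.
  have -> : x + t *: (v - u) = u + (s + t) *: (v - u).
    by rewrite xs; apply: pt_eq; rewrite !pE; ring.
  by move=> /segment_lin[r /andP[_ r1]] /(lin_inj uv); lra.
have s0 : s < 0.
  rewrite ltNge; apply/negP => s0; apply: nx; exists s; first by rewrite s0.
  by rewrite xs; apply: pt_eq; rewrite !pE; ring.
exists (u - v) => [|t t0]; first by rewrite subr_eq0.
have -> : x + t *: (u - v) = u + (s - t) *: (v - u).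
  by rewrite xs; apply: pt_eq; rewrite !pE; ring.
by move=> /segment_lin[r /andP[r0 _]] /(lin_inj uv); lra.
Qed.

Lemma near_line (P : set (pt R)) m w : (\forall z \near m, P z) ->
  exists2 d : R, 0 < d & forall t, `|t| <= d -> P (m + t *: w).
Proof.
move=> h; have cw : continuous (fun t : R => m + t *: w).
  move=> t; apply: cvgD; first exact: cvg_cst.
  by apply: cvgZr_tmp; exact: cvg_id.
have /nbhs_ballP[e /= e0 he] : \forall t \near (0 : R), P (m + t *: w).
  by apply: (cw 0); rewrite scale0r addr0.
exists (e / 2); first by rewrite divr_gt0.
move=> t ht; apply: he; rewrite /ball /= sub0r normrN.
by apply: (le_lt_trans ht); rewrite ltr_pdivrMr// ltr_pMr// ltr1n.
Qed.

Lemma pcross_normal u v (t d : R) : u != v -> 0 < t < 1 -> 0 < d ->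
  let m := (1 - t) *: u + t *: v in let w := mkpt (py u - py v) (px v - px u) in
  [/\ pcross u v (m + d *: w) (m - d *: w), 0 < orient u v (m + d *: w) &
      orient u v (m - d *: w) < 0].
Proof.
move=> uv /andP[t0 t1] d0 m w.
pose q := (px v - px u) ^+ 2 + (py v - py u) ^+ 2.
have q0 : 0 < q.
  rewrite lt_def addr_ge0 ?sqr_ge0// andbT paddr_eq0 ?sqr_ge0// !sqrf_eq0 !subr_eq0.
  by apply: contra_neqN uv => /andP[/eqP h1 /eqP h2]; apply: pt_eq.
have dq : 0 < d * q by rewrite mulr_gt0.
have e1 : orient u v (m + d *: w) = d * q by rewrite /orient /m /w /q !pE; ring.
have e2 : orient u v (m - d *: w) = - (d * q) by rewrite /orient /m /w /q !pE; ring.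
have e3 : orient (m + d *: w) (m - d *: w) u = - (2 * t * (d * q)).
  by rewrite /orient /m /w /q !pE; ring.
have e4 : orient (m + d *: w) (m - d *: w) v = 2 * (1 - t) * (d * q).
  by rewrite /orient /m /w /q !pE; ring.
split; rewrite ?e1 ?e2 //; last by lra.
split; rewrite ?e1 ?e2 ?e3 ?e4 ?mulrN ?mulNr oppr_lt0.
  by rewrite mulr_gt0.
by rewrite !mulr_gt0; lra.
Qed.

(* The segment [u, v] closes the chain [E1] from [u] to [v] and the chain [E2] from [v] to [u]
   to cycles; [a1] and [a2] are inner points of the chains. *)
Definition join u v E1 E2 a1 a2 : Prop := [/\ u != v,
  cyc ((v, u) :: E1) /\ cyc ((u, v) :: E2),
  (forall z, on E1 z -> on E2 z -> z = u \/ z = v) /\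
  (forall z, on E1 z \/ on E2 z -> segment u v z -> z = u \/ z = v),
  [/\ on E1 u, on E1 v, on E2 u & on E2 v] &
  [/\ on E1 a1 /\ (a1 != u /\ a1 != v), on E2 a2 /\ (a2 != u /\ a2 != v),
    (forall z, on E1 z -> z != u -> z != v ->
      par ((u, v) :: E2) z = par ((u, v) :: E2) a1) &
    (forall z, on E2 z -> z != u -> z != v ->
      par ((v, u) :: E1) z = par ((v, u) :: E1) a2)]].

Lemma join_sym u v E1 E2 a1 a2 : join u v E1 E2 a1 a2 -> join v u E2 E1 a2 a1.
Proof.
case=> uv [c1 c2] [h12 hd] [k1 k2 k3 k4] [[b1 [b2 b3]] [b4 [b5 b6]] b7 b8].
split=> //; first by rewrite eq_sym.
  split=> z h1 h2; first by case: (h12 z h2 h1); [right|left].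
  have h1' : on E1 z \/ on E2 z by case: h1; [right|left].
  by rewrite segment_sym in h2; case: (hd z h1' h2); [right|left].
by split=> // z ? ? ?; [apply: b8|apply: b7].
Qed.

(** * The two cycles obtained by closing each chain with the chord *)

Section JoinTheory.
Variables (u v a1 a2 : pt R) (E1 E2 : seq edge).
Hypothesis J : join u v E1 E2 a1 a2.
Let P1 := (v, u) :: E1.
Let P2 := (u, v) :: E2.
Let P := E1 ++ E2.

Lemma par_join z : par P z = par P1 z (+) par P2 z.
Proof.
rewrite /P /P1 /P2 par_cat !par_cons /= rayC.
by case: (ray _ _ _); case: (par E1 z); case: (par E2 z).
Qed.

Lemma cyc_join : cyc P.
Proof.
case: J => _ [c1 c2] _ _ _ g; have := c1 g; have := c2 g.
rewrite !big_cons big_cat /=.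
case: (\big[addb/false]_(i <- E1) _); case: (\big[addb/false]_(i <- E2) _) => //.
all: by case: (g u); case: (g v).
Qed.

(** A ray from [x] that avoids the chord is followed to infinity. If it first meets [P] on [E1],
    then [x] has the parity of [E1] with respect to [P2], and symmetrically for [E2]; both are
    excluded, so the ray meets neither cycle. *)
Lemma join_key x : ~ segment u v x -> ~ on P x ->
  par P1 x != par P1 a2 -> par P2 x != par P2 a1 ->
  par P1 x = false /\ par P2 x = false.
Proof.
case: J => uv [c1 c2] [h12 hd] _ [_ _ b7 b8] xd xP n1 n2.
have [w w0 hw] := ray_avoid uv xd.
have [M M0 hM] := inbox_ex (P1 ++ P2).
have M1 : inbox M P1 by move=> e eP; apply: hM; rewrite mem_cat eP.
have M2 : inbox M P2 by move=> e eP; apply: hM; rewrite mem_cat eP orbT.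
have [T T0 hT] := far_along M x w0.
have dray z : segment x (x + T *: w) z -> ~ segment u v z.
  by move=> /(segment_ray T0)[t /andP[t0 _] ->]; apply: hw.
have [ho|[m [xm mP hm]]] := first_hit P x (x + T *: w).
  rewrite (@par_const _ P1 _ (x + T *: w)) ?(@par_const _ P2 _ (x + T *: w)) //.
  - by rewrite !(@par_far _ M).
  - move=> z hz /on_cons[|h]; first exact: dray.
    by apply: (ho z hz); apply/on_cat; right.
  - move=> z hz /on_cons[|h]; first by rewrite segment_sym; apply: dray.
    by apply: (ho z hz); apply/on_cat; left.
have md := dray m xm.
have mu : m != u by apply: contra_notN md => /eqP ->; apply: segment_l.
have mv : m != v by apply: contra_notN md => /eqP ->; apply: segment_r.
have sub z : segment x m z -> segment x (x + T *: w) z.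
  by apply: segment_conv => //; apply: segment_l.
case/on_cat: (mP) => mE.
  have m2 : ~ on E2 m by move=> m2; case: (h12 m mE m2) => /eqP; apply/negP.
  case/negP: n2; rewrite (@par_const _ P2 x m) ?(b7 m)// => z hz /on_cons[|zE].
    by apply: dray; apply: sub.
  have [e|ne] := eqVneq z m; first by apply: m2; rewrite -e.
  by apply: (hm z hz ne); apply/on_cat; right.
have m1 : ~ on E1 m by move=> m1; case: (h12 m m1 mE) => /eqP; apply/negP.
case/negP: n1; rewrite (@par_const _ P1 x m) ?(b8 m)// => z hz /on_cons[|zE].
  by rewrite segment_sym; apply: dray; apply: sub.
have [e|ne] := eqVneq z m; first by apply: m1; rewrite -e.
by apply: (hm z hz ne); apply/on_cat; left.
Qed.

(** Coming from infinity, where both parities are even, the first point of [P] met would lie on one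
    chain, hence inside the cycle of the other, although that cycle has not been crossed; so [P] is
    not met at all. Next to the chord the conclusion is absurd, which rules out that each chain lies
    inside the other's cycle. *)
Lemma join_not_both x : ~ segment u v x -> ~ on P x ->
  par P1 a2 -> par P2 a1 -> par P1 x = false /\ par P2 x = false.
Proof.
case: J => uv [c1 c2] [h12 hd] _ [_ _ b7 b8] xd xP n1 n2.
have [w w0 hw] := ray_avoid uv xd.
have [M M0 hM] := inbox_ex (P1 ++ P2).
have M1 : inbox M P1 by move=> e eP; apply: hM; rewrite mem_cat eP.
have M2 : inbox M P2 by move=> e eP; apply: hM; rewrite mem_cat eP orbT.
have [T T0 hT] := far_along M x w0.
pose y := x + T *: w; have y1 : par P1 y = false := par_far c1 M1 hT.
have y2 : par P2 y = false := par_far c2 M2 hT.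
have dray z : segment x y z -> ~ segment u v z.
  by move=> /(segment_ray T0)[t /andP[t0 _] ->]; apply: hw.
have [ho|[m [xm mP hm]]] := first_hit P y x.
  rewrite (@par_const _ P1 _ y) ?(@par_const _ P2 _ y) //.
  - move=> z hz /on_cons[|h]; first exact: dray.
    by apply: (offC ho hz); apply/on_cat; right.
  - move=> z hz /on_cons[|h]; first by rewrite segment_sym; apply: dray.
    by apply: (offC ho hz); apply/on_cat; left.
rewrite segment_sym in xm; have md := dray m xm.
have mu : m != u by apply: contra_notN md => /eqP ->; apply: segment_l.
have mv : m != v by apply: contra_notN md => /eqP ->; apply: segment_r.
have sub z : segment y m z -> segment x y z.
  by rewrite (segment_sym x); apply: segment_conv; [apply: segment_l|rewrite segment_sym].
case/on_cat: (mP) => mE.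
  have m2 : ~ on E2 m by move=> m2; case: (h12 m mE m2) => /eqP; apply/negP.
  have : par P2 y = par P2 m.
    apply: par_const => // z hz /on_cons[|zE]; first by apply: dray; apply: sub.
    have [e|ne] := eqVneq z m; first by apply: m2; rewrite -e.
    by apply: (hm z hz ne); apply/on_cat; right.
  by rewrite (b7 m mE mu mv) y2 n2.
have m1 : ~ on E1 m by move=> m1; case: (h12 m m1 mE) => /eqP; apply/negP.
have : par P1 y = par P1 m.
  apply: par_const => // z hz /on_cons[|zE]; first by rewrite segment_sym; apply: dray; apply: sub.
  have [e|ne] := eqVneq z m; first by apply: m1; rewrite -e.
  by apply: (hm z hz ne); apply/on_cat; left.
by rewrite (b8 m mE mu mv) y1 n1.
Qed.

Lemma join_diag m z : segment u v m -> segment u v z -> m != u -> m != v ->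
  z != u -> z != v -> ~ on P z /\ par P m = par P z.
Proof.
move=> sm sz mu mv zu zv; case: J => uv _ [_ hd] _ _.
have nP z' : segment u v z' -> z' != u -> z' != v -> ~ on P z'.
  by move=> hz nu nv /on_cat h; case: (hd z' h hz) => /eqP; apply/negP.
split; first exact: nP.
apply: par_const; first exact: cyc_join.
move=> y hy; apply: nP; first exact: (segment_conv sm sz hy).
  by apply/eqP => e; apply: (segment_open uv sm sz mu zu); rewrite -e.
apply/eqP => e; have vu : v != u by rewrite eq_sym.
by apply: (@segment_open v u m z vu) => //; rewrite 1?segment_sym// -e segment_sym.
Qed.

(** Two probes close to [m] on either side of the chord: crossing it flips the parity of both
    partial cycles but not that of [P], to which the chord does not belong. *)
Lemma join_sides m : segment u v m -> m != u -> m != v -> exists x y,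
  [/\ ~ segment u v x /\ ~ on P x, ~ segment u v y /\ ~ on P y,
      par P1 x = ~~ par P1 y, par P2 x = ~~ par P2 y & par P x = par P m].
Proof.
case: J => uv [c1 c2] [h12 hd] _ _ sm mu mv.
case: sm (sm) => t /andP[t0 t1] em sm.
have nP : ~ on P m by move=> /on_cat h; case: (hd m h sm) => /eqP; apply/negP.
pose w := mkpt (py u - py v) (px v - px u).
have [d d0 hD] := near_line w (off_near nP).
have t01 : 0 < t < 1.
  rewrite lt_def t0 lt_def t1 !andbT; apply/andP; split.
    by apply: contra_neq mu => e; rewrite em e; apply: pt_eq; rewrite !pE; ring.
  by apply: contra_neq mv => e; rewrite em -e; apply: pt_eq; rewrite !pE; ring.
have := pcross_normal uv t01 d0; rewrite /= -em => -[pc ox oy].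
pose x := m + d *: w; pose y := m - d *: w.
have line z : segment x y z -> exists2 s, `|s| <= d & z = m + s *: w.
  case=> s /andP[s0 s1] ->; exists (d - 2 * s * d).
    have h1 : 0 <= s * d by rewrite mulr_ge0// ltW.
    have h2 : s * d <= d by rewrite ler_piMl// ltW.
    by rewrite ler_norml; lra.
  by apply: pt_eq; rewrite !pE; ring.
have o z : segment x y z -> ~ on P z by move=> /line[s hs ->]; apply: hD.
have o1 : off E1 x y by move=> z hz h; apply: (o z hz); apply/on_cat; left.
have o2 : off E2 x y by move=> z hz h; apply: (o z hz); apply/on_cat; right.
have nd z : orient u v z != 0 -> ~ segment u v z.
  by move=> /eqP h /segment_orient0.
have xd : ~ segment u v x by apply: nd; rewrite gt_eqF.
have yd : ~ segment u v y by apply: nd; rewrite lt_eqF.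
exists x, y; split.
- by split=> //; apply: o; apply: segment_l.
- by split=> //; apply: o; apply: segment_r.
- by apply: par_flip c1 _ _ o1; [exact: perm_refl|exact: pcross_swapl].
- by apply: par_flip c2 _ _ o2; [exact: perm_refl|].
- apply: par_const; first exact: cyc_join.
  move=> z hz; apply: o; apply: segment_conv hz; first exact: segment_l.
  exists (1 / 2); first by lra.
  by rewrite /x /y; apply: pt_eq; rewrite !pE; field.
Qed.

Lemma join_mid : exists m, [/\ segment u v m, m != u & m != v].
Proof.
case: J => uv _ _ _ _; exists (u + (1 / 2) *: (v - u)).
have hu : u = u + 0 *: (v - u) by rewrite scale0r addr0.
have hv : v = u + 1 *: (v - u) by apply: pt_eq; rewrite !pE; ring.
split.
- by exists (1 / 2); [lra|apply: pt_eq; rewrite !pE; field].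
- by apply/eqP; rewrite [X in _ = X]hu => /(lin_inj uv); lra.
- by apply/eqP; rewrite [X in _ = X]hv => /(lin_inj uv); lra.
Qed.

Lemma on_join z : on P1 z -> on P z \/ segment u v z /\ z != u /\ z != v.
Proof.
case: J => _ _ _ [k1 k2 _ _] _ /on_cons[/=|h]; last by left; apply/on_cat; left.
rewrite segment_sym => h; have [->|zu] := eqVneq z u; first by left; apply/on_cat; left.
have [->|zv] := eqVneq z v; first by left; apply/on_cat; left.
by right.
Qed.

(** If the chord runs inside [P], neither chain lies inside the other's cycle. By [join_key] no
    point off [P] and off the chord is then inside both cycles, so a point inside [P1] is inside
    [P]. *)
Lemma inner_join_sub m : segment u v m -> m != u -> m != v -> par P m ->
  inner P1 `<=` inner P.
Proof.
move=> sm mu mv pm z.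
have [x [y [[xd xP] [yd yP] x1 x2 xm]]] := join_sides sm mu mv.
have kx := join_key xd xP; have ky := join_key yd yP.
have nx := join_not_both xd xP; have ny := join_not_both yd yP.
rewrite par_join pm in xm.
(* Finite check on the two probes: all other values contradict [join_key] or [join_not_both]. *)
have [e1 e2] : par P1 a2 = false /\ par P2 a1 = false.
  move: x1 x2 xm kx ky nx ny.
  case: (par P1 x); case: (par P2 x); case: (par P1 y); case: (par P2 y);
  case: (par P1 a2); case: (par P2 a1) => //= _ _ _ h1 h2 h3 h4;
  by [case: (h1 isT isT)|case: (h2 isT isT)|case: (h3 isT isT)|case: (h4 isT isT)].
have diag : segment u v z -> z != u -> z != v -> par P z.
  by move=> sz zu zv; have [_ <-] := join_diag sm sz mu mv zu zv.
case=> [/on_join[|[sz [zu zv]]]|p1].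
- by left.
- by right; apply: diag.
have [zP|zP] := pselect (on P z); first by left.
have [zd|zd] := pselect (segment u v z).
  right; apply: diag => //; case: J => _ _ _ [k1 k2 _ _] _;
  by apply: contra_notN zP => /eqP ->; apply/on_cat; left.
right; rewrite par_join p1 /=; apply/negP => p2.
by have [||] := join_key zd zP; rewrite ?p1 ?p2 ?e1 ?e2.
Qed.

Lemma inner_join_cover : inner P `<=` inner P1 `|` inner P2.
Proof.
move=> z [/on_cat[] h|]; first by left; left; apply/on_cons; right.
  by right; left; apply/on_cons; right.
by rewrite par_join => h; case: (boolP (par P1 z)) h => /= [h _|_ h]; [left|right]; right.
Qed.

(** With the chord outside [P] and [E2] outside [P1], the cycle [P1] bounds a pocket: [E1] lies
    inside [P2], and passing from [P] to [P2] fills the pocket. *)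
Lemma outer_join m : segment u v m -> m != u -> m != v -> par P m = false ->
  par P1 a2 = false -> [/\ outer P `<=` inner P1 `|` outer P2,
    inner P1 `<=` outer P, outer P2 `<=` outer P & par P2 a1].
Proof.
move=> sm mu mv pm e1.
have [x [y [[xd xP] [yd yP] x1 x2 xm]]] := join_sides sm mu mv.
have kx := join_key xd xP; have ky := join_key yd yP.
have nx := join_not_both xd xP; have ny := join_not_both yd yP.
rewrite par_join pm in xm.
have e2 : par P2 a1 = true.
  move: x1 x2 xm kx ky nx ny; rewrite e1.
  case: (par P1 x); case: (par P2 x); case: (par P1 y); case: (par P2 y);
  case: (par P2 a1) => //= _ _ _ h1 h2 h3 h4;
  by [case: (h1 isT isT)|case: (h2 isT isT)].
have diag z : segment u v z -> z != u -> z != v -> ~~ par P z.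
  by move=> sz zu zv; have [_ <-] := join_diag sm sz mu mv zu zv; rewrite pm.
have key z : on P z \/ (~ on P z /\ segment u v z /\ z != u /\ z != v) \/
    (~ on P z /\ ~ segment u v z /\ (par P1 z -> par P2 z)).
  have [zP|zP] := pselect (on P z); first by left.
  right; have [zd|zd] := pselect (segment u v z); [left|right].
    split=> //; split=> //; case: J => _ _ _ [k1 k2 _ _] _.
    by split; apply: contra_notN zP => /eqP ->; apply/on_cat; left.
  split=> //; split=> // p1; apply/negPn/negP => p2.
  by have [||] := join_key zd zP; rewrite ?p1 ?e1 ?e2 ?(negbTE p2).
split=> //.
- move=> z [/on_cat[] h|]; first by left; left; apply/on_cons; right.
    by right; left; apply/on_cons; right.
  rewrite par_join => h; case: (key z) => [/on_cat[] zP|[[_ [zd _]]|[_ [_ hz]]]].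
  + by left; left; apply/on_cons; right.
  + by right; left; apply/on_cons; right.
  + by right; left; apply/on_cons; left.
  + move: h hz; case: (boolP (par P1 z)) => /= [p1 _ _|p1 p2 _]; first by left; right.
    by right; right.
- move=> z; case: (key z) => [zP _|[[_ [zd [zu zv]]] _|[zP [zd hz]]]]; first by left.
    by right; apply: diag.
  case=> [/on_join[//|[//]]|p1].
  by right; rewrite par_join p1 hz.
- move=> z; case: (key z) => [zP _|[[_ [zd [zu zv]]] _|[zP [zd hz]]]]; first by left.
    by right; apply: diag.
  case=> [/on_cons[//|h]|p2]; first by left; apply/on_cat; right.
  right; rewrite par_join (negbTE p2) addbF; apply: contra p2; exact: hz.
Qed.
End JoinTheory.

(** Some cycle is a pocket: if each chain were inside the other's cycle, neither probe at the chord
    would be inside a cycle, although crossing the chord flips the parity. *)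
Lemma outer_join_alt u v E1 E2 a1 a2 m : join u v E1 E2 a1 a2 ->
  segment u v m -> m != u -> m != v -> par (E1 ++ E2) m = false ->
  par ((v, u) :: E1) a2 = false \/ par ((u, v) :: E2) a1 = false.
Proof.
move=> J sm mu mv pm; have [x [y [[xd xP] [yd yP] x1 x2 xm]]] := join_sides J sm mu mv.
have := join_not_both J xd xP; have := join_not_both J yd yP; move: x1 x2.
case: (par _ a2); last by left.
case: (par _ a1); last by right.
by case: (par _ x) => /=; case: (par _ y) => //= _ _ h1 h2;
 [case: (h2 isT isT)|case: (h1 isT isT)].
Qed.
End Split.

(** * Polygons as vertex sequences in general position *)

Section Polygon.
Variable R : realType.
Implicit Types a b c d u v w x y z m : pt R.
Local Notation edge := (pt R * pt R)%type.
Implicit Types (E : seq edge) (e f : edge) (s t Q D : seq (pt R)).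

Fixpoint pe a s : seq edge := if s is b :: s' then (a, b) :: pe b s' else [::].
Definition ed Q : seq edge := if Q is a :: s then pe a (rcons s a) else [::].

Lemma pe_cat a s t : pe a (s ++ t) = pe a s ++ pe (last a s) t.
Proof. by elim: s a => //= b s ih a; rewrite ih. Qed.
Lemma pe_rcons a s b : pe a (rcons s b) = rcons (pe a s) (last a s, b).
Proof. by rewrite -cats1 pe_cat cats1. Qed.

Lemma cyc_ed Q : cyc (ed Q).
Proof.
case: Q => [|a s] g; first by rewrite big_nil.
have main : forall s b, \big[addb/false]_(e <- pe b s) (g e.1 (+) g e.2) =
    g b (+) g (last b s).
  elim=> [|c t ih] b /=; first by rewrite big_nil addbb.
  by rewrite big_cons ih /=; case: (g b); case: (g c); case: (g _).
by rewrite /ed main last_rcons addbb.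
Qed.

Lemma ed_rot1 Q : perm_eq (ed (rot 1 Q)) (ed Q).
Proof.
case: Q => [|a [|b s]] //; rewrite rot1_cons /= !pe_rcons !last_rcons /=.
by rewrite perm_rcons.
Qed.

Lemma ed_rot k Q : perm_eq (ed (rot k Q)) (ed Q).
Proof.
elim: k => [|k ih]; first by rewrite rot0.
have [hk|hk] := ltnP k (size Q).
  by apply: perm_trans ih; rewrite -[k.+1]/(1 + k)%N rotD//; apply: ed_rot1.
by move: ih; rewrite !rot_oversize// ltnW.
Qed.

Lemma mem_pe a s e : e \in pe a s -> e.1 \in belast a s /\ e.2 \in s.
Proof.
elim: s a => //= b s ih a; rewrite inE => /orP[/eqP ->|/ih[h1 h2]] /=; rewrite !inE ?eqxx//.
by rewrite h1 h2 !orbT.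
Qed.

Lemma mem_ed Q e : e \in ed Q -> e.1 \in Q /\ e.2 \in Q.
Proof.
case: Q => [|a s] //= /mem_pe[]; rewrite belast_rcons mem_rcons => h1 h2.
by split.
Qed.

Lemma ed_split u s1 v s2 :
  ed (u :: s1 ++ v :: s2) = pe u (rcons s1 v) ++ pe v (rcons s2 u).
Proof. by rewrite /= rcons_cat /= -cat_rcons pe_cat last_rcons. Qed.

Lemma ed_close u s v : perm_eq (ed (u :: rcons s v)) ((v, u) :: pe u (rcons s v)).
Proof. by rewrite /= pe_rcons last_rcons perm_rcons. Qed.

Definition cross a b c d : R :=
  (px b - px a) * (py d - py c) - (py b - py a) * (px d - px c).

(* General position: no two vertices on a vertical line, and no two lines through different
   pairs of vertices parallel; in particular no three vertices are collinear. *)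
Definition gp D : Prop :=
  (forall a b, a \in D -> b \in D -> a != b -> px a != px b) /\
  (forall a b c d, a \in D -> b \in D -> c \in D -> d \in D ->
     a != b -> c != d -> (a, b) != (c, d) -> (a, b) != (d, c) -> cross a b c d != 0).

(* Guarding by distinctness of the end points, an edge never conflicts with itself or with its
   neighbours: in general position these meet only in the common vertex. *)
Definition nc e f : Prop :=
  e.1 != f.1 -> e.1 != f.2 -> e.2 != f.1 -> e.2 != f.2 -> sdisj e.1 e.2 f.1 f.2.

Definition sp Q : Prop := [/\ uniq Q, (2 < size Q)%N, gp Q &
  forall e f, e \in ed Q -> f \in ed Q -> nc e f].

Lemma nc_sym e f : nc e f -> nc f e.
Proof. by move=> h ? ? ? ?; apply/sdisjC/h; rewrite eq_sym. Qed.
Lemma nc_swap a b f : nc (a, b) f -> nc (b, a) f.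
Proof. by move=> h ? ? ? ?; apply/sdisj_swapl/h. Qed.

Lemma gp_sub D D' : {subset D' <= D} -> gp D -> gp D'.
Proof.
move=> sD [h1 h2]; split=> [a b /sD ? /sD ?|a b c d /sD ? /sD ? /sD ? /sD ?].
  exact: h1.
exact: h2.
Qed.

Lemma gp_orient D a b c : gp D -> a \in D -> b \in D -> c \in D ->
  a != b -> a != c -> b != c -> orient a b c != 0.
Proof.
move=> [_ h] aD bD cD ab ac bc; have := h a b a c aD bD aD cD ab ac.
rewrite !xpair_eqE eqxx /= (negbTE bc) (negbTE ac) /= => /(_ isT isT).
by rewrite /cross /orient.
Qed.

Lemma gp_vertex D a b c : gp D -> a \in D -> b \in D -> c \in D ->
  a != b -> a != c -> b != c -> ~ segment a b c.
Proof.
by move=> g aD bD cD ab ac bc /segment_orient0/eqP; apply/negP; apply: (gp_orient g).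
Qed.

Lemma meet_common a b c z : orient a b c != 0 -> segment a b z -> segment a c z -> z = a.
Proof.
move=> h /segment_lin[s _ ->] /segment_orient0.
have -> : orient a c (a + s *: (b - a)) = - s * orient a b c.
  by rewrite /orient !pE; ring.
move/eqP; rewrite mulf_eq0 (negbTE h) orbF oppr_eq0 => /eqP ->.
by rewrite scale0r addr0.
Qed.

Lemma gp_meet D a b c z : gp D -> a \in D -> b \in D -> c \in D ->
  a != b -> a != c -> b != c -> segment a b z -> segment a c z -> z = a.
Proof. by move=> g aD bD cD ab ac bc; apply: meet_common; apply: (gp_orient g). Qed.

Lemma orient_same_side u v a b z : 0 < orient u v a * orient u v b ->
  segment a b z -> orient u v z != 0.
Proof.
have [h|h|->] := ltgtP (orient u v a) 0; last by rewrite mul0r ltxx.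
  rewrite nmulr_rgt0// => hb hz; rewrite -oppr_eq0 -orient_swap gt_eqF//.
  by apply: orient_seg_gt0 hz; rewrite orient_swap; lra.
by rewrite pmulr_rgt0// => hb hz; rewrite gt_eqF//; apply: orient_seg_gt0 hz.
Qed.

Lemma same_side_sdisj a b x y : 0 < orient x y a * orient x y b -> sdisj a b x y.
Proof.
move=> h z hz /segment_orient0/eqP; apply/negP; exact: orient_same_side hz.
Qed.

Lemma chain_const E a s : cyc E -> (forall e, e \in pe a s -> off E e.1 e.2) ->
  forall z, on (pe a s) z -> par E z = par E a.
Proof.
move=> c; elim: s a => [|b s ih] a h z /=; first by case.
have hab : off E a b by apply: (h (a, b)); rewrite inE eqxx.
case/on_cons => [hz|hz].
  by apply: par_const => //; apply: off_sub hab _ (segment_l _ _).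
rewrite (ih b) ?(par_const c hab)// => e he; apply: h.
by rewrite inE he orbT.
Qed.

Lemma pe_neq a s e : uniq (a :: s) -> e \in pe a s -> e.1 != e.2.
Proof.
elim: s a => //= b s ih a /andP[]; rewrite !inE negb_or => /andP[ab _] us.
by move=> /orP[/eqP ->//|]; apply: ih.
Qed.

(** The inner vertex [g] keeps the edge apart from the cut and from the other chain in the case
    analyses that follow. *)
Lemma pe_mid u s v e : s != [::] -> uniq (u :: rcons s v) -> e \in pe u (rcons s v) ->
  exists g h, [/\ g \in s, h \in u :: rcons s v, g != h & e = (g, h) \/ e = (h, g)].
Proof.
move=> s0 us eP; have ne := pe_neq us eP; have [m1 m2] := mem_pe eP.
move: eP; rewrite pe_rcons mem_rcons inE => /orP[/eqP ee|/mem_pe[_ m3]].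
  exists (last u s), v; split.
  - by case: (s) s0 => // b s' _; rewrite /= mem_last.
  - by rewrite inE mem_rcons mem_head orbT.
  - by move: ne; rewrite ee.
  - by left.
exists e.2, e.1; split=> //; last by right; case: (e).
  by apply: mem_belast m1.
by rewrite eq_sym.
Qed.

(** * Cutting a polygon along an admissible segment between two vertices *)

Section Diagonal.
Variables (u v : pt R) (s1 s2 : seq (pt R)).
Let Q := u :: s1 ++ v :: s2.
Hypothesis (spQ : sp Q) (s10 : s1 != [::]) (s20 : s2 != [::]).
Hypothesis ncd : forall f, f \in ed Q -> nc (u, v) f.

Let E1 := pe u (rcons s1 v).
Let E2 := pe v (rcons s2 u).

Lemma diag_uniq : [/\ uniq (u :: rcons s1 v), uniq (v :: rcons s2 u) &
  forall z, z \in s1 -> z \in v :: rcons s2 u -> False].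
Proof.
case: spQ => uQ _ _ _.
have p : perm_eq Q ((u :: rcons s1 v) ++ s2) by rewrite /Q -cat_rcons.
have p2 : perm_eq Q ((v :: rcons s2 u) ++ s1).
  rewrite /Q -[v :: rcons _ _]/(rcons (v :: s2) u) cat_rcons.
  by rewrite -[u :: s1 ++ _]cat_cons perm_catC.
have := uQ; rewrite (perm_uniq p) cat_uniq => /and3P[h1 _ _].
have := uQ; rewrite (perm_uniq p2) cat_uniq => /and3P[h2 /hasPn h3 _].
by split=> // z z1 z2; have := h3 z z1; rewrite /= z2.
Qed.

Lemma diag_mem z : z \in u :: rcons s1 v \/ z \in v :: rcons s2 u -> z \in Q.
Proof.
rewrite /Q !inE !mem_rcons !mem_cat !inE => -[] /or3P[]->; rewrite ?orbT//.
Qed.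

Lemma diag_edge e : e \in E1 \/ e \in E2 -> e \in ed Q.
Proof. by rewrite /Q ed_split mem_cat => -[]->; rewrite ?orbT. Qed.

(** General position reduces incidences to vertices: edges with a common vertex meet only there, all
    others are disjoint by [nc]. Both chains have inner vertices, so [head] returns the first of
    these and never its default. *)
Lemma diag_join : join u v E1 E2 (head u s1) (head v s2).
Proof.
case: (spQ) => uQ _ gQ ncQ; have [u1 u2 dj] := diag_uniq.
have us1 z : z \in s1 -> z != u /\ z != v.
  move=> z1; move: u1; rewrite cons_uniq rcons_uniq mem_rcons inE negb_or.
  move=> /and3P[/andP[_ n1] n2 _].
  by split; [apply: contraNneq n1 => <-|apply: contraNneq n2 => <-].
have us2 z : z \in s2 -> z != u /\ z != v.
  move=> z1; move: u2; rewrite cons_uniq rcons_uniq mem_rcons inE negb_or.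
  move=> /and3P[/andP[_ n1] n2 _].
  by split; [apply: contraNneq n2 => <-|apply: contraNneq n1 => <-].
have uv : u != v.
  by move: u1; rewrite cons_uniq mem_rcons inE negb_or => /andP[/andP[]].
have mQ1 z : z \in u :: rcons s1 v -> z \in Q by move=> h; apply: diag_mem; left.
have mQ2 z : z \in v :: rcons s2 u -> z \in Q by move=> h; apply: diag_mem; right.
have m1 z : z \in s1 -> z \in u :: rcons s1 v.
  by move=> h; rewrite inE mem_rcons inE h !orbT.
have m2 z : z \in s2 -> z \in v :: rcons s2 u.
  by move=> h; rewrite inE mem_rcons inE h !orbT.
have uQm : u \in Q by rewrite mem_head.
have vQm : v \in Q by rewrite /Q inE mem_cat mem_head !orbT.
have h12 z : on E1 z -> on E2 z -> z = u \/ z = v.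
  (* Each of the two edges has an inner vertex of its own chain as an end, so they can share only
     [u] or [v]. *)
  move=> [e e1 se] [f f2 sf].
  have [g [h [g1 h1 gh eE]]] := pe_mid s10 u1 e1.
  have [k [l [k2 l2 kl fE]]] := pe_mid s20 u2 f2.
  have sgh : segment g h z by case: eE se => -> //=; rewrite segment_sym.
  have skl : segment k l z by case: fE sf => -> //=; rewrite segment_sym.
  have gk : g != k by apply/eqP => e'; apply: (dj g g1); rewrite e' m2.
  have gl : g != l by apply/eqP => e'; apply: (dj g g1); rewrite e'.
  have hk : h != k.
    apply/eqP => e'; move: h1; rewrite e' inE mem_rcons inE => /or3P[].
    + by have [/negbTE ->] := us2 k k2.
    + by have [_ /negbTE ->] := us2 k k2.
    + by move=> k1; apply: (dj k k1); apply: m2.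
  have [e'|hl] := eqVneq h l.
    have -> : z = h.
      apply: (@gp_meet Q h g k z gQ) => //; rewrite 1?eq_sym//.
      - exact: mQ1.
      - by apply/mQ1/m1.
      - by apply/mQ2/m2.
      - by rewrite segment_sym.
      - by rewrite e' segment_sym.
    move: h1; rewrite inE mem_rcons inE => /or3P[/eqP|/eqP|h1]; auto.
    by case: (dj h h1); rewrite e'.
  exfalso; have := ncQ e f (diag_edge (or_introl e1)) (diag_edge (or_intror f2)).
  by case: eE => ->; case: fE => -> /(_ _ _ _ _)hd; apply: (hd _ _ _ _ z) => //=; rewrite 1?segment_sym.
have hd z : on E1 z \/ on E2 z -> segment u v z -> z = u \/ z = v.
  have main e g h : e \in ed Q -> segment e.1 e.2 z -> g \in Q -> h \in Q -> g != h ->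
      e = (g, h) \/ e = (h, g) -> g != u -> g != v -> segment u v z -> z = u \/ z = v.
    move=> eQ se gQ' hQ gh eE gu gv suv.
    have sgh : segment g h z by case: eE se => -> //=; rewrite segment_sym.
    have [hu|hu] := eqVneq h u.
      left; apply: (@gp_meet Q u g v z gQ) => //; rewrite 1?eq_sym//.
      by rewrite -hu segment_sym.
    have [hv|hv] := eqVneq h v.
      right; apply: (@gp_meet Q v g u z gQ) => //; rewrite 1?eq_sym//.
        by rewrite -hv segment_sym.
      by rewrite segment_sym.
    exfalso; have := ncd eQ; rewrite !(eq_sym _ u) !(eq_sym _ v) in gu gv hu hv.
    by case: eE => -> hn; apply: (hn _ _ _ _ z) => //=; rewrite 1?segment_sym.
  case=> -[e eP se].
    have [g [h [g1 h1 gh eE]]] := pe_mid s10 u1 eP; have [gu gv] := us1 g g1.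
    by apply: (main e g h) => //; [apply: diag_edge; left|apply/mQ1/m1|apply: mQ1].
  have [g [h [g1 h1 gh eE]]] := pe_mid s20 u2 eP; have [gu gv] := us2 g g1.
  by apply: (main e g h) => //; [apply: diag_edge; right|apply/mQ2/m2|apply: mQ2].
have cP1 : cyc ((v, u) :: E1) by apply: cyc_perm (ed_close _ _ _) (cyc_ed _).
have cP2 : cyc ((u, v) :: E2) by apply: cyc_perm (ed_close _ _ _) (cyc_ed _).
have onl (a b : pt R) s : on (pe a (rcons s b)) a.
  case: s => [|c s]; apply/on_cons; left; exact: segment_l.
have onr (a b : pt R) s : on (pe a (rcons s b)) b.
  rewrite pe_rcons; exists (last a s, b); last exact: segment_r.
  by rewrite mem_rcons mem_head.
(* A chain without its ends [a] and [b] has constant parity: edges between inner vertices avoid [E],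
   and the first and last edge meet it at most in [a] and [b]. *)
have key (a b : pt R) s E : a != b -> s != [::] -> uniq (a :: rcons s b) -> cyc E ->
    {subset a :: rcons s b <= Q} ->
    (forall z, on (pe a (rcons s b)) z -> on E z -> z = a \/ z = b) ->
    forall z, on (pe a (rcons s b)) z -> z != a -> z != b -> par E z = par E (head a s).
  case: s => // c s ab _ us cE sQ hE z.
  have ca : c != a by move: us; rewrite /= inE eq_sym negb_or => /andP[/andP[]].
  have sz y : y \in c :: s -> y != a /\ y != b.
    move=> yc; move: us; rewrite cons_uniq rcons_uniq mem_rcons inE negb_or.
    by move=> /and3P[/andP[_ n1] n2 _]; split;
      [apply: contraNneq n1 => <-|apply: contraNneq n2 => <-].
  have offi e : e \in pe c s -> off E e.1 e.2.
    move=> ei; have [k1 k2] := mem_pe ei; have k1' := mem_belast k1.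
    have k2' : e.2 \in c :: s by rewrite inE k2 orbT.
    have [n1 n2] := sz _ k1'; have [n3 n4] := sz _ k2'.
    have ne : e.1 != e.2.
      apply: pe_neq ei; move: us; rewrite -rcons_cons rcons_cons /= => /andP[_].
      by rewrite rcons_uniq mem_rcons inE negb_or -andbA => /and3P[_ -> /andP[]].
    have inQ y : y \in c :: s -> y \in Q.
      by move=> hy; apply: sQ; rewrite in_cons mem_rcons [y \in b :: _]in_cons hy !orbT.
    have aQ : a \in Q by apply: sQ; rewrite mem_head.
    have bQ : b \in Q by apply: sQ; rewrite inE mem_rcons mem_head orbT.
    move=> y ey /hE[|ya|ya].
    - exists e => //; rewrite rcons_cons /= inE pe_rcons mem_rcons inE ei !orbT//.
    - by move: ey; rewrite ya; apply: (gp_vertex gQ) => //; apply: inQ.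
    - by move: ey; rewrite ya; apply: (gp_vertex gQ) => //; apply: inQ.
  have cs := chain_const cE offi.
  have inQ y : y \in c :: s -> y \in Q.
    by move=> hy; apply: sQ; rewrite in_cons mem_rcons [y \in b :: _]in_cons hy !orbT.
  have aQ : a \in Q by apply: sQ; rewrite mem_head.
  have bQ : b \in Q by apply: sQ; rewrite inE mem_rcons mem_head orbT.
  rewrite rcons_cons /= => /on_cons[/= hz|hp] za zb.
    apply: par_const => // y hy yE.
    have yac : segment a c y by apply: segment_conv hy => //; exact: segment_r.
    have [|ya|yb] := hE y _ yE.
    + by exists (a, c); rewrite // rcons_cons /= mem_head.
    + rewrite ya in hy.
      by apply: (@segment_open _ a c z c) hy => //; rewrite 1?eq_sym//; apply: segment_r.
    + move: yac; rewrite yb; apply: (gp_vertex gQ) => //; rewrite 1?eq_sym//.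
        by apply: inQ; rewrite mem_head.
      by rewrite eq_sym; have [] := sz c (mem_head _ _).
  move: hp; rewrite pe_rcons -cats1 => /on_cat[/cs//|].
  case=> e; rewrite inE => /eqP -> /= hz.
  have lc : last c s \in c :: s by apply: mem_last.
  have [la lb] := sz _ lc.
  have -> : par E c = par E (last c s).
    case: (s) cs => //= d s' cs; symmetry; apply: cs.
    have := mem_last d s'; rewrite -[last d s']/(last c (d :: s')).
    by rewrite lastI /= => _; elim: s' (c) (d) => [|k s' ih] c' d' /=;
     [exists (c', d'); rewrite ?mem_head//; exact: segment_r|apply/on_cons; right; apply: ih].
  apply: par_const => // y hy yE.
  have ylb : segment (last c s) b y by apply: segment_conv hy => //; exact: segment_l.
  have [|ya|yb] := hE y _ yE.
  + exists (last c s, b) => //.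
    by rewrite rcons_cons /= inE pe_rcons mem_rcons mem_head orbT.
  + move: ylb; rewrite ya; apply: (gp_vertex gQ) => //; rewrite 1?eq_sym//.
    exact: inQ.
  + rewrite yb in hy; rewrite segment_sym in hz.
    by apply: (@segment_open _ b (last c s) z (last c s)) hy => //;
     rewrite 1?eq_sym//; apply: segment_r.
split=> //; first by split; [exact: onl|exact: onr|exact: onr|exact: onl].
split=> //.
- rewrite /E1; case: (s1) s10 us1 => // c s' _ us1; have [? ?] := us1 c (mem_head _ _).
  by split=> //; apply/on_cons; left; apply: segment_r.
- rewrite /E2; case: (s2) s20 us2 => // c s' _ us2; have [? ?] := us2 c (mem_head _ _).
  by split=> //; apply/on_cons; left; apply: segment_r.
- apply: (key u v s1) => // z h /on_cons[|]; [by apply: hd; left|exact: h12].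
- move=> z h zu zv; apply: (key v u s2) => //; first by rewrite eq_sym.
  move=> y hy /on_cons[|hy1]; first by rewrite segment_sym /= => /(hd _ (or_intror hy))[]; auto.
  by case: (h12 y hy1 hy); auto.
Qed.

Lemma diag_sp1 : sp (u :: rcons s1 v).
Proof.
case: (spQ) => uQ _ gQ ncQ; have [u1 u2 dj] := diag_uniq.
split=> //.
- by rewrite /= size_rcons; case: (s1) s10.
- by apply: gp_sub gQ => z h; apply: diag_mem; left.
- have self e : nc e e by rewrite /nc eqxx.
  move=> e f; rewrite !(perm_mem (ed_close _ _ _)) !inE.
  move=> /orP[/eqP ->|e1] /orP[/eqP ->|f1]; first exact: self.
  + by apply/nc_swap/ncd/diag_edge; left.
  + by apply/nc_sym/nc_swap/ncd/diag_edge; left.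
  + by apply: ncQ; apply: diag_edge; left.
Qed.
End Diagonal.

Lemma sp_perm Q Q' : perm_eq Q Q' -> perm_eq (ed Q) (ed Q') -> sp Q -> sp Q'.
Proof.
move=> p pe [h1 h2 h3 h4]; split.
- by rewrite -(perm_uniq p).
- by rewrite -(perm_size p).
- by apply: gp_sub h3 => z; rewrite (perm_mem p).
- by move=> e f; rewrite -!(perm_mem pe); apply: h4.
Qed.

Lemma sp_rot k Q : sp Q -> sp (rot k Q).
Proof. by apply: sp_perm; rewrite perm_sym ?perm_rot// ed_rot. Qed.

Lemma diag_sp2 u v s1 s2 : sp (u :: s1 ++ v :: s2) -> s1 != [::] -> s2 != [::] ->
  (forall f, f \in ed (u :: s1 ++ v :: s2) -> nc (u, v) f) -> sp (v :: rcons s2 u).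
Proof.
move=> h s10 s20 ncd.
have e : v :: s2 ++ u :: s1 = rot (size (u :: s1)) (u :: s1 ++ v :: s2).
  by rewrite -[u :: s1 ++ _]cat_cons rot_size_cat.
apply: (@diag_sp1 v u s2 s1) => //; first by rewrite e; apply: sp_rot.
by move=> f; rewrite e (perm_mem (ed_rot _ _)) => /ncd/nc_swap.
Qed.

Lemma inner_perm E E' : perm_eq E E' -> inner E = inner E'.
Proof.
by move=> p; apply/seteqP; split=> z; rewrite /inner /= (par_perm _ p) (on_perm _ p).
Qed.
Lemma outer_perm E E' : perm_eq E E' -> outer E = outer E'.
Proof.
by move=> p; apply/seteqP; split=> z; rewrite /outer /= (par_perm _ p) (on_perm _ p).
Qed.
End Polygon.

(** * Existence of an interior diagonal *)

Section Diag.
Variable R : realType.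
Implicit Types a b c d u v w x y z m : pt R.
Local Notation edge := (pt R * pt R)%type.
Implicit Types (E : seq edge) (e f : edge) (s t Q D : seq (pt R)).

Lemma seq_argmax (T : eqType) (F : T -> R) (s : seq T) : s != [::] ->
  exists2 x, x \in s & forall y : T, y \in s -> F y <= F x.
Proof.
elim: s => // a s ih _; have [->|s0] := eqVneq s [::].
  by exists a; rewrite ?mem_head// => y; rewrite inE => /eqP ->.
have [x xs hx] := ih s0; have [h|h] := leP (F a) (F x).
  exists x; first by rewrite inE xs orbT.
  by move=> y; rewrite inE => /orP[/eqP ->|/hx].
exists a; rewrite ?mem_head// => y; rewrite inE => /orP[/eqP -> //|/hx hy].
by rewrite (le_trans hy)// ltW.
Qed.

Lemma on_pe a s z : z \in s -> on (pe a s) z.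
Proof.
elim: s a => //= b s ih a; rewrite inE => /orP[/eqP ->|/(ih b) h]; apply/on_cons.
  by left; apply: segment_r.
by right.
Qed.

Lemma mem_cat_split (T : eqType) (x : T) (s : seq T) : x \in s ->
  exists s1 s2 : seq T, s = s1 ++ x :: s2.
Proof. by case/splitPr => s1 s2; exists s1, s2. Qed.

(** * The corner at an extreme vertex and the triangle it spans *)

Section Ear.
Variables (v w u : pt R) (t : seq (pt R)).
Let Q := v :: w :: rcons t u.
Hypothesis (spQ : sp Q) (t0 : t != [::]).

Let o := orient v w u.
(** Barycentric coordinates in the triangle [v w u], belonging to [v], [w] and [u] in this order;
    [al] measures the height over the side [w u]. *)
Definition al z := orient w u z / o.
Definition be z := orient u v z / o.
Definition ga z := orient v w z / o.

Let uQ : uniq Q. Proof. by case: spQ. Qed.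
Let gQ : gp Q. Proof. by case: spQ. Qed.
Let vQ : v \in Q. Proof. by rewrite mem_head. Qed.
Let wQ : w \in Q. Proof. by rewrite inE mem_head orbT. Qed.
Let uQm : u \in Q. Proof. by rewrite !inE mem_rcons mem_head !orbT. Qed.
Let tQ z : z \in t -> z \in Q.
Proof. by move=> h; rewrite !inE mem_rcons inE h !orbT. Qed.
Let tn z : z \in t -> [/\ z != u, z != v & z != w].
Proof.
move=> zt; have := uQ; rewrite /Q !cons_uniq rcons_uniq inE !mem_rcons !inE !negb_or.
move=> /and4P[/and3P[_ _ vt] /andP[_ wt] ut _].
by split; [apply: contraNneq ut|apply: contraNneq vt|apply: contraNneq wt] => <-.
Qed.
Let vwu : [/\ v != w, v != u & w != u].
Proof.
have := uQ; rewrite /Q !cons_uniq rcons_uniq inE !mem_rcons !inE !negb_or.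
by move=> /and4P[/and3P[-> -> _] /andP[-> _] _ _].
Qed.
Let o0 : o != 0.
Proof. by have [? ? ?] := vwu; apply: (gp_orient gQ). Qed.

Lemma bary_sum z : al z + be z + ga z = 1.
Proof.
rewrite /al /be /ga -!mulrDl.
have -> : orient w u z + orient u v z + orient v w z = o by rewrite /o /orient; ring.
by rewrite divff.
Qed.

Lemma bary_pt z : z = al z *: v + be z *: w + ga z *: u.
Proof.
apply: pt_eq; rewrite !pE /al /be /ga; apply: (mulfI o0);
rewrite /o /orient; field; exact: o0.
Qed.

Lemma al_conv x y r : al ((1 - r) *: x + r *: y) = (1 - r) * al x + r * al y.
Proof. by rewrite /al orient_conv mulrDl !mulrA. Qed.
Lemma be_conv x y r : be ((1 - r) *: x + r *: y) = (1 - r) * be x + r * be y.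
Proof. by rewrite /be orient_conv mulrDl !mulrA. Qed.
Lemma ga_conv x y r : ga ((1 - r) *: x + r *: y) = (1 - r) * ga x + r * ga y.
Proof. by rewrite /ga orient_conv mulrDl !mulrA. Qed.

Lemma bary_v : [/\ al v = 1, be v = 0 & ga v = 0].
Proof.
rewrite /al /be /ga orient_abb orient_aba !mul0r; split=> //.
by rewrite -orient_cyc divff.
Qed.
Lemma bary_w : [/\ al w = 0, be w = 1 & ga w = 0].
Proof.
rewrite /al /be /ga orient_abb orient_aba !mul0r; split=> //.
by rewrite orient_cyc divff.
Qed.
Lemma bary_u : [/\ al u = 0, be u = 0 & ga u = 1].
Proof. by rewrite /al /be /ga orient_abb orient_aba !mul0r divff. Qed.

Lemma bary_neq0 z : z \in t -> [/\ al z != 0, be z != 0 & ga z != 0].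
Proof.
move=> zt; have [zu zv zw] := tn zt; have [vw vu wu] := vwu; have zQ := tQ zt.
by split; rewrite mulf_neq0 ?invr_neq0//; apply: (gp_orient gQ) => //; rewrite eq_sym.
Qed.

(** The coordinates are affine along [z, a]. The first zero of [be] or [ga] is the exit point, and
    [al] is positive there, so the exit is through a side at [v]. *)
Lemma tri_exit z a : 0 <= al z -> 0 < be z -> 0 < ga z -> 0 < al a ->
  be a < 0 \/ ga a < 0 ->
  exists q, [/\ segment z a q, 0 < al q & segment u v q \/ segment v w q].
Proof.
move=> az bz cz aa h.
have side r : 0 < r <= 1 -> 0 <= (1 - r) * be z + r * be a ->
    0 <= (1 - r) * ga z + r * ga a ->
    (1 - r) * be z + r * be a = 0 \/ (1 - r) * ga z + r * ga a = 0 ->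
    exists q, [/\ segment z a q, 0 < al q & segment u v q \/ segment v w q].
  move=> /andP[r0 r1] hb hg h0; pose q := (1 - r) *: z + r *: a.
  have aq : 0 < al q.
    have h1 : 0 < r * al a by rewrite mulr_gt0.
    have h2 : 0 <= (1 - r) * al z by rewrite mulr_ge0//; lra.
    rewrite al_conv; lra.
  rewrite -be_conv -/q in hb h0; rewrite -ga_conv -/q in hg h0.
  exists q; split=> //; first by exists r; rewrite ?(ltW r0).
  have hs := bary_sum q; have hp := bary_pt q.
  case: h0 => h0; rewrite h0 scale0r in hp; [left|right].
    exists (al q); first by lra.
    have -> : 1 - al q = ga q by lra.
    by rewrite addr0 in hp; rewrite [LHS]hp addrC.
  exists (be q); first by lra.
  have -> : 1 - be q = al q by lra.
  by rewrite addr0 in hp; rewrite [LHS]hp.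
have root (p q : R) : 0 < p -> q < 0 -> exists2 r : R, 0 < r <= 1 & (1 - r) * p + r * q = 0.
  move=> p0 q0; exists (p / (p - q)); last by field; lra.
  by rewrite divr_gt0 ?ler_pdivrMr; lra.
have mono (p q r r' : R) : 0 < p -> 0 < r -> r <= r' -> (1 - r') * p + r' * q = 0 ->
    0 <= (1 - r) * p + r * q.
  move=> p0 r0 rr h1; have r'0 : 0 < r' by lra.
  rewrite -(pmulr_rge0 _ r'0).
  have -> : r' * ((1 - r) * p + r * q) = (r' - r) * p + r * ((1 - r') * p + r' * q) by ring.
  by rewrite h1 mulr0 addr0 mulr_ge0//; lra.
have pos (p q r : R) : 0 < p -> 0 <= q -> 0 < r <= 1 -> 0 <= (1 - r) * p + r * q.
  by move=> p0 q0 /andP[r0 r1]; rewrite addr_ge0// mulr_ge0//; lra.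
have [ba|ba] := ltP (be a) 0; have [ca|ca] := ltP (ga a) 0.
- have [r r01 hr] := root _ _ bz ba; have [r' r01' hr'] := root _ _ cz ca.
  have [rr|rr] := leP r r'.
    apply: (side r) => //; rewrite ?hr ?lexx//; last by left.
    by apply: (mono _ _ _ r') => //; case/andP: r01.
  apply: (side r') => //; rewrite ?hr' ?lexx//; last by right.
  by apply: (mono _ _ _ r) => //; [case/andP: r01'|exact: ltW].
- have [r r01 hr] := root _ _ bz ba.
  by apply: (side r) => //; rewrite ?hr ?lexx ?pos//; left.
- have [r r01 hr] := root _ _ cz ca.
  by apply: (side r) => //; rewrite ?hr ?lexx ?pos//; right.
- by case: h; lra.
Qed.

(** The affine function [al] is at least [al z] at one end of an edge through [z]. An inner vertex
    so high lies outside the triangle, so the edge would leave through a side at [v], itself an edge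
    of the polygon; the ends [w] and [u], where [al] vanishes, are excluded directly. *)
Lemma ear_blocked z e : 0 <= al z -> 0 < be z -> 0 < ga z ->
  (forall x, x \in t -> 0 < al x -> 0 < be x -> 0 < ga x -> al x < al z) ->
  e \in pe w (rcons t u) -> segment e.1 e.2 z -> False.
Proof.
move=> az bz cz hx eP se.
have [vw vu wu] := vwu.
have uw : uniq (w :: rcons t u) by have := uQ; rewrite /Q cons_uniq => /andP[].
have [g [h [gt ht gh eE]]] := pe_mid t0 uw eP.
have eQ : e \in ed Q by rewrite /Q /= pe_rcons inE mem_rcons inE eP !orbT.
have sgh : segment g h z by case: eE se => -> //=; rewrite segment_sym.
have ncE f : f \in ed Q -> nc (g, h) f.
  by case: spQ => _ _ _ hn fQ; case: eE eQ => -> eQ; [|apply: nc_swap]; apply: hn.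
have vwE : (v, w) \in ed Q by rewrite mem_head.
have uvE : (u, v) \in ed Q by rewrite /Q /= pe_rcons inE mem_rcons inE last_rcons eqxx !orbT.
(* an endpoint of [e] above [z] forces [e] to leave the triangle through a side at [v] *)
have up a b : segment a b z -> a \in t -> b \in w :: rcons t u -> a != b ->
    (forall f, f \in ed Q -> nc (a, b) f) -> al z <= al a -> False.
  move=> sab ta tb ab ncab la; have [na nb nc_] := bary_neq0 ta.
  have [au av aw] := tn ta.
  have aa : 0 < al a by rewrite lt_def na (le_trans az).
  have [|q [zq aq hq]] := @tri_exit z a az bz cz aa.
    have [|hb] := ltP (be a) 0; first by left.
    have [|hg] := ltP (ga a) 0; first by right.
    have := hx a ta aa; rewrite !lt_def nb nc_ hb hg => /(_ isT isT); lra.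
  have abq : segment a b q by apply: segment_conv zq => //; exact: segment_l.
  have bv : b != v.
    move: tb; rewrite inE mem_rcons inE => /or3P[/eqP ->|/eqP ->|/tn[]//]; by rewrite eq_sym.
  case: hq => hq.
    have [bu|bu] := eqVneq b u; last first.
      by apply: (ncab _ uvE _ _ _ _ q) => //=.
    have : q = u.
      apply: (@gp_meet _ Q u a v q gQ) => //; rewrite ?tQ// 1?eq_sym//.
      by rewrite -bu segment_sym.
    by move=> e'; move: aq; rewrite e'; have [-> _ _] := bary_u; rewrite ltxx.
  have [bw|bw] := eqVneq b w; last first.
    by apply: (ncab _ vwE _ _ _ _ q) => //=.
  have : q = w.
    apply: (@gp_meet _ Q w a v q gQ) => //; rewrite ?tQ// 1?eq_sym//.
      by rewrite -bw segment_sym.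
    by rewrite segment_sym.
  by move=> e'; move: aq; rewrite e'; have [-> _ _] := bary_w; rewrite ltxx.
have [hg|hg] := leP (al z) (al g); first exact: (up g h).
case: (sgh) => r /andP[r0 r1] ez.
have hh : al z <= al h.
  rewrite leNgt; apply/negP => hh.
  have hZ : al z = (1 - r) * al g + r * al h by rewrite -al_conv -ez.
  have h1 : 0 <= (1 - r) * (al z - al g) by rewrite mulr_ge0//; lra.
  have h2 : 0 <= r * (al z - al h) by rewrite mulr_ge0//; lra.
  have [e1|n1] := eqVneq r 0; first by move: hZ; rewrite e1; lra.
  have h3 : 0 < r * (al z - al h) by rewrite mulr_gt0 ?lt_def ?n1//; lra.
  by lra.
move: ht; rewrite inE mem_rcons inE => /or3P[/eqP hw|/eqP hu|ht].
- have hz : al z = 0 by move: hh; rewrite hw; have [-> _ _] := bary_w; lra.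
  move: hz; rewrite ez al_conv hw; have [-> _ cw] := bary_w.
  rewrite mulr0 addr0 => /eqP; rewrite mulf_eq0 => /orP[|/eqP g0].
    rewrite subr_eq0 => /eqP r1'; move: cz.
    by rewrite ez -r1' subrr scale0r add0r scale1r hw cw ltxx.
  by have [] := bary_neq0 gt; rewrite g0 eqxx.
- have hz : al z = 0 by move: hh; rewrite hu; have [-> _ _] := bary_u; lra.
  move: hz; rewrite ez al_conv hu; have [-> cw _] := bary_u.
  rewrite mulr0 addr0 => /eqP; rewrite mulf_eq0 => /orP[|/eqP g0].
    rewrite subr_eq0 => /eqP r1'; move: bz.
    by rewrite ez -r1' subrr scale0r add0r scale1r hu cw ltxx.
  by have [] := bary_neq0 gt; rewrite g0 eqxx.
- apply: (up h g) => //; rewrite 1?segment_sym// 1?eq_sym//.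
    by rewrite inE mem_rcons inE gt !orbT.
  by move=> f fQ; apply/nc_swap/ncE.
Qed.

Lemma ed_ear : perm_eq (ed Q) [:: (v, w), (u, v) & pe w (rcons t u)].
Proof. by rewrite /Q /= perm_cons pe_rcons last_rcons perm_rcons. Qed.

Hypothesis vmin : forall z, z \in Q -> z != v -> px v < px z.

(** To the left of all other vertices only the two edges at [v] can be crossed, and for a point
    within the angle at [v] exactly one of them lies above. *)
Lemma par_near_ear a : 0 < be a -> 0 < ga a -> px v < px a ->
  exists2 r : R, 0 < r < 1 & par (ed Q) ((1 - r) *: v + r *: a) = true.
Proof.
move=> ba ca va; have [vw vu wu] := vwu.
have [|x xQ hx] := @seq_argmax _ (fun z => - px z) (w :: rcons t u); first by [].
have xv : px v < px x.
  have xQ' : x \in Q by rewrite inE xQ orbT.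
  apply: vmin => //; have := uQ; rewrite /Q cons_uniq => /andP[n _].
  by apply: contraNneq n => <-.
have [r r01 hr] : exists2 r : R, 0 < r < 1 & r * (px a - px v) < px x - px v.
  exists ((px x - px v) / ((px a - px v) + (px x - px v))).
    by rewrite divr_gt0 ?ltr_pdivrMr; lra.
  by rewrite mulrAC ltr_pdivrMr ?ltr_pM2l; lra.
exists r => //; case/andP: r01 => r0 r1.
pose m := (1 - r) *: v + r *: a.
have pm : px m = px v + r * (px a - px v) by rewrite /m !pE; ring.
have mv : px v < px m by rewrite pm ltrDl mulr_gt0//; lra.
have mx z : z \in w :: rcons t u -> px m < px z.
  by move=> /hx; rewrite lerN2 => h; apply: lt_le_trans h; rewrite pm; lra.
rewrite (par_perm _ ed_ear) !par_cons /=.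
have -> : par (pe w (rcons t u)) m = false.
  rewrite /par big_seq big1 // => e /mem_pe[/mem_belast /mx h1 h2].
  have /mx h3 : e.2 \in w :: rcons t u by rewrite inE h2 orbT.
  by apply/negP => /orP[] /and3P[]; lra.
have mw : px m < px w by apply: mx; rewrite mem_head.
have mu : px m < px u by apply: mx; rewrite inE mem_rcons mem_head orbT.
rewrite addbF (rayC u) /ray mw mu (ltW mv) /= !(leNgt _ (px m)) mw mu /= !orbF.
have hc : orient v w m = r * (o * ga a).
  by rewrite /m orient_conv orient_aba /ga mulr0 add0r (mulrC o) divfK.
have hb : orient v u m = - (r * (o * be a)).
  rewrite /m orient_conv orient_aba /be mulr0 add0r (mulrC o) divfK//.
  by rewrite orient_swap mulrN.
have -> : (orient v w m < 0) = (o < 0) by rewrite hc pmulr_rlt0// pmulr_llt0.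
have -> : (orient v u m < 0) = (0 < o) by rewrite hb oppr_lt0 pmulr_rgt0// pmulr_lgt0.
by have [h|h|h] := ltgtP o 0 => //; move: o0; rewrite h eqxx.
Qed.

Lemma off_ear z : 0 <= al z -> 0 < be z -> 0 < ga z ->
  (forall x, x \in t -> 0 < al x -> 0 < be x -> 0 < ga x -> al x < al z) ->
  ~ on (ed Q) z.
Proof.
move=> az bz cz hz; rewrite (on_perm _ ed_ear) => /on_cons[/= /segment_orient0 h|].
  by move: cz; rewrite /ga h mul0r ltxx.
case/on_cons => [/= /segment_orient0 h|[e eP se]].
  by move: bz; rewrite /be h mul0r ltxx.
exact: (ear_blocked az bz cz hz eP se).
Qed.

Lemma off_ear_seg a r : 0 <= al a -> 0 < be a -> 0 < ga a -> 0 < r -> r < 1 ->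
  (forall x, x \in t -> 0 < al x -> 0 < be x -> 0 < ga x -> al x <= al a) ->
  al a < 1 ->
  ~ on (ed Q) ((1 - r) *: v + r *: a).
Proof.
move=> aa ba ca r0 r1 ha a1; have [av bv cv] := bary_v.
have az : al a < al ((1 - r) *: v + r *: a).
  rewrite al_conv av; have : 0 < (1 - r) * (1 - al a) by rewrite mulr_gt0//; lra.
  by lra.
apply: off_ear.
- by rewrite (le_trans aa)// ltW.
- by rewrite be_conv bv mulr0 add0r mulr_gt0.
- by rewrite ga_conv cv mulr0 add0r mulr_gt0.
- by move=> x xt h1 h2 h3; apply: le_lt_trans az; apply: ha.
Qed.

(** The vertex sequence may be rotated first. The parity of the inner point [m] certifies that the
    diagonal runs inside. *)
Definition good_diag (Q' : seq (pt R)) := exists x y s1 s2 m,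
  [/\ perm_eq Q' (x :: s1 ++ y :: s2) /\ perm_eq (ed Q') (ed (x :: s1 ++ y :: s2)),
      s1 != [::] /\ s2 != [::],
      (forall f, f \in ed (x :: s1 ++ y :: s2) -> nc (x, y) f),
      [/\ segment x y m, m != x & m != y] & par (ed (x :: s1 ++ y :: s2)) m].

Lemma lt1_al a : 0 < be a -> 0 < ga a -> al a < 1.
Proof. by have := bary_sum a; lra. Qed.

(** With no vertex in the triangle the ear at [v] is cut off along [w u]. By [ear_blocked] no edge
    crosses this segment, and its midpoint is joined to an inside point near [v] without meeting an
    edge. *)
Lemma ear_diag : (forall x, x \in t -> ~ [/\ 0 < al x, 0 < be x & 0 < ga x]) -> good_diag Q.
Proof.
move=> hno; have [vw vu wu] := vwu.
have p1 : Q = v :: (w :: rcons t u) by [].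
have er : rot 1 Q = w :: t ++ u :: [:: v] by rewrite rot1_cons /= -cats1 -cats1 -catA.
have pq : perm_eq (ed Q) (ed (w :: t ++ u :: [:: v])).
  by rewrite -er perm_sym ed_rot1.
have [av bv cv] := bary_v; have [aw bw cw] := bary_w; have [au bu cu] := bary_u.
have hb (z : pt R) : segment w u z -> z != w -> z != u -> [/\ al z = 0, 0 < be z & 0 < ga z].
  case=> r /andP[r0 r1] ez zw zu.
  have r0' : 0 < r by rewrite lt_def r0 andbT; apply: contra_neq zw => e; rewrite ez e; apply: pt_eq; rewrite !pE; ring.
  have r1' : r < 1 by rewrite lt_neqAle r1 andbT; apply: contra_neq zu => e; rewrite ez e; apply: pt_eq; rewrite !pE; ring.
  by rewrite ez al_conv be_conv ga_conv aw bw cw au bu cu; split; lra.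
pose m := (1 - (1 / 2)) *: w + (1 / 2) *: u.
have sm : segment w u m by exists (1 / 2); [lra|].
have [am bm cm] : [/\ al m = 0, 0 < be m & 0 < ga m].
  by rewrite /m al_conv be_conv ga_conv aw bw cw au bu cu; split; lra.
have mw : m != w by apply/eqP => e; move: cm; rewrite e cw ltxx.
have mu : m != u by apply/eqP => e; move: bm; rewrite e bu ltxx.
have hno' a : 0 <= al a -> forall x, x \in t -> 0 < al x -> 0 < be x -> 0 < ga x -> al x < al a.
  by move=> _ x xt h1 h2 h3; case: (hno x xt).
exists w, u, t, [:: v], m; split=> //.
- by split; rewrite // -er perm_sym perm_rot.
- move=> f; rewrite -(perm_mem pq) (perm_mem ed_ear) !inE => /or3P[/eqP ->|/eqP ->|fP].
  + by rewrite /nc /= eqxx.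
  + by rewrite /nc /= eqxx.
  + have uw : uniq (w :: rcons t u) by have := uQ; rewrite /Q cons_uniq => /andP[].
    move=> n1 n2 n3 n4 z hz hf; have [g [h [gt ht gh eE]]] := pe_mid t0 uw fP.
    have [gu gv gw] := tn gt.
    have hQ : h \in Q by rewrite inE ht orbT.
    have sgh : segment g h z by case: eE hf => -> //=; rewrite segment_sym.
    have [hw hu] : h != w /\ h != u.
      by move: n1 n2 n3 n4; case: eE => -> /=; rewrite !(eq_sym h); split.
    have zw : z != w.
      by apply/eqP => e; move: sgh; rewrite e; apply: (gp_vertex gQ) => //; apply: tQ.
    have zu : z != u.
      by apply/eqP => e; move: sgh; rewrite e; apply: (gp_vertex gQ) => //; apply: tQ.
    have [az bz cz] := hb z hz zw zu.
    by apply: (ear_blocked _ bz cz _ fP hf); [rewrite az|apply: hno'; rewrite az].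
- have mQ : ~ on (ed Q) m by apply: off_ear => //; [rewrite am|apply: hno'; rewrite am].
  rewrite -(par_perm _ pq).
  have vm : px v < px m.
    have h1 : px v < px w by apply: vmin; rewrite // eq_sym.
    have h2 : px v < px u by apply: vmin; rewrite // eq_sym.
    by rewrite /m !pE; lra.
  have [r /andP[r0 r1] hr] := par_near_ear bm cm vm.
  rewrite -[par (ed Q) m](@par_const _ (ed Q) ((1 - r) *: v + r *: m)) ?hr//; first exact: cyc_ed.
  move=> z; have [->//|zm] := eqVneq z m.
  case=> s /andP[s0 s1] ez.
  have -> : z = (1 - (r + s * (1 - r))) *: v + (r + s * (1 - r)) *: m.
    by rewrite ez; apply: pt_eq; rewrite !pE; ring.
  have s1' : s < 1 by rewrite lt_neqAle s1 andbT; apply: contra_neq zm => e; rewrite ez e; apply: pt_eq; rewrite !pE; ring.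
  have h1 : 0 <= s * (1 - r) by rewrite mulr_ge0//; lra.
  have h2 : 0 < (1 - s) * (1 - r) by rewrite mulr_gt0//; lra.
  have h3 : 0 < r + s * (1 - r) by lra.
  have h4 : r + s * (1 - r) < 1 by lra.
  apply: (off_ear_seg _ bm cm h3 h4); rewrite am //.
  by move=> x xt h5 h6 h7; case: (hno x xt).
Qed.

(** The vertex in the triangle highest over [w u] is visible from [v]: points of the open segment
    between them are higher than every vertex in the triangle, so no edge passes there. *)
Lemma inner_diag x : x \in t -> 0 < al x -> 0 < be x -> 0 < ga x ->
  (forall y, y \in t -> 0 < al y -> 0 < be y -> 0 < ga y -> al y <= al x) -> good_diag Q.
Proof.
move=> xt ax bx cx hx; have [vw vu wu] := vwu; have [xu xv xw] := tn xt.
have [av bv cv] := bary_v.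
have xQ := tQ xt.
have [t1 [t2 et]] := mem_cat_split xt.
have eQ : Q = v :: (w :: t1) ++ x :: rcons t2 u by rewrite /Q et rcons_cat.
pose m := (1 - (1 / 2)) *: v + (1 / 2) *: x.
have sm : segment v x m by exists (1 / 2); [lra|].
have a1 := lt1_al bx cx.
have sub r : 0 < r -> r < 1 -> ~ on (ed Q) ((1 - r) *: v + r *: x).
  by move=> r0 r1; apply: off_ear_seg => //; exact: ltW.
have mQ : ~ on (ed Q) m by apply: sub; lra.
have ex z : z \in Q -> on (ed Q) z.
  by move=> zQ; apply: on_pe; rewrite -rot1_cons mem_rot.
have mv : m != v by apply/eqP => e; apply: mQ; rewrite e; apply: ex.
have mx : m != x by apply/eqP => e; apply: mQ; rewrite e; apply: ex.
have vx : px v < px x by apply: vmin.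
exists v, x, (w :: t1), (rcons t2 u), m; split; rewrite -?eQ //.
- by split=> //; case: (t2).
- move=> f; rewrite (perm_mem ed_ear) !inE => /or3P[/eqP ->|/eqP ->|fP].
  + by rewrite /nc /= eqxx.
  + by rewrite /nc /= eqxx.
  + have uw : uniq (w :: rcons t u) by have := uQ; rewrite /Q cons_uniq => /andP[].
    move=> n1 n2 n3 n4 z hz hf.
    have fQ : f \in ed Q by rewrite (perm_mem ed_ear) !inE fP !orbT.
    have [f1Q f2Q] := mem_ed fQ.
    have f12 := pe_neq uw fP.
    have zv : z != v.
      by apply/eqP => e; move: hf; rewrite e; apply: (gp_vertex gQ) => //; rewrite eq_sym.
    have zx : z != x.
      by apply/eqP => e; move: hf; rewrite e; apply: (gp_vertex gQ) => //; rewrite eq_sym.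
    case: hz zv zx => r /andP[r0 r1] ez zv zx.
    apply: (sub r); last by rewrite -ez; exists f.
      by rewrite lt_def r0 andbT; apply: contra_neq zv => e; rewrite ez e; apply: pt_eq; rewrite !pE; ring.
    by rewrite lt_neqAle r1 andbT; apply: contra_neq zx => e; rewrite ez e; apply: pt_eq; rewrite !pE; ring.
- have [r /andP[r0 r1] hr] := par_near_ear bx cx vx.
  rewrite -[par (ed Q) m](@par_const _ (ed Q) ((1 - r) *: v + r *: x)) ?hr//; first exact: cyc_ed.
  move=> z; case=> s /andP[s0 s1] ->.
  have -> : (1 - s) *: ((1 - r) *: v + r *: x) + s *: m =
      (1 - ((1 - s) * r + s * (1 / 2))) *: v + ((1 - s) * r + s * (1 / 2)) *: x.
    by apply: pt_eq; rewrite !pE; field.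
  have h1 : 0 <= (1 - s) * r by rewrite mulr_ge0//; lra.
  have h2 : 0 <= (1 - s) * (1 - r) by rewrite mulr_ge0//; lra.
  have [->|sn] := eqVneq s 0; first by apply: sub; lra.
  have s0' : 0 < s by rewrite lt_def sn.
  by apply: sub; lra.
Qed.
End Ear.

Lemma diag_exists Q : sp Q -> (3 < size Q)%N -> good_diag Q.
Proof.
(* [v] is the leftmost vertex, the maximised function being minus the abscissa. *)
move=> spQ hs; have [|v vQ hv] := @seq_argmax _ (fun z => - px z) Q; first by case: (Q) hs.
have [s1 [s2 eQ]] := mem_cat_split vQ.
pose Q' := rot (size s1) Q.
have eQ' : Q' = v :: s2 ++ s1 by rewrite /Q' eQ rot_size_cat.
have spQ' : sp Q' by apply: sp_rot.
have hs' : (2 < size (s2 ++ s1))%N.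
  have e : size Q' = size Q by rewrite size_rot.
  by move: hs; rewrite -e eQ'.
case ew : (s2 ++ s1) hs' => [|w [|t1 tt]] // hs'.
case/lastP: tt ew hs' => [//|tt u] ew hs'.
have eR : Q' = v :: w :: rcons (t1 :: tt) u by rewrite eQ' ew.
have vm z : z \in v :: w :: rcons (t1 :: tt) u -> z != v -> px v < px z.
  rewrite -eR mem_rot => zQ zv; have := hv z zQ; rewrite lerN2 => h.
  rewrite lt_neqAle h andbT; case: spQ => _ _ [h1 _] _.
  by apply: h1 => //; rewrite eq_sym.
have key : good_diag Q'.
  rewrite eR in spQ' *.
  have [[x [xt hx]]|hno] := pselect (exists x, x \in t1 :: tt /\
    [/\ 0 < al v w u x, 0 < be v w u x & 0 < ga v w u x]).
    pose I := [seq y <- t1 :: tt | [&& 0 < al v w u y, 0 < be v w u y & 0 < ga v w u y]].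
    have [|y yI hy] := @seq_argmax _ (al v w u) I.
      have : x \in I by rewrite mem_filter xt andbT; case: hx => -> -> ->.
      by apply: contraTneq => ->.
    move: yI; rewrite mem_filter => /andP[/and3P[y1 y2 y3] yt].
    apply: (@inner_diag v w u (t1 :: tt) spQ' isT vm y) => // z zt z1 z2 z3.
    by apply: hy; rewrite mem_filter z1 z2 z3.
  by apply: (@ear_diag v w u (t1 :: tt) spQ' isT vm) => x xt hx; apply: hno; exists x.
case: key => x [y [t [t' [m [[p1 p2] h1 h2 h3 h4]]]]].
exists x, y, t, t', m; split=> //; split.
  by apply: perm_trans p1; rewrite /Q' perm_sym perm_rot.
by apply: perm_trans p2; rewrite /Q' perm_sym ed_rot.
Qed.
End Diag.

(** * Link distance inside a polygon in general position *)

Section Links.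
Variable R : realType.
Implicit Types a b c d u v w x y z m : pt R.
Local Notation edge := (pt R * pt R)%type.
Implicit Types (E : seq edge) (e f : edge) (Q : seq (pt R)) (O : set (pt R)).

(* At most [k] links: trivial links are allowed. *)
Fixpoint lk O a b (k : nat) : Prop :=
  if k is k'.+1 then exists2 c, lk O a c k' & segment c b `<=` O else a = b /\ O a.

Lemma lk_end O a b k : lk O a b k -> O b.
Proof. by case: k => [[<-]|k [c _ h]] //; apply: h; exact: segment_r. Qed.
Lemma lk_S O a b k : lk O a b k -> lk O a b k.+1.
Proof. by move=> h; exists b => // z /segment_xx ->; apply: lk_end h. Qed.
Lemma lk_le O a b k k' : (k <= k')%N -> lk O a b k -> lk O a b k'.
Proof.
by move=> /subnK <-; elim: (k' - k)%N => // j ih h; apply/lk_S/ih.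
Qed.
Lemma lk_mono O O' a b k : O `<=` O' -> lk O a b k -> lk O' a b k.
Proof.
move=> s; elim: k b => [b [-> h]|k ih b [c h1 h2]]; first by split; [|exact: s].
by exists c; [exact: ih|exact: subset_trans s].
Qed.
Lemma lk_trans O a b c j k : lk O a b j -> lk O b c k -> lk O a c (j + k).
Proof.
move=> h; elim: k c => [c [<- _]|k ih c [d h1 h2]]; first by rewrite addn0.
by rewrite addnS; exists d => //; apply: ih.
Qed.
Lemma lk1 O a b : segment a b `<=` O -> lk O a b 1.
Proof. by move=> h; exists a => //; split=> //; apply: h; exact: segment_l. Qed.
Lemma lk_sym O a b k : lk O a b k -> lk O b a k.
Proof.
elim: k b => [b [<- h]|k ih b [c h1 h2]]; first by split.
by rewrite -[k.+1]add1n; apply: lk_trans (ih _ h1); apply: lk1; rewrite segment_sym.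
Qed.

Lemma lk_path O a b k : lk O a b k -> polygonal_path O a b k.
Proof.
elim: k b => [b [<- h]|k ih b [c /ih[q [q0 qk hq]] h2]]; first by exists (fun=> a); split=> // -[].
exists (fun i => if (i <= k)%N then q i else b); split=> //; first by rewrite ltnn.
move=> [//|i] hi; have ik : (i <= k)%N by lia.
rewrite /= ik.
case: ltnP => h; first exact: (hq i.+1).
have -> : i = k by lia.
by rewrite qk.
Qed.

(* [reach O a e s] with [s = 2j+1]: both ends of [e] are within [j] links of [a];
   with [s = 2j+2]: one of them is. *)
Definition reach O a e (s : nat) : Prop :=
  if odd s then lk O a e.1 s./2 /\ lk O a e.2 s./2
  else lk O a e.1 s./2.-1 \/ lk O a e.2 s./2.-1.

Lemma reach_odd O a e j : reach O a e j.*2.+1 <-> lk O a e.1 j /\ lk O a e.2 j.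
Proof. by rewrite /reach /= odd_double /= uphalf_double. Qed.
Lemma reach_even O a e j : reach O a e j.*2.+2 <-> lk O a e.1 j \/ lk O a e.2 j.
Proof. by rewrite /reach /= negbK odd_double /= doubleK. Qed.

Lemma natS_case (s : nat) : (0 < s)%N -> exists j, s = j.*2.+1 \/ s = j.*2.+2.
Proof.
case: s => // s _; exists s./2; rewrite -[s in s.+1]odd_double_half.
by case: (odd s); rewrite /= ?add0n ?add1n; auto; rewrite -{1}[s]odd_double_half; case: (odd s); auto.
Qed.

Lemma reach_swap O a u v s : reach O a (u, v) s -> reach O a (v, u) s.
Proof. by rewrite /reach /=; case: ifP => _ [] *; auto. Qed.
Lemma reach_mono O O' a e s : O `<=` O' -> reach O a e s -> reach O' a e s.
Proof.
move=> h; rewrite /reach; case: ifP => _; case=> h1.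
- by move=> h2; split; apply: (lk_mono h).
- by left; apply: (lk_mono h).
- by right; apply: (lk_mono h).
Qed.

(** From odd to even one end is forgotten; from even to odd the other end is reached along the
    edge. *)
Lemma reach_S O a e s : segment e.1 e.2 `<=` O -> (0 < s)%N ->
  reach O a e s -> reach O a e s.+1.
Proof.
move=> hs /natS_case[j [->|->]].
  by move=> /reach_odd[h _]; apply/reach_even; left.
move=> /reach_even h; rewrite -doubleS; apply/reach_odd.
case: h => h; split; try exact: lk_S; rewrite -addn1; apply: (lk_trans h); apply: lk1 => //.
by rewrite segment_sym.
Qed.

Lemma reach_le O a e s s' : segment e.1 e.2 `<=` O -> (0 < s)%N -> (s <= s')%N ->
  reach O a e s -> reach O a e s'.
Proof.
move=> hs s0 /subnK <-; elim: (s' - s)%N => // j ih h.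
by apply: reach_S => //; [rewrite addn_gt0 s0 orbT|exact: ih].
Qed.

(** If one count is odd, a common end is available. If both are even, the ends reached may differ,
    and the edge itself serves as one more link. *)
Lemma reach_link O a b e s t : segment e.1 e.2 `<=` O -> (0 < s)%N -> (0 < t)%N ->
  reach O a e s -> reach O b e t -> lk O a b (s + t - 2)./2.
Proof.
move=> hs /natS_case[i [->|->]] /natS_case[j [->|->]].
- move=> /reach_odd[h1 _] /reach_odd[h2 _]; have := lk_trans h1 (lk_sym h2).
  by apply: lk_le; lia.
- move=> /reach_odd[h1 h2] /reach_even[h|h]; [have := lk_trans h1 (lk_sym h)|have := lk_trans h2 (lk_sym h)];
  by apply: lk_le; lia.
- move=> /reach_even[h|h] /reach_odd[h1 h2]; [have := lk_trans h (lk_sym h1)|have := lk_trans h (lk_sym h2)];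
  by apply: lk_le; lia.
- have h12 : lk O e.1 e.2 1 by apply: lk1.
  move=> /reach_even[h|h] /reach_even[h'|h'].
  + by have := lk_trans h (lk_sym h'); apply: lk_le; lia.
  + by have := lk_trans (lk_trans h h12) (lk_sym h'); apply: lk_le; lia.
  + by have := lk_trans (lk_trans h (lk_sym h12)) (lk_sym h'); apply: lk_le; lia.
  + by have := lk_trans h (lk_sym h'); apply: lk_le; lia.
Qed.

(** * Triangles, the base case *)

Section Triangle.
Variables x y z : pt R.
Hypothesis o0 : 0 < orient x y z.

Let T : set (pt R) := [set p | [/\ 0 <= orient x y p, 0 <= orient y z p & 0 <= orient z x p]].

Lemma tri_convex p q : T p -> T q -> segment p q `<=` T.
Proof.
by case=> a1 a2 a3 [b1 b2 b3] r hr; split; apply: orient_seg_ge0 hr.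
Qed.

Lemma tri_edge a b c p : 0 < orient a b c -> orient a b p = 0 -> 0 <= orient b c p ->
  0 <= orient c a p -> segment a b p.
Proof.
move=> h e h1 h2.
have hs : orient a b p + orient b c p + orient c a p = orient a b c.
  by rewrite /orient; ring.
have hn : orient a b c != 0 by rewrite gt_eqF.
exists (orient c a p / orient a b c).
  by rewrite divr_ge0 ?(ltW h)//= ler_pdivrMr//; lra.
have -> : 1 - orient c a p / orient a b c = orient b c p / orient a b c.
  by rewrite -[1](divff hn) -mulrBl -hs; congr (_ / _); lra.
have ex : orient a b c * px p = orient b c p * px a + orient c a p * px b + orient a b p * px c.
  by rewrite /orient; ring.
have ey : orient a b c * py p = orient b c p * py a + orient c a p * py b + orient a b p * py c.
  by rewrite /orient; ring.
rewrite e mul0r addr0 in ex; rewrite e mul0r addr0 in ey.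
by apply: pt_eq; rewrite !pE; apply: (mulfI hn); rewrite ?ex ?ey; field.
Qed.

Lemma tri_inner p : inner (ed [:: x; y; z]) p <-> T p.
Proof.
have oy : 0 < orient y z x by rewrite -orient_cyc.
have oz : 0 < orient z x y by rewrite -orient_cyc.
have cE : cyc (ed [:: x; y; z]) := cyc_ed _.
have eE : ed [:: x; y; z] = [:: (x, y); (y, z); (z, x)] by [].
have onT q : on (ed [:: x; y; z]) q -> T q.
  move=> [e]; rewrite eE !inE => /or3P[] /eqP -> /= h; split;
  by apply: (orient_seg_ge0 _ _ h); rewrite ?orient_aab ?orient_abb ?orient_aba ?(ltW o0) ?(ltW oy) ?(ltW oz).
have vx : x != y by apply/eqP => e; move: o0; rewrite e orient_aab ltxx.
have vy : y != z by apply/eqP => e; move: oy; rewrite e orient_aab ltxx.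
have vz : z != x by apply/eqP => e; move: oz; rewrite e orient_aab ltxx.
have side u v q : u != v -> (forall e, e \in ed [:: x; y; z] -> 0 <= orient u v e.1 /\ 0 <= orient u v e.2) ->
    orient u v q < 0 -> par (ed [:: x; y; z]) q = false.
  move=> uv h hq; apply: (@par_right _ _ u v) => //; first exact: ltW.
  case=> e eP /(orient_seg_ge0 (h e eP).1 (h e eP).2); lra.
have hx e : e \in ed [:: x; y; z] -> 0 <= orient x y e.1 /\ 0 <= orient x y e.2.
  by rewrite eE !inE => /or3P[] /eqP -> /=; rewrite ?orient_abb ?orient_aba ?(ltW o0).
have hy e : e \in ed [:: x; y; z] -> 0 <= orient y z e.1 /\ 0 <= orient y z e.2.
  by rewrite eE !inE => /or3P[] /eqP -> /=; rewrite ?orient_abb ?orient_aba ?(ltW oy).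
have hz e : e \in ed [:: x; y; z] -> 0 <= orient z x e.1 /\ 0 <= orient z x e.2.
  by rewrite eE !inE => /or3P[] /eqP -> /=; rewrite ?orient_abb ?orient_aba ?(ltW oz).
split=> [[/onT//|hp]|[h1 h2 h3]].
  split; rewrite leNgt; apply/negP => h.
  - by move: hp; rewrite (side x y).
  - by move: hp; rewrite (side y z).
  - by move: hp; rewrite (side z x).
have [h1'|n1] := eqVneq (orient x y p) 0.
  by left; exists (x, y); rewrite ?mem_head//; apply: tri_edge h1' h2 h3.
have [h2'|n2] := eqVneq (orient y z p) 0.
  by left; exists (y, z); rewrite ?eE ?inE ?eqxx ?orbT//; apply: tri_edge h2' h3 h1.
have [h3'|n3] := eqVneq (orient z x p) 0.
  by left; exists (z, x); rewrite ?eE ?inE ?eqxx ?orbT//; apply: tri_edge h3' h1 h2.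
have p1 : 0 < orient x y p by rewrite lt_def n1.
have p2 : 0 < orient y z p by rewrite lt_def n2.
have p3 : 0 < orient z x p by rewrite lt_def n3.
(* [q] is the mirror image of [p] in the midpoint of [x, y], so [p, q] crosses this side properly
   and meets no other. *)
right; pose q := x + y - p.
have oq : orient x y q = - orient x y p by rewrite /orient /q !pE; ring.
rewrite (@par_flip _ _ (x, y) [:: (y, z); (z, x)] p q) //.
- by rewrite (side x y)// oq oppr_lt0.
- split=> /=; first by rewrite oq mulrN oppr_lt0 mulr_gt0.
  have -> : orient p q x = - orient x y p by rewrite /orient /q !pE; ring.
  have -> : orient p q y = orient x y p by rewrite /orient /q !pE; ring.
  by rewrite mulNr oppr_lt0 mulr_gt0.
- move=> r [s /andP[s0 s1] er] [e].
  have r1 : orient x y r = (1 - 2 * s) * orient x y p by rewrite er orient_conv oq; ring.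
  have r2 : orient y z r = (1 - 2 * s) * orient y z p + s * orient x y z.
    by rewrite er orient_conv /orient /q !pE; ring.
  have r3 : orient z x r = (1 - 2 * s) * orient z x p + s * orient x y z.
    by rewrite er orient_conv /orient /q !pE; ring.
  have [s2|s2] := leP s (1 / 2).
    have k2 : 0 < orient y z r.
      rewrite r2; have : 0 <= (1 - 2 * s) * orient y z p by rewrite mulr_ge0//; lra.
      have [->|sn] := eqVneq s 0; first by lra.
      have : 0 < s * orient x y z by rewrite mulr_gt0// lt_def sn.
      lra.
    have k3 : 0 < orient z x r.
      rewrite r3; have : 0 <= (1 - 2 * s) * orient z x p by rewrite mulr_ge0//; lra.
      have [->|sn] := eqVneq s 0; first by lra.
      have : 0 < s * orient x y z by rewrite mulr_gt0// lt_def sn.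
      lra.
    by rewrite !inE => /orP[] /eqP -> /= /segment_orient0; lra.
  have k1 : orient x y r < 0 by rewrite r1 nmulr_rlt0//; lra.
  move=> eP he; have eE' : e \in ed [:: x; y; z] by rewrite eE inE eP orbT.
  have := orient_seg_ge0 (hx e eE').1 (hx e eE').2 he; lra.
Qed.
End Triangle.

Lemma tri_segment Q p q : sp Q -> size Q = 3%N -> inner (ed Q) p -> inner (ed Q) q ->
  segment p q `<=` inner (ed Q).
Proof.
case: Q => [|x [|y [|z [|? ?]]]] // [uQ _ gQ _] _.
have xy : x != y by move: uQ; rewrite /= inE negb_or => /andP[/andP[]].
have xz : x != z by move: uQ; rewrite /= !inE !negb_or => /andP[/andP[]].
have yz : y != z by move: uQ; rewrite /= !inE !negb_or => /andP[_ /andP[]].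
have : orient x y z != 0 by apply: (gp_orient gQ); rewrite // !inE eqxx ?orbT.
rewrite neq_lt => /orP[h|h]; last first.
  by move=> /(tri_inner h) hp /(tri_inner h) hq r /(tri_convex hp hq)/(tri_inner h).
have h' : 0 < orient x z y by rewrite orient_swapr; lra.
have e : inner (ed [:: x; y; z]) = inner (ed [:: x; z; y]).
  apply/seteqP; split=> r.
    case=> [[e he se]|hr]; [left|right].
      exists (e.2, e.1); last by rewrite segment_sym.
      by move: he; rewrite !inE => /or3P[] /eqP -> /=; rewrite eqxx ?orbT.
    move: hr; rewrite /par /= !big_cons !big_nil /= (rayC x y) (rayC y z) (rayC z x).
    by case: (ray y x r); case: (ray z y r); case: (ray x z r).
  case=> [[e he se]|hr]; [left|right].
    exists (e.2, e.1); last by rewrite segment_sym.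
    by move: he; rewrite !inE => /or3P[] /eqP -> /=; rewrite eqxx ?orbT.
  move: hr; rewrite /par /= !big_cons !big_nil /= (rayC x y) (rayC y z) (rayC z x).
  by case: (ray y x r); case: (ray z y r); case: (ray x z r).
rewrite e.
by move=> /(tri_inner h') hp /(tri_inner h') hq r /(tri_convex hp hq)/(tri_inner h').
Qed.

Lemma on_vertex Q a : (1 < size Q)%N -> a \in Q -> on (ed Q) a.
Proof.
case: Q => // b s _ aQ; apply: on_pe; by rewrite mem_rcons.
Qed.

(* The last clause is the aim; the first two are the invariant that survives gluing along a
   diagonal, which is an edge of both parts. *)
Definition int_links Q := [/\
  forall a e, inner (ed Q) a -> e \in ed Q -> reach (inner (ed Q)) a e (size Q),
  forall O a f e s, inner (ed Q) `<=` O -> f \in ed Q -> e \in ed Q -> (0 < s)%N ->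
    reach O a f s -> reach O a e (s + size Q - 2) &
  forall a b, inner (ed Q) a -> inner (ed Q) b -> lk (inner (ed Q)) a b (size Q)./2].

(** Any two edges of a triangle share a vertex, and any two of its points are one link apart. *)
Lemma int_links_tri Q : sp Q -> size Q = 3%N -> int_links Q.
Proof.
move=> spQ s3; have seg := tri_segment spQ s3.
have vin v : v \in Q -> inner (ed Q) v by move=> h; left; apply: on_vertex; rewrite ?s3.
split.
- move=> a e ha /mem_ed[e1 e2]; rewrite s3; apply/(@reach_odd _ _ _ 1).
  by split; apply/lk1/seg => //; apply: vin.
- move=> O a d e s sO dQ eQ /natS_case[j [->|->]].
    move=> /reach_odd[h1 h2].
    suff : e.1 \in [:: d.1; d.2] \/ e.2 \in [:: d.1; d.2].
      have -> : (j.*2.+1 + size Q - 2 = j.*2.+2)%N by rewrite s3; lia.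
      move=> h; apply/reach_even; move: h; rewrite !inE.
      by case=> /orP[] /eqP ->; auto.
    move: s3 dQ eQ; case: (Q) => [|x [|y [|z [|? ?]]]] // _.
    by rewrite !inE => /or3P[] /eqP -> /or3P[] /eqP -> /=; rewrite !eqxx ?orbT; auto.
  have [d1 d2] := mem_ed dQ; have [e1 e2] := mem_ed eQ.
  have -> : (j.*2.+2 + size Q - 2 = j.+1.*2.+1)%N by rewrite s3; lia.
  have st v w : v \in Q -> w \in Q -> lk O a v j -> lk O a w j.+1.
    by move=> hv hw h; exists v => //; apply: subset_trans sO; apply: seg; apply: vin.
  move=> /reach_even[] h; apply/reach_odd.
    by split; [apply: (st d.1)|apply: (st d.1)].
  by split; [apply: (st d.2)|apply: (st d.2)].
- by move=> a b ha hb; rewrite s3; apply/lk1/seg.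
Qed.

Lemma size_sp Q : sp Q -> (2 < size Q)%N. Proof. by case. Qed.

Lemma int_links_perm Q Q' : perm_eq Q Q' -> perm_eq (ed Q) (ed Q') ->
  int_links Q' -> int_links Q.
Proof.
move=> p1 p2 [A C B]; rewrite /int_links (inner_perm p2) (perm_size p1).
split=> //; first by move=> a e; rewrite (perm_mem p2); apply: A.
by move=> O a f e s; rewrite !(perm_mem p2); apply: C.
Qed.

(** [k1] and [k2] count the inner vertices of the two chains; each part has two vertices more, and
    so has the whole polygon compared with [k1 + k2]. *)
Lemma cut_arith (s k1 k2 : nat) : (0 < s)%N ->
  [/\ (s + k1.+2 - 2 <= s + (k1 + k2).+2 - 2)%N, (s + k2.+2 - 2 <= s + (k1 + k2).+2 - 2)%N,
      (0 < s + k1.+2 - 2)%N, (0 < s + k2.+2 - 2)%N &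
      (s + k1.+2 - 2 + k2.+2 - 2 = s + (k1 + k2).+2 - 2)%N /\
      (s + k2.+2 - 2 + k1.+2 - 2 = s + (k1 + k2).+2 - 2)%N].
Proof. by split; lia. Qed.
Lemma cut_arith2 (k1 k2 : nat) :
  [/\ (k1.+2 + k2.+2 - 2 = (k1 + k2).+2)%N, (k2.+2 + k1.+2 - 2 = (k1 + k2).+2)%N,
      (k1.+2./2 <= (k1 + k2).+2./2)%N, (k2.+2./2 <= (k1 + k2).+2./2)%N &
      (k1.+2 <= (k1 + k2).+2)%N /\ (k2.+2 <= (k1 + k2).+2)%N].
Proof. by split; lia. Qed.

(** Induction along an interior diagonal: reaching it takes as many half steps as one part has
    vertices, and passing on from it costs the size of the other part minus 2. *)
Theorem int_linksP Q : sp Q -> int_links Q.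
Proof.
have [n] := ubnP (size Q); elim: n Q => // n ih Q; rewrite ltnS => sn spQ.
have [s3|s3] := leqP (size Q) 3.
  by apply: int_links_tri => //; apply/eqP; rewrite eqn_leq s3 size_sp.
have [u [v [s1 [s2 [m [[p1 p2] [s10 s20] ncd [um mu mv] pm]]]]]] := diag_exists spQ s3.
have spQ' := sp_perm p1 p2 spQ.
apply: (int_links_perm p1 p2); rewrite /int_links.
set Q' := u :: s1 ++ v :: s2 in spQ' pm ncd *.
have J := diag_join spQ' s10 s20 ncd.
have sp1 := diag_sp1 spQ' s10 ncd; have sp2 := diag_sp2 spQ' s10 s20 ncd.
rewrite ed_split in pm.
have c1 := inner_join_sub J um mu mv pm.
have c2 : inner ((u, v) :: pe v (rcons s2 u)) `<=` inner (pe u (rcons s1 v) ++ pe v (rcons s2 u)).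
  rewrite (inner_perm (permEl (perm_catC _ _))).
  apply: (inner_join_sub (join_sym J) (m := m)) => //; first by rewrite segment_sym.
  by rewrite (par_perm _ (permEl (perm_catC _ _))).
have cov := @inner_join_cover _ u v (pe u (rcons s1 v)) (pe v (rcons s2 u)).
have q1 := ed_close u s1 v; have q2 := ed_close v s2 u.
have z1 : size (u :: rcons s1 v) = (size s1).+2 by rewrite /= size_rcons.
have z2 : size (v :: rcons s2 u) = (size s2).+2 by rewrite /= size_rcons.
have zQ : size Q' = (size s1 + size s2).+2 by rewrite /Q' /= size_cat /= addnS.
have n1 : (0 < size s1)%N by rewrite lt0n size_eq0.
have n2 : (0 < size s2)%N by rewrite lt0n size_eq0.
have zQn : (size Q' <= n)%N by rewrite -(perm_size p1).
have [] := ih (u :: rcons s1 v) _ sp1; first by rewrite z1; lia.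
have [] := ih (v :: rcons s2 u) _ sp2; first by rewrite z2; lia.
rewrite (inner_perm q1) (inner_perm q2) z1 z2 zQ.
have me1 e : e \in pe u (rcons s1 v) -> e \in ed (u :: rcons s1 v).
  by rewrite (perm_mem q1) inE => ->; rewrite orbT.
have me2 e : e \in pe v (rcons s2 u) -> e \in ed (v :: rcons s2 u).
  by rewrite (perm_mem q2) inE => ->; rewrite orbT.
have md1 : (v, u) \in ed (u :: rcons s1 v) by rewrite (perm_mem q1) mem_head.
have md2 : (u, v) \in ed (v :: rcons s2 u) by rewrite (perm_mem q2) mem_head.
rewrite ed_split.
set I1 := inner _ in c1 cov *; set I2 := inner _ in c2 cov *; set I := inner _ in c1 c2 cov *.
have sub_e (O : set (pt R)) e : I `<=` O -> e \in pe u (rcons s1 v) ++ pe v (rcons s2 u) ->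
    segment e.1 e.2 `<=` O.
  by move=> sO eP z hz; apply: sO; left; exists e.
have sub_d (O : set (pt R)) : I `<=` O -> segment u v `<=` O.
  by move=> sO z hz; apply/sO/c2; left; apply/on_cons; left.
move=> A2 C2 B2 A1 C1 B1.
(* Because the transfer clause holds in every larger region [O], that of a part applies to paths
   through the whole polygon; edges of different parts are linked through the diagonal. *)
have C O a (d : edge) e s : I `<=` O -> d \in pe u (rcons s1 v) ++ pe v (rcons s2 u) ->
    e \in pe u (rcons s1 v) ++ pe v (rcons s2 u) -> (0 < s)%N ->
    reach O a d s -> reach O a e (s + (size s1 + size s2).+2 - 2).
  move=> sO dP eP s0 h; have he := sub_e O e sO eP.
  have [r1 r2 r3 r4 [r5 r6]] := cut_arith (size s1) (size s2) s0.
  have O1 := subset_trans c1 sO; have O2 := subset_trans c2 sO.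
  have hd : segment (v, u).1 (v, u).2 `<=` O by rewrite segment_sym; exact: sub_d.
  move: dP eP; rewrite !mem_cat => /orP[d1|d2] /orP[e1|e2].
  - by apply: (reach_le he _ _ (C1 O a d e s O1 (me1 _ d1) (me1 _ e1) s0 h)).
  - have h' := reach_swap (C1 O a d (v, u) s O1 (me1 _ d1) md1 s0 h).
    have := C2 O a (u, v) e _ O2 md2 (me2 _ e2) _ h'.
    by rewrite r5; apply.
  - have h' := reach_swap (C2 O a d (u, v) s O2 (me2 _ d2) md2 s0 h).
    have := C1 O a (v, u) e _ O1 md1 (me1 _ e1) _ h'.
    by rewrite r6; apply.
  - by apply: (reach_le he _ _ (C2 O a d e s O2 (me2 _ d2) (me2 _ e2) s0 h)).
have [r1 r2 r3 r4 [r5 r6]] := cut_arith2 (size s1) (size s2).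
split=> // [a e /cov[ha|ha] eP|a b /cov[ha|ha] /cov[hb|hb]].
- have := A1 a _ ha md1 => /(reach_mono c1) h.
  move: (eP); rewrite mem_cat => /orP[e1|e2].
    have h' := reach_mono c1 (A1 a e ha (me1 _ e1)).
    by apply: (reach_le _ _ _ h'); [exact: (sub_e I)| |].
  have := C2 I a (u, v) e _ c2 md2 (me2 _ e2) _ (reach_swap h).
  by rewrite r1; apply.
- have := A2 a _ ha md2 => /(reach_mono c2) h.
  move: (eP); rewrite mem_cat => /orP[e1|e2]; last first.
    have h' := reach_mono c2 (A2 a e ha (me2 _ e2)).
    by apply: (reach_le _ _ _ h'); [exact: (sub_e I)| |].
  have := C1 I a (v, u) e _ c1 md1 (me1 _ e1) _ (reach_swap h).
  by rewrite r2; apply.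
- by apply: (lk_le _ (lk_mono c1 (B1 a b ha hb))).
- have h1 := reach_mono c1 (A1 a _ ha md1); have h2 := reach_mono c2 (A2 b _ hb md2).
  have := reach_link _ _ _ (reach_swap h1) h2.
  by rewrite r1; apply=> //; apply: sub_d.
- have h1 := reach_mono c1 (A1 b _ hb md1); have h2 := reach_mono c2 (A2 a _ ha md2).
  have := reach_link _ _ _ h2 (reach_swap h1).
  by rewrite r2; apply=> //; apply: sub_d.
- by apply: (lk_le _ (lk_mono c2 (B2 a b ha hb))).
Qed.
End Links.

(** * Hull edges *)

Section Hull.
Variable R : realType.
Implicit Types a b c u v w x y z m : pt R.
Local Notation edge := (pt R * pt R)%type.
Implicit Types (E : seq edge) (d e f : edge) (s Q D : seq (pt R)) (O : set (pt R)).

(** A side of the convex hull, oriented counterclockwise. *)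
Definition hp Q u v : Prop := [/\ u \in Q, v \in Q, u != v &
  forall z, z \in Q -> z != u -> z != v -> 0 < orient u v z].

Definition hull_edge Q e : Prop := hp Q e.1 e.2 \/ hp Q e.2 e.1.

Lemma hp_ge0 Q u v z : hp Q u v -> z \in Q -> 0 <= orient u v z.
Proof.
case=> _ _ _ h zQ; have [->|zu] := eqVneq z u; first by rewrite orient_aba.
by have [->|zv] := eqVneq z v; [rewrite orient_abb|exact/ltW/h].
Qed.

Lemma hp_sub Q Q' u v : {subset Q' <= Q} -> u \in Q' -> v \in Q' -> hp Q u v -> hp Q' u v.
Proof. by move=> s uQ vQ [_ _ uv h]; split=> // z /s; apply: h. Qed.

Lemma hull_edge_sub Q Q' e : {subset Q' <= Q} -> e.1 \in Q' -> e.2 \in Q' ->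
  hull_edge Q e -> hull_edge Q' e.
Proof. by move=> s h1 h2 [h|h]; [left|right]; apply: hp_sub h. Qed.

Lemma hp_half Q u v : hp Q u v -> [set z | orient u v z <= 0] `<=` outer (ed Q).
Proof.
move=> h z /= hz; have [zE|zE] := pselect (on (ed Q) z); first by left.
right; rewrite (@par_right _ _ u v) //; first exact: cyc_ed.
  by case: h.
by move=> e /mem_ed[h1 h2]; split; apply: hp_ge0 h _.
Qed.

Lemma half_convex u v a b : orient u v a <= 0 -> orient u v b <= 0 ->
  segment a b `<=` [set z | orient u v z <= 0].
Proof.
move=> ha hb z hz /=; rewrite -oppr_ge0 -orient_swap.
by apply: orient_seg_ge0 hz; rewrite orient_swap oppr_ge0.
Qed.

(* the first point of [s] in angular order around [v], inside an open half-plane at [v];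
   [k] fixes the sense of rotation *)
Lemma angular_first (k p q : R) v s : k != 0 -> s != [::] ->
  (forall z, z \in s -> 0 < p * (px z - px v) + q * (py z - py v)) ->
  (forall z z', z \in s -> z' \in s -> z != z' -> orient v z z' != 0) ->
  exists2 w, w \in s & forall z, z \in s -> z != w -> 0 < k * orient v w z.
Proof.
move=> k0; elim: s => // a s ih _ hf ho; have [s0|s0] := eqVneq s [::].
  by exists a; rewrite ?mem_head// s0 => z; rewrite inE => /eqP ->; rewrite eqxx.
have [||w ws hw] := ih s0.
- by move=> z zs; apply: hf; rewrite inE zs orbT.
- by move=> z z' zs zs'; apply: ho; rewrite inE ?zs ?zs' orbT.
have fa := hf a (mem_head _ _).
have fs z : z \in s -> 0 < p * (px z - px v) + q * (py z - py v).
  by move=> zs; apply: hf; rewrite inE zs orbT.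
have [e|aw] := eqVneq a w.
  exists w; first by rewrite inE ws orbT.
  by move=> z; rewrite inE => /orP[/eqP ->|]; [rewrite e eqxx|exact: hw].
have := ho a w (mem_head _ _); rewrite inE ws orbT => /(_ isT aw) oaw.
have : k * orient v a w != 0 by rewrite mulf_neq0.
rewrite neq_lt => /orP[h|h].
  exists w; first by rewrite inE ws orbT.
  move=> z; rewrite inE => /orP[/eqP -> _|]; last exact: hw.
  by rewrite orient_swapr mulrN; lra.
exists a; first exact: mem_head.
move=> z; rewrite inE => /orP[/eqP ->|zs za]; first by rewrite eqxx.
have [->//|zw] := eqVneq z w.
have h2 := hw z zs zw; have fw := fs w ws; have fz := fs z zs.
(* A three-term Pluecker relation; it makes the angular order around [v] transitive within the
   half-plane. *)
have id : (p * (px w - px v) + q * (py w - py v)) * (k * orient v a z) =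
   (p * (px a - px v) + q * (py a - py v)) * (k * orient v w z) +
   (p * (px z - px v) + q * (py z - py v)) * (k * orient v a w).
  by rewrite /orient; ring.
by rewrite -(pmulr_rgt0 _ fw) id addr_gt0// mulr_gt0.
Qed.

Lemma third u v Q : uniq Q -> (2 < size Q)%N ->
  exists t, [/\ t \in Q, t != u & t != v].
Proof.
move=> uQ sQ; have [|h] := pselect (exists t, [/\ t \in Q, t != u & t != v]); first by [].
suff /(uniq_leq_size uQ) /= : {subset Q <= [:: u; v]} by rewrite leqNgt sQ.
move=> t tQ; rewrite !inE; apply/negPn/negP; rewrite negb_or => /andP[tu tv].
by apply: h; exists t.
Qed.

(** Gift wrapping: the line of a hull side is turned about [v] until it meets the next vertex. *)
Lemma hp_next Q u v : gp Q -> uniq Q -> (2 < size Q)%N -> hp Q u v ->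
  exists2 w, w != u & hp Q v w.
Proof.
move=> g uQ sQ [uQ' vQ uv h]; pose s := [seq z <- Q | (z != u) && (z != v)].
have ms z : z \in s = [&& z != u, z != v & z \in Q] by rewrite mem_filter andbA.
have s0 : s != [::].
  have [t [tQ tu tv]] := third u v uQ sQ.
  have : t \in s by rewrite ms tu tv.
  by apply: contraTneq => ->.
have [||w ws hw] := @angular_first 1 (- (py v - py u)) (px v - px u) v s (oner_neq0 _) s0.
- move=> z; rewrite ms => /and3P[zu zv zQ]; have := h z zQ zu zv.
  by rewrite /orient; lra.
- move=> z z'; rewrite !ms => /and3P[_ zv zQ] /and3P[_ zv' zQ'] zz.
  by apply: (gp_orient g) => //; rewrite eq_sym.
move: ws; rewrite ms => /and3P[wu wv wQ]; exists w => //; split=> //; first by rewrite eq_sym.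
move=> z zQ zv zw; have [->|zu] := eqVneq z u.
  by rewrite -orient_cyc; apply: h.
by have := hw z; rewrite ms zu zv zQ mul1r; apply.
Qed.

(** Gift wrapping in the opposite sense of rotation, hence the factor -1. *)
Lemma hp_prev Q u v : gp Q -> uniq Q -> (2 < size Q)%N -> hp Q v u ->
  exists2 w, w != u & hp Q w v.
Proof.
move=> g uQ sQ [vQ uQ' vu h]; have uv : u != v by rewrite eq_sym.
pose s := [seq z <- Q | (z != u) && (z != v)].
have ms z : z \in s = [&& z != u, z != v & z \in Q] by rewrite mem_filter andbA.
have s0 : s != [::].
  have [t [tQ tu tv]] := third u v uQ sQ.
  have : t \in s by rewrite ms tu tv.
  by apply: contraTneq => ->.
have k0 : (-1 : R) != 0 by rewrite oppr_eq0 oner_neq0.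
have [||w ws hw] := @angular_first (-1) (- (py u - py v)) (px u - px v) v s k0 s0.
- move=> z; rewrite ms => /and3P[zu zv zQ]; have := h z zQ zv zu.
  by rewrite /orient; lra.
- move=> z z'; rewrite !ms => /and3P[_ zv zQ] /and3P[_ zv' zQ'] zz.
  by apply: (gp_orient g) => //; rewrite eq_sym.
move: ws; rewrite ms => /and3P[wu wv wQ]; exists w => //; split=> //.
move=> z zQ zw zv; have [->|zu] := eqVneq z u.
  by rewrite orient_cyc; apply: h => //.
by have := hw z; rewrite ms zu zv zQ mulN1r orient_swap opprK; apply.
Qed.

(** Gift wrapping starts at the leftmost vertex, as seen from which all others lie in an open
    half-plane. *)
Lemma hp_ex Q : gp Q -> (1 < size Q)%N -> uniq Q -> exists v w, hp Q v w.
Proof.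
move=> g sQ uQ; have [|v vQ hv] := @seq_argmax _ _ (fun z => - px z) Q; first by case: (Q) sQ.
pose s := [seq z <- Q | z != v].
have ms z : z \in s = (z != v) && (z \in Q) by rewrite mem_filter.
have s0 : s != [::].
  have : (1 < size s + 1)%N.
    apply: (leq_trans sQ); have := size_filter (fun z => (z != v)) Q.
    rewrite -/s => ->; rewrite -(count_predC (fun z => z != v) Q) leq_add2l.
    rewrite (eq_count (a2 := pred1 v)) ?count_uniq_mem ?leq_b1//.
    by move=> z; rewrite /= negbK.
  by case: (s).
have [||w ws hw] := @angular_first 1 1 0 v s (oner_neq0 _) s0.
- move=> z; rewrite ms => /andP[zv zQ]; have := hv z zQ; rewrite lerN2 => hz.
  have /negbTE n : px v != px z by case: g => h _; apply: h; rewrite // eq_sym.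
  rewrite mul1r mul0r addr0 subr_gt0 lt_neqAle n //.
- move=> z z'; rewrite !ms => /andP[zv zQ] /andP[zv' zQ'] zz.
  by apply: (gp_orient g) => //; rewrite eq_sym.
move: ws; rewrite ms => /andP[wv wQ]; exists v, w; split=> //; first by rewrite eq_sym.
by move=> z zQ zv zw; have := hw z; rewrite ms zv zQ mul1r; apply.
Qed.

Lemma ed_rot_ex Q e : e \in ed Q -> (1 < size Q)%N ->
  exists k s, rot k Q = e.1 :: e.2 :: s.
Proof.
move=> eQ sQ.
have pe_ex a t (b : edge) : b \in pe a t -> exists t1 t2, a :: t = t1 ++ b.1 :: b.2 :: t2.
  elim: t a => // c t ih a /=; rewrite inE => /orP[/eqP ->|/ih[t1 [t2 h]]].
    by exists [::], t.
  by exists (a :: t1), t2; rewrite h.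
case: Q eQ sQ => // a t; rewrite /ed pe_rcons mem_rcons inE => /orP[/eqP -> |/pe_ex[t1 [t2 h]]] sQ.
  case/lastP: t sQ => // t b _; exists (size (a :: t)), t.
  by rewrite -rcons_cons -cats1 rot_size_cat last_rcons.
by exists (size t1), (t2 ++ t1); rewrite h rot_size_cat.
Qed.

(* A lid is a side of the convex hull that is not an edge of the polygon. *)
Definition nolid Q := forall u v, hp Q u v -> (u, v) \in ed Q \/ (v, u) \in ed Q.

Lemma hp_perm Q Q' u v : perm_eq Q Q' -> hp Q u v -> hp Q' u v.
Proof.
move=> p [h1 h2 h3 h4]; split; rewrite -?(perm_mem p)// => z.
by rewrite -(perm_mem p); apply: h4.
Qed.

Lemma or_swap (A B : Prop) : A \/ B -> B \/ A.
Proof. by case; [right|left]. Qed.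

Lemma nolid_step b c x s w : let Q := b :: c :: x :: s in uniq Q ->
  (c, w) \in ed Q \/ (w, c) \in ed Q -> w != b -> w = x.
Proof.
move=> Q uQ; have uQ' := uQ; move: uQ; rewrite /Q /=.
rewrite !inE !negb_or => /and3P[/and3P[bc bx bs] /andP[cx cs] /andP[xs us]].
rewrite !xpair_eqE !eqxx /= (eq_sym c b) (negbTE bc) (negbTE cx) (eq_sym w b) /= ?andbF /=.
have notin y : (c, y) \in pe x (rcons s b) -> False.
  case/mem_pe; rewrite belast_rcons /= inE (negbTE cx) (negbTE cs) //.
have notin' y : (y, c) \in pe x (rcons s b) -> False.
  by case/mem_pe => _; rewrite mem_rcons inE eq_sym (negbTE bc) (negbTE cs).
case=> /orP[|].
- by move/eqP.
- by move/notin.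
- by move=> /andP[/eqP -> _]; rewrite eqxx.
- by move/notin'.
Qed.

Lemma rot_closed (P : seq (pt R) -> Prop) : (forall s, P s -> P (rot 1 s)) ->
  forall s, P s -> forall k, P (rot k s).
Proof.
move=> h s Ps; elim=> [|k ih]; first by rewrite rot0.
have [hk|hk] := ltnP k (size s); last by rewrite rot_oversize// ltnW.
by rewrite -[k.+1]/(1 + k)%N rotD//; apply: h.
Qed.

Lemma nolid_rot Q : sp Q -> nolid Q -> nolid (rot 1 Q).
Proof.
move=> _ nl u v h; rewrite !(perm_mem (ed_rot1 _)); apply: nl.
by apply: hp_perm h; rewrite perm_rot.
Qed.

(** Without lids one edge that is a counterclockwise hull side forces the next, and so on around the
    polygon. [nolid_bwd] is the same for a polygon traversed clockwise. *)
Lemma nolid_fwd Q : sp Q -> nolid Q -> (exists b c s, Q = b :: c :: s /\ hp Q b c) ->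
  forall k b c s, rot k Q = b :: c :: s -> hp Q b c.
Proof.
move=> spQ nl h k b c s ek.
have := @rot_closed (fun Q => [/\ sp Q, nolid Q & forall b c s, Q = b :: c :: s -> hp Q b c]) _ Q.
case/(_ _ _ k) => [Q' [spQ' nl' h']||_ _ h'].
- split; [exact: sp_rot|exact: nolid_rot|].
  have [uQ sQ gQ _] := spQ'; move: (Q') spQ' nl' h' uQ sQ gQ => [|b0 [|c0 [|x0 s0]]] //.
  move=> spQ' nl' /(_ _ _ _ erefl) hbc uQ sQ gQ b' c' s'; rewrite rot1_cons => -[<- <- _].
  have [w wb hw] := hp_next gQ uQ sQ hbc.
  have := nolid_step uQ (nl' _ _ hw) wb => e; rewrite e in hw.
  by apply: hp_perm hw; rewrite -rot1_cons perm_sym perm_rot.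
- by split=> // b0 c0 s0 e0; case: h => b1 [c1 [s1 [e1 h1]]]; move: h1; rewrite {1}e1 in e0 *; case: e0 => -> ->.
- by apply: hp_perm (h' _ _ _ ek); rewrite perm_rot.
Qed.

Lemma nolid_bwd Q : sp Q -> nolid Q -> (exists b c s, Q = b :: c :: s /\ hp Q c b) ->
  forall k b c s, rot k Q = b :: c :: s -> hp Q c b.
Proof.
move=> spQ nl h k b c s ek.
have := @rot_closed (fun Q => [/\ sp Q, nolid Q & forall b c s, Q = b :: c :: s -> hp Q c b]) _ Q.
case/(_ _ _ k) => [Q' [spQ' nl' h']||_ _ h'].
- split; [exact: sp_rot|exact: nolid_rot|].
  have [uQ sQ gQ _] := spQ'; move: (Q') spQ' nl' h' uQ sQ gQ => [|b0 [|c0 [|x0 s0]]] //.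
  move=> spQ' nl' /(_ _ _ _ erefl) hbc uQ sQ gQ b' c' s'; rewrite rot1_cons => -[<- <- _].
  have [w wb hw] := hp_prev gQ uQ sQ hbc.
  have := nolid_step uQ (or_swap (nl' _ _ hw)) wb => e; rewrite e in hw.
  by apply: hp_perm hw; rewrite -rot1_cons perm_sym perm_rot.
- by split=> // b0 c0 s0 e0; case: h => b1 [c1 [s1 [e1 h1]]]; move: h1; rewrite {1}e1 in e0 *; case: e0 => -> ->.
- by apply: hp_perm (h' _ _ _ ek); rewrite perm_rot.
Qed.

Lemma nolid_hull Q : sp Q -> nolid Q -> forall e, e \in ed Q -> hull_edge Q e.
Proof.
move=> spQ nl e eQ; have [uQ sQ gQ _] := spQ; have s1 := ltnW sQ.
have [v [w hvw]] := hp_ex gQ s1 uQ.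
have tr k : nolid (rot k Q).
  apply: (@rot_closed (fun Q => sp Q /\ nolid Q) _ Q (conj spQ nl) k).2.
  by move=> Q' [h1 h2]; split; [exact: sp_rot|exact: nolid_rot].
have hr k u1 u2 : hp Q u1 u2 <-> hp (rot k Q) u1 u2.
  by split; apply: hp_perm; rewrite ?perm_rot// perm_sym perm_rot.
have eQk k : exists j s, rot j (rot k Q) = e.1 :: e.2 :: s.
  by apply: ed_rot_ex; rewrite ?size_rot// (perm_mem (ed_rot _ _)).
case: (nl _ _ hvw) => /ed_rot_ex/(_ s1)[k [s ek]]; have [j [s' ej]] := eQk k.
  left; apply/(hr k); apply: (nolid_fwd (sp_rot k spQ) (tr k) _ ej).
  by exists v, w, s; split=> //; apply/hr.
right; apply/(hr k); apply: (nolid_bwd (sp_rot k spQ) (tr k) _ ej).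
by exists w, v, s; split=> //; apply/hr.
Qed.

(** A polygon without lids is convex. A point strictly to the left of all hull sides is reflected in
    the midpoint of an edge; the joining segment crosses only this edge and ends beyond a hull side,
    so the point is inside. *)
Lemma outer_half Q a : sp Q -> nolid Q -> outer (ed Q) a ->
  exists u v, hp Q u v /\ orient u v a <= 0.
Proof.
move=> spQ nl; have [uQ sQ gQ _] := spQ; have hull := nolid_hull spQ nl.
case=> [[e eQ he]|pa].
  have e0 := segment_orient0 he.
  by case: (hull e eQ) => h; [exists e.1, e.2|exists e.2, e.1]; rewrite ?e0 1?orient_swap ?e0 ?oppr0.
apply: contrapT => hn.
have pos u v : hp Q u v -> 0 < orient u v a.
  by move=> h; rewrite ltNge; apply/negP => ha; apply: hn; exists u, v.
case: Q spQ nl uQ sQ gQ hull pa hn pos => [|x [|y [|t s]]] // spQ nl uQ sQ gQ hull pa hn pos.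
set Q := [:: x, y, t & s] in spQ nl uQ sQ gQ hull pa hn pos *.
have xyQ : (x, y) \in ed Q by rewrite mem_head.
have xQ : x \in Q by rewrite mem_head.
have yQ : y \in Q by rewrite inE mem_head orbT.
have xy : x != y by move: uQ; rewrite /= inE negb_or => /andP[/andP[]].
have side : exists u v, [/\ hp Q u v, (u, v) = (x, y) \/ (u, v) = (y, x) &
    forall z, orient u v (x + y - z) = - orient u v z].
  have id z : orient x y (x + y - z) = - orient x y z by rewrite /orient !pE; ring.
  case: (hull _ xyQ) => h; [exists x, y|exists y, x]; split=> //; auto => z.
  by rewrite orient_swap id -orient_swap.
case: side => u [v [huv euv id]].
pose q := x + y - a.
have qo : orient u v q < 0 by rewrite id oppr_lt0; apply: pos.
have nq : ~ on (ed Q) q.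
  case=> e /mem_ed[h1 h2] /(orient_seg_ge0 (hp_ge0 huv h1) (hp_ge0 huv h2)); lra.
have pq : par (ed Q) q = false.
  apply: (@par_right _ _ u v) => //; first exact: cyc_ed.
  - by case: huv.
  - by move=> e /mem_ed[h1 h2]; split; apply: (hp_ge0 huv).
  - exact: ltW.
have po : orient x y a * orient x y q < 0.
  have -> : orient x y q = - orient x y a by rewrite /orient /q !pE; ring.
  rewrite mulrN oppr_lt0 -expr2 exprn_even_gt0//=.
  have := pos _ _ huv; case: euv => -[-> ->]; rewrite ?(orient_swap x y); lra.
have e' : par (ed Q) a = ~~ par (ed Q) q; last by move: pa; rewrite e' pq.
apply: (@par_flip _ _ (x, y) (pe y (rcons (t :: s) x))) => //; first exact: cyc_ed.
  split=> //=.
  have -> : orient a q x = - orient x y a by rewrite /orient /q !pE; ring.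
  have -> : orient a q y = orient x y a by rewrite /orient /q !pE; ring.
  rewrite mulNr oppr_lt0 -expr2 exprn_even_gt0//=.
  have := pos _ _ huv; case: euv => -[-> ->]; rewrite ?(orient_swap x y); lra.
move=> r [k /andP[k0 k1] er] [f fE fr].
have fQ : f \in ed Q by rewrite /Q /= inE fE orbT.
have [f1Q f2Q] := mem_ed fQ.
(* The second half of [a, q] is beyond the side [u v]; the first half is still strictly to the left
   of every other side. *)
have [k2|k2] := leP k (1 / 2); last first.
  have : orient u v r < 0.
    rewrite er orient_conv id.
    have -> : (1 - k) * orient u v a + k * - orient u v a = (1 - 2 * k) * orient u v a by ring.
    by rewrite nmulr_rlt0 ?pos//; lra.
  have := orient_seg_ge0 (hp_ge0 huv f1Q) (hp_ge0 huv f2Q) fr; lra.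
have main u' v' : hp Q u' v' -> f = (u', v') \/ f = (v', u') -> False.
  move=> h' ef.
  have r0 : orient u' v' r = 0.
    have := segment_orient0 fr; case: ef => -> //=; rewrite orient_swap; lra.
  have hx := hp_ge0 h' xQ; have hy := hp_ge0 h' yQ; have ha := pos _ _ h'.
  have : 0 < orient u' v' x + orient u' v' y.
    have uf : uniq (y :: rcons (t :: s) x).
      by rewrite -rcons_cons rcons_uniq; move: uQ; rewrite /Q cons_uniq.
    have [g [h [gt ht gh eg]]] := pe_mid (isT : t :: s != [::]) uf fE.
    have [u'Q v'Q _ hpos] := h'.
    have gx : g != x.
      by apply: contraTneq gt => ->; move: uQ; rewrite /Q cons_uniq inE negb_or => /andP[/andP[]].
    have gy : g != y.
      by apply: contraTneq gt => ->; move: uQ; rewrite /Q !cons_uniq => /and3P[].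
    have cas : (u' = g /\ v' = h) \/ (u' = h /\ v' = g).
      by case: eg => eg; rewrite eg in ef; case: ef => -[-> ->]; auto.
    have [hx0|hx0] := eqVneq h x.
      have : 0 < orient u' v' y; last by lra.
      have [n1 n2] : y != u' /\ y != v'.
        by case: cas => -[-> ->]; rewrite ?hx0 !(eq_sym y); split.
      exact: hpos.
    have : 0 < orient u' v' x; last by lra.
    have [n1 n2] : x != u' /\ x != v'.
      by case: cas => -[-> ->]; rewrite !(eq_sym x); split.
    exact: hpos.
  have : orient u' v' r = (1 - 2 * k) * orient u' v' a + k * (orient u' v' x + orient u' v' y).
    by rewrite er orient_conv /q /orient !pE; ring.
  have : 0 <= (1 - 2 * k) * orient u' v' a by rewrite mulr_ge0 ?(ltW ha)//; lra.
  move=> h1 h2 h3; have [k0'|kn] := eqVneq k 0.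
    by move: h2; rewrite r0 k0'; lra.
  have : 0 < k * (orient u' v' x + orient u' v' y) by rewrite mulr_gt0// lt_def kn.
  lra.
case: (hull f fQ) => h'; apply: (main _ _ h'); first by left; case: (f).
by right; case: (f).
Qed.
End Hull.

(** * Link distance outside a polygon in general position *)

Section Exterior.
Variable R : realType.
Implicit Types a b c u v w x y z m : pt R.
Local Notation edge := (pt R * pt R)%type.
Implicit Types (E : seq edge) (d e f : edge) (s Q D : seq (pt R)) (O : set (pt R)).

(** [x :: rcons s1 y] is the pocket under the lid [x, y]; [y :: rcons s2 x] is the polygon with the
    pocket filled, which has the lid as an edge. The last clause places the pocket chain inside the
    filled polygon. *)
Definition lid_split Q x y s1 s2 := let Q' := x :: s1 ++ y :: s2 in
  [/\ perm_eq Q Q' /\ perm_eq (ed Q) (ed Q'), s1 != [::] /\ s2 != [::],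
      (forall f, f \in ed Q' -> nc (x, y) f), hull_edge Q' (x, y) &
      [/\ outer (ed Q') `<=` inner (ed (x :: rcons s1 y)) `|` outer (ed (y :: rcons s2 x)),
          inner (ed (x :: rcons s1 y)) `<=` outer (ed Q'),
          outer (ed (y :: rcons s2 x)) `<=` outer (ed Q') &
          par (ed (y :: rcons s2 x)) (head x s1)]].

Lemma lid_split_of Q x y s1 s2 : let Q' := x :: s1 ++ y :: s2 in
  sp Q' -> perm_eq Q Q' -> perm_eq (ed Q) (ed Q') -> s1 != [::] -> s2 != [::] ->
  (forall f, f \in ed Q' -> nc (x, y) f) -> hull_edge Q' (x, y) ->
  par ((y, x) :: pe x (rcons s1 y)) (head y s2) = false ->
  lid_split Q x y s1 s2.
Proof.
move=> Q' spQ p1 p2 s10 s20 ncd hl pa; have J := diag_join spQ s10 s20 ncd.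
have [m [um mx my]] := join_mid J.
have q1 := ed_close x s1 y; have q2 := ed_close y s2 x.
have pm : par (ed Q') m = false.
  have nm : ~ on (ed Q') m.
    move=> h; case: J => _ _ [_ hd] _ _; case: (hd m _ um); try by apply/eqP.
    by move: h; rewrite /Q' ed_split => /on_cat.
  case: hl => h; [apply: (@par_right _ _ x y)|apply: (@par_right _ _ y x)] => //;
    try exact: cyc_ed; try by case: h.
  - by move=> e /mem_ed[h1 h2]; split; apply: (hp_ge0 h).
  - by rewrite (segment_orient0 um).
  - by move=> e /mem_ed[h1 h2]; split; apply: (hp_ge0 h).
  - by rewrite orient_swap (segment_orient0 um) oppr0.
rewrite /Q' ed_split in pm.
have [r1 r2 r3 r4] := outer_join J um mx my pm pa.
by split=> //; rewrite (inner_perm q1) (outer_perm q2) (par_perm _ q2) /Q' ed_split; split.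
Qed.

Lemma lid_ex Q : sp Q -> ~ nolid Q -> exists x y s1 s2, lid_split Q x y s1 s2.
Proof.
move=> spQ nl; have [u [v [huv n1 n2]]] : exists u v,
    [/\ hp Q u v, (u, v) \notin ed Q & (v, u) \notin ed Q].
  apply: contrapT => h; apply: nl => u v huv.
  have [?|n1] := boolP ((u, v) \in ed Q); first by left.
  have [?|n2] := boolP ((v, u) \in ed Q); first by right.
  by case: h; exists u, v.
have [uQ vQ uv hpos] := huv; have [uniqQ sQ gQ _] := spQ.
have [t1 [t2 eQ]] := mem_cat_split uQ.
have er : rot (size t1) Q = u :: t2 ++ t1 by rewrite eQ rot_size_cat.
have vt : v \in t2 ++ t1.
  by move: vQ; rewrite -(mem_rot (size t1)) er inE eq_sym (negbTE uv).
have [s1 [s2 es]] := mem_cat_split vt.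
have eR : rot (size t1) Q = u :: s1 ++ v :: s2 by rewrite er es.
set Q' := u :: s1 ++ v :: s2 in eR.
have p1 : perm_eq Q Q' by rewrite -eR perm_sym perm_rot.
have p2 : perm_eq (ed Q) (ed Q') by rewrite -eR perm_sym ed_rot.
have spQ' : sp Q' by rewrite -eR; apply: sp_rot.
have s10 : s1 != [::].
  by apply: contra n1 => /eqP e; rewrite (perm_mem p2) /Q' e /= mem_head.
have s20 : s2 != [::].
  apply: contra n2 => /eqP e; rewrite (perm_mem p2) /Q' e ed_split /= mem_cat.
  by rewrite mem_head orbT.
have huv' : hp Q' u v := hp_perm p1 huv.
have ncd f : f \in ed Q' -> nc (u, v) f.
  move=> /mem_ed[f1 f2] k1 k2 k3 k4 z h1 h2; have [_ _ _ hp'] := huv'.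
  have : 0 < orient u v z by apply: orient_seg_gt0 h2; apply: hp'; rewrite // eq_sym.
  by rewrite (segment_orient0 h1) ltxx.
have J := diag_join spQ' s10 s20 ncd; have [m [um mu mv]] := join_mid J.
have pm : par (pe u (rcons s1 v) ++ pe v (rcons s2 u)) m = false.
  rewrite -ed_split; apply: (@par_right _ _ u v) => //; first exact: cyc_ed.
  - by move=> e /mem_ed[h1 h2]; split; apply: (hp_ge0 huv').
  - by rewrite (segment_orient0 um).
  - move=> h; case: J => _ _ [_ hd] _ _; case: (hd m _ um); try by apply/eqP.
    by move: h; rewrite ed_split => /on_cat.
(* Which chain bounds the pocket is not known beforehand; in the second case the ends of the lid are
   exchanged. *)
have [pa|pa] := outer_join_alt J um mu mv pm.
  by exists u, v, s1, s2; apply: lid_split_of => //; left.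
have e2 : v :: s2 ++ u :: s1 = rot (size (u :: s1)) Q'.
  by rewrite /Q' -[u :: s1 ++ _]cat_cons rot_size_cat.
exists v, u, s2, s1; apply: lid_split_of => //; rewrite ?e2.
- exact: sp_rot.
- by apply: perm_trans p1 _; rewrite perm_sym perm_rot.
- by apply: perm_trans p2 _; rewrite perm_sym ed_rot.
- by move=> f; rewrite (perm_mem (ed_rot _ _)) => /ncd/nc_swap.
- by right => /=; apply: hp_perm huv'; rewrite perm_sym perm_rot.
Qed.

(** An edge of the pocket chain has its midpoint strictly inside the filled polygon, hence strictly
    inside the hull. *)
Lemma lid_hull Q x y s1 s2 e : sp Q -> lid_split Q x y s1 s2 -> e \in ed Q -> hull_edge Q e ->
  e \in pe y (rcons s2 x).
Proof.
move=> spQ [[p1 p2] [s10 s20] ncd hl [r1 r2 r3 r4]] eQ he.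
have spQ' := sp_perm p1 p2 spQ.
have J := diag_join spQ' s10 s20 ncd; have [uxy _ _] := diag_uniq spQ'.
move: eQ; rewrite (perm_mem p2) ed_split mem_cat => /orP[e1|//].
have [g [h [gs hs gh ee]]] := pe_mid s10 uxy e1.
case: J => xy [c1 c2] [h12 hd] _ [_ _ b7 _].
pose m := (1 - 1 / 2) *: e.1 + (1 / 2) *: e.2.
have sm : segment e.1 e.2 m by exists (1 / 2); [lra|].
have uQ' : uniq (x :: s1 ++ y :: s2) by case: spQ'.
have gQ' : gp (x :: s1 ++ y :: s2) by case: spQ'.
have e12 : e.1 != e.2 by apply: pe_neq uxy e1.
have mv z : z \in x :: s1 ++ y :: s2 -> m != z.
  move=> zQ; apply/eqP => ez.
  have eQ' : e \in ed (x :: s1 ++ y :: s2) by rewrite ed_split mem_cat e1.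
  have [e1Q e2Q] := mem_ed eQ'.
  have [E1|n1] := eqVneq e.1 z.
    move: ez; rewrite -E1 => ez; case/eqP: e12; apply: pt_eq.
      by have := congr1 px ez; rewrite /m !pE; lra.
    by have := congr1 py ez; rewrite /m !pE; lra.
  have [E2|n2] := eqVneq e.2 z.
    move: ez; rewrite -E2 => ez; case/eqP: e12; apply: pt_eq.
      by have := congr1 px ez; rewrite /m !pE; lra.
    by have := congr1 py ez; rewrite /m !pE; lra.
  by move: sm; rewrite ez; apply: (gp_vertex gQ').
have mx : m != x by apply: mv; rewrite mem_head.
have my : m != y by apply: mv; rewrite inE mem_cat mem_head !orbT.
have m1 : on (pe x (rcons s1 y)) m by exists e.
have a1 : par ((x, y) :: pe y (rcons s2 x)) m.
  rewrite b7// -(par_perm _ (ed_close y s2 x)) //.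
have n2 : ~ on (ed (y :: rcons s2 x)) m.
  rewrite (on_perm _ (ed_close _ _ _)) => /on_cons[h'|h'].
    by case: (hd m (or_introl m1) h') => /eqP; apply/negP.
  by case: (h12 m m1 h') => /eqP; apply/negP.
have sub z : z \in y :: rcons s2 x -> z \in Q.
  move=> zs; rewrite (perm_mem p1); move: zs; rewrite !inE mem_rcons !inE mem_cat inE.
  by case/or3P => ->; rewrite ?orbT.
move: a1; rewrite -(par_perm _ (ed_close y s2 x)).
have om : orient e.1 e.2 m = 0 by apply: segment_orient0.
case: he => he.
  rewrite (@par_right _ _ e.1 e.2) ?om //; first exact: cyc_ed.
  by move=> f /mem_ed[/sub h1 /sub h2]; split; apply: (hp_ge0 he).
rewrite (@par_right _ _ e.2 e.1) ?om //; first exact: cyc_ed.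
- by rewrite eq_sym.
- by move=> f /mem_ed[/sub h1 /sub h2]; split; apply: (hp_ge0 he).
- by rewrite orient_swap om oppr0.
Qed.

(** Only hull edges are tracked: they all belong to the filled polygon and are hull edges of it, as
    is the lid, so the induction never has to reach an edge inside a pocket. *)
Definition ext_links Q := [/\
  forall a b, outer (ed Q) a -> outer (ed Q) b -> lk (outer (ed Q)) a b (size Q).+1./2,
  forall a e, outer (ed Q) a -> e \in ed Q -> hull_edge Q e ->
    reach (outer (ed Q)) a e (size Q).+1 &
  forall O a f e (s : nat), outer (ed Q) `<=` O -> f \in ed Q -> e \in ed Q ->
    hull_edge Q f -> hull_edge Q e -> (0 < s)%N ->
    reach O a f s -> reach O a e (s + size Q - 1)].

(** Beyond each hull side lies a free half-plane. The lines of two different sides are not parallel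
    in general position, and their intersection [z] lies in both half-planes. *)
Lemma nolid_link2 Q a b : sp Q -> nolid Q -> outer (ed Q) a -> outer (ed Q) b ->
  lk (outer (ed Q)) a b 2.
Proof.
move=> spQ nl ha hb; have [uQ sQ gQ _] := spQ.
have [u [v [huv oa]]] := outer_half spQ nl ha.
have [u' [v' [huv' ob]]] := outer_half spQ nl hb.
have [e|ne] := eqVneq (u, v) (u', v').
  case: e => e1 e2; rewrite -e1 -e2 in ob; apply/lk_S/lk1.
  by apply: subset_trans (half_convex oa ob) (hp_half huv).
have [uQ1 vQ uv hpos] := huv; have [uQ' vQ' uv' hpos'] := huv'.
have ne' : (u, v) != (v', u').
  apply/eqP => -[e1 e2]; have [t [tQ tu tv]] := third u v uQ sQ.
  have := hpos t tQ tu tv; have := hpos' t tQ; rewrite -e1 -e2 orient_swap => /(_ tv tu); lra.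
have cr : cross u v u' v' != 0 by case: gQ => _; apply.
have crE : cross u v u' v' = - (orient u' v' v - orient u' v' u).
  by rewrite /cross /orient; ring.
pose t := orient u' v' u / cross u v u' v'; pose z := u + t *: (v - u).
have z1 : orient u v z = 0 by rewrite /orient /z !pE; ring.
have z2 : orient u' v' z = 0.
  have -> : orient u' v' z = orient u' v' u + t * (orient u' v' v - orient u' v' u).
    by rewrite /orient /z !pE; ring.
  have -> : orient u' v' v - orient u' v' u = - cross u v u' v' by rewrite crE opprK.
  by rewrite /t mulrN divfK// subrr.
have l1 : lk (outer (ed Q)) a z 1.
  by apply/lk1/(subset_trans _ (hp_half huv))/half_convex; rewrite ?z1.
exists z => //; apply: subset_trans (hp_half huv').
by apply: half_convex; rewrite ?z2.
Qed.

Lemma seg_outer Q e : e \in ed Q -> segment e.1 e.2 `<=` outer (ed Q).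
Proof. by move=> eQ z hz; left; exists e. Qed.

Lemma ext_base_arith (j n : nat) : [/\ (4 < n)%N -> (j.+2.*2.+1 <= j.*2.+1 + n - 1)%N,
  (j.*2.+2.+2 = j.*2.+1 + 4 - 1)%N, (j.*2.+1.+2 = j.*2.+1 + 3 - 1)%N,
  (3 < n)%N -> (j.+2.*2.+1 <= j.*2.+2 + n - 1)%N & (j.*2.+2.+2 = j.*2.+2 + 3 - 1)%N].
Proof. by split; lia. Qed.

Lemma adjacent_link Q v w : v = w \/ (v, w) \in ed Q \/ (w, v) \in ed Q -> v \in Q ->
  (1 < size Q)%N -> lk (outer (ed Q)) v w 1.
Proof.
move=> h vQ sQ; case: h => [<-|[h|h]].
- by apply: lk_S; split=> //; left; apply: on_vertex.
- exact/lk1/(@seg_outer _ (v, w)).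
- by apply: lk1; rewrite segment_sym; apply: (@seg_outer _ (w, v)).
Qed.

Lemma adjacent3 Q v w : size Q = 3%N -> v \in Q -> w \in Q -> lk (outer (ed Q)) v w 1.
Proof.
move=> s3 vQ wQ; apply: adjacent_link => //; last by rewrite s3.
move: s3 vQ wQ; case: Q => [|x [|y [|z [|? ?]]]] // _.
by rewrite !inE => /or3P[] /eqP -> /or3P[] /eqP ->; rewrite ?eqxx ?orbT; auto.
Qed.

(** For four vertices, passing from one edge to another by two links after an odd count would take
    half a step too many; but two edges of a quadrilateral share a vertex or are joined by an
    edge. *)
Lemma adjacent4 Q f e : size Q = 4%N -> f \in ed Q -> e \in ed Q ->
  exists v w, [/\ v = f.1 \/ v = f.2, w = e.1 \/ w = e.2 & lk (outer (ed Q)) v w 1].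
Proof.
move=> s4 fQ eQ.
suff [v [w [h1 h2 h3]]] : exists v w, [/\ v = f.1 \/ v = f.2, w = e.1 \/ w = e.2 &
    v = w \/ (v, w) \in ed Q \/ (w, v) \in ed Q].
  exists v, w; split=> //; apply: adjacent_link h3 _ _; last by rewrite s4.
  by have [? ?] := mem_ed fQ; case: h1 => ->.
move: s4 fQ eQ; case: Q => [|x [|y [|z [|t [|? ?]]]]] // _.
have A : (x, y) \in ed [:: x; y; z; t] by rewrite !inE eqxx.
have B : (y, z) \in ed [:: x; y; z; t] by rewrite !inE eqxx ?orbT.
have C : (z, t) \in ed [:: x; y; z; t] by rewrite !inE eqxx ?orbT.
have D : (t, x) \in ed [:: x; y; z; t] by rewrite !inE eqxx ?orbT.
rewrite !inE => /or4P[] /eqP -> /or4P[] /eqP -> /=.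
- by exists x, x; split; auto.
- by exists y, y; split; auto.
- by exists x, t; split; auto.
- by exists x, x; split; auto.
- by exists y, y; split; auto.
- by exists y, y; split; auto.
- by exists z, z; split; auto.
- by exists y, x; split; auto.
- by exists z, y; split; auto.
- by exists z, z; split; auto.
- by exists z, z; split; auto.
- by exists t, t; split; auto.
- by exists x, x; split; auto.
- by exists x, y; split; auto.
- by exists t, t; split; auto.
- by exists x, x; split; auto.
Qed.

Lemma ext_links_base Q : sp Q -> nolid Q -> ext_links Q.
Proof.
move=> spQ nl; have sQ := size_sp spQ; have [uQ _ gQ _] := spQ.
have l2 := nolid_link2 spQ nl.
have ov v : v \in Q -> outer (ed Q) v by move=> h; left; apply: on_vertex; rewrite // ltnW.
split.
- move=> a b ha hb; apply: lk_le (l2 _ _ ha hb).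
  by case: (size Q) sQ => [|[|[|n]]].
- move=> a e ha eQ he; have [e1 e2] := mem_ed eQ.
  have [s3|s3] := leqP (size Q) 3; last first.
    have h5 : reach (outer (ed Q)) a e 5.
      by apply/(@reach_odd _ _ _ _ 2); split; apply: l2 => //; apply: ov.
    by apply: reach_le h5 => //; exact: seg_outer.
  have -> : size Q = 3%N by apply/eqP; rewrite eqn_leq s3.
  have [u [v [huv oa]]] := outer_half spQ nl ha; have [uQ1 vQ uv hpos] := huv.
  have st w : w = u \/ w = v -> lk (outer (ed Q)) a w 1.
    move=> h; apply/lk1/(subset_trans _ (hp_half huv))/half_convex => //.
    by case: h => ->; rewrite ?orient_aba ?orient_abb.
  apply/(@reach_even _ _ _ _ 1).
  (* There are only three vertices, so [e] shares an end with the hull side beyond which [a]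
     lies. *)
  have [E1|n1] := eqVneq e.1 u; first by left; apply: st; left.
  have [E2|n2] := eqVneq e.1 v; first by left; apply: st; right.
  have [E3|n3] := eqVneq e.2 u; first by right; apply: st; left.
  have [E4|n4] := eqVneq e.2 v; first by right; apply: st; right.
  have e12 : e.1 != e.2 by case: he => -[_ _ h _] //; rewrite eq_sym.
  exfalso; suff : (size [:: u; v; e.1; e.2] <= size Q)%N by rewrite leqNgt ltnS s3.
  apply: uniq_leq_size.
    by rewrite /= !inE !negb_or uv e12 !(eq_sym u) !(eq_sym v) n1 n2 n3 n4.
  by move=> z; rewrite !inE => /or4P[] /eqP ->.
- move=> O a f e s sO fQ eQ hf he s0.
  have [f1 f2] := mem_ed fQ; have [e1 e2] := mem_ed eQ.
  have se := subset_trans (seg_outer eQ) sO.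
  have l2' v w : v \in Q -> w \in Q -> lk O v w 2.
    by move=> vQ wQ; apply: (lk_mono sO); apply: l2; apply: ov.
  have st v w j k : lk O v w k -> lk O a v j -> lk O a w (j + k).
    by move=> h1 h2; apply: lk_trans h2 h1.
  have [s3|s3] := leqP (size Q) 3.
    have sz : size Q = 3%N by apply/eqP; rewrite eqn_leq s3.
    have l1 v w : v \in Q -> w \in Q -> lk O v w 1.
      by move=> vQ wQ; apply: (lk_mono sO); apply: adjacent3.
    rewrite sz; case/natS_case: (s0) => j [->|->]; have [_ _ k1 _ k2] := ext_base_arith j 3.
      rewrite -k1 => /reach_odd[h _]; rewrite -doubleS; apply/reach_odd; rewrite -addn1.
      by split; apply: st h; apply: l1.
    rewrite -k2 => h; apply: reach_S => //; rewrite -doubleS; apply/reach_odd; rewrite -addn1.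
    by move/reach_even: h => [] h; split; apply: st h; apply: l1.
  have key t : reach O a e t -> (0 < t)%N -> (t <= s + size Q - 1)%N -> reach O a e (s + size Q - 1).
    by move=> h h1 h2; apply: reach_le h.
  move: key; case/natS_case: (s0) => j [->|->] key; have [k1 k2 _ k3 _] := ext_base_arith j (size Q).
    move=> /reach_odd[h h']; have [s4|s4] := leqP (size Q) 4.
      have sz : size Q = 4%N by apply/eqP; rewrite eqn_leq s4.
      rewrite sz -k2; apply/(@reach_even _ _ _ _ j.+1); rewrite -addn1.
      have [v [w [hv hw vw]]] := adjacent4 sz fQ eQ.
      have hv' : lk O a v j by case: hv => ->.
      have := st _ _ _ _ (lk_mono sO vw) hv'.
      by case: hw => ->; [left|right].
    apply: key (k1 s4) => //; apply/reach_odd; rewrite -addn2.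
    by split; apply: st h; apply: l2'.
  move=> h; apply: key (k3 s3) => //; apply/reach_odd; rewrite -addn2.
  by move/reach_even: h => [] h; split; apply: st h; apply: l2'.
Qed.

Lemma ext_links_perm Q Q' : perm_eq Q Q' -> perm_eq (ed Q) (ed Q') ->
  ext_links Q' -> ext_links Q.
Proof.
move=> p1 p2 [A C B]; rewrite /ext_links (outer_perm p2) (perm_size p1).
have hl e : hull_edge Q e -> hull_edge Q' e by case=> h; [left|right]; apply: hp_perm h.
split=> //; first by move=> a e ha; rewrite (perm_mem p2) => eP /hl; apply: C.
by move=> O a f e s sO; rewrite !(perm_mem p2) => fP eP /hl hf /hl he; apply: B.
Qed.

Lemma cut_arith3 (k1 k2 : nat) :
  [/\ (k1.+2./2 <= (k1 + k2).+2.+1./2)%N, (k2.+2.+1./2 <= (k1 + k2).+2.+1./2)%N,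
      (k1.+2 + k2.+2.+1 - 2 = (k1 + k2).+2.+1)%N, (k2.+2.+1 <= (k1 + k2).+2.+1)%N &
      (k1.+2 + k2.+2 - 1 = (k1 + k2).+2.+1)%N /\
      forall s : nat, (0 < s)%N -> (0 < s + k2.+2 - 1)%N /\ (s + k2.+2 - 1 <= s + (k1 + k2).+2 - 1)%N].
Proof. by split; try lia; split; lia. Qed.

(** Let the pocket have n1 and the filled polygon n2 vertices. From the pocket the lid is reached in
    n1 half steps by the interior bound, and passing on costs n2 - 1, in all n + 1; from outside the
    filled polygon the lid is reached in n2 + 1. *)
Theorem ext_linksP Q : sp Q -> ext_links Q.
Proof.
have [n] := ubnP (size Q); elim: n Q => // n ih Q; rewrite ltnS => sn spQ.
have [nl|nl] := pselect (nolid Q); first exact: ext_links_base.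
have [x [y [s1 [s2 ls]]]] := lid_ex spQ nl.
have lhull := lid_hull spQ ls.
case: ls => -[p1 p2] [s10 s20] ncd hl [r1 r2 r3 _].
have spQ' := sp_perm p1 p2 spQ.
have lhull' e : e \in ed (x :: s1 ++ y :: s2) -> hull_edge (x :: s1 ++ y :: s2) e ->
    e \in pe y (rcons s2 x).
  rewrite -(perm_mem p2) => h1 h2; apply: lhull => //.
  by case: h2 => h2; [left|right]; apply: hp_perm h2; rewrite perm_sym.
apply: (ext_links_perm p1 p2); set Q' := x :: s1 ++ y :: s2 in r1 r2 r3 spQ' ncd hl lhull' *.
have sp1 := diag_sp1 spQ' s10 ncd; have sp2 := diag_sp2 spQ' s10 s20 ncd.
have q1 := ed_close x s1 y; have q2 := ed_close y s2 x.
have z1 : size (x :: rcons s1 y) = (size s1).+2 by rewrite /= size_rcons.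
have z2 : size (y :: rcons s2 x) = (size s2).+2 by rewrite /= size_rcons.
have zQ : size Q' = (size s1 + size s2).+2 by rewrite /Q' /= size_cat /= addnS.
have n1 : (0 < size s1)%N by rewrite lt0n size_eq0.
have zQn : (size Q' <= n)%N by rewrite -(perm_size p1).
have lt2 : (size (y :: rcons s2 x) < n)%N by apply: leq_trans zQn; rewrite z2 zQ !ltnS -add1n leq_add2r.
have [A1 _ B1] := int_linksP sp1.
have [B2 A2 C2] := ih _ lt2 sp2.
have sub z : z \in y :: rcons s2 x -> z \in Q'.
  by rewrite /Q' !inE mem_rcons !inE mem_cat inE => /or3P[] ->; rewrite ?orbT.
have md1 : (y, x) \in ed (x :: rcons s1 y) by rewrite (perm_mem q1) mem_head.
have md2 : (x, y) \in ed (y :: rcons s2 x) by rewrite (perm_mem q2) mem_head.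
have m2 e : e \in ed Q' -> hull_edge Q' e ->
    e \in ed (y :: rcons s2 x) /\ hull_edge (y :: rcons s2 x) e.
  move=> eQ he; have eP : e \in ed (y :: rcons s2 x).
    by rewrite (perm_mem q2) inE lhull' ?orbT.
  split=> //; have [e1 e2] := mem_ed eP.
  exact: hull_edge_sub sub e1 e2 he.
have hxy : hull_edge (y :: rcons s2 x) (x, y).
  have [e1 e2] := mem_ed md2; exact: hull_edge_sub sub e1 e2 hl.
have sd : segment (x, y).1 (x, y).2 `<=` outer (ed Q').
  by move=> z hz; apply: r3; left; exists (x, y).
have [a1 a2 a3 a4 [a5 a6]] := cut_arith3 (size s1) (size s2).
rewrite z1 in A1 B1; rewrite z2 in A2 B2 C2; rewrite /ext_links zQ.
have R1 a : inner (ed (x :: rcons s1 y)) a -> reach (outer (ed Q')) a (x, y) (size s1).+2.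
  by move=> ha; apply/reach_swap/(reach_mono r2)/A1.
have R2 a : outer (ed (y :: rcons s2 x)) a -> reach (outer (ed Q')) a (x, y) (size s2).+2.+1.
  by move=> ha; apply/(reach_mono r3)/A2.
split.
- move=> a b /r1[ha|ha] /r1[hb|hb].
  + exact: lk_le a1 (lk_mono r2 (B1 a b ha hb)).
  + by have := reach_link sd (ltn0Sn _) (ltn0Sn _) (R1 a ha) (R2 b hb); rewrite a3.
  + by have := reach_link sd (ltn0Sn _) (ltn0Sn _) (R1 b hb) (R2 a ha); rewrite a3 => /lk_sym.
  + exact: lk_le a2 (lk_mono r3 (B2 a b ha hb)).
- move=> a e /r1[ha|ha] eQ he; have [eP he'] := m2 e eQ he.
    by have := C2 (outer (ed Q')) a (x, y) e _ r3 md2 eP hxy he' (ltn0Sn _) (R1 a ha); rewrite a5.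
  apply: (@reach_le _ _ _ _ (size s2).+2.+1) => //; first exact: seg_outer.
  by apply: (reach_mono r3); apply: A2.
- move=> O a f e s sO fQ eQ hf he s0 h.
  have [eP he'] := m2 e eQ he; have [fP hf'] := m2 f fQ hf.
  have [k1 k2] := a6 s s0.
  apply: (reach_le _ k1 k2); first exact: subset_trans (seg_outer eQ) sO.
  by apply: C2 h => //; apply: subset_trans sO.
Qed.
End Exterior.

(** * Perturbation *)

Section Perturb.
Variable R : realType.
Implicit Types a b c u v w x y z m : pt R.
Local Notation edge := (pt R * pt R)%type.
Implicit Types (E : seq edge) (e f : edge) (Q D : seq (pt R)) (O : set (pt R)).

Lemma norm_px x : `|px x| <= `|x|.
Proof. by rewrite [leRHS]mx_normrE; apply: (le_bigmax _ (fun i => `|x i.1 i.2|) (ord0, ord0)). Qed.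
Lemma norm_le x (M : R) : `|px x| <= M -> `|py x| <= M -> `|x| <= M.
Proof.
move=> h1 h2; rewrite [leLHS]mx_normrE; apply: bigmax_le; first exact: le_trans h1.
case=> i j _ /=; rewrite ord1; have [->|nj] := eqVneq j ord0; first exact: h1.
suff -> : j = lift ord0 ord0 by [].
by case: j nj => -[|[|?]]//= ? _; apply/val_inj.
Qed.

Lemma dist_on E z : ~ on E z -> exists2 d : R, 0 < d & forall w, on E w -> d <= `|w - z|.
Proof.
move=> /off_near/nbhs_ballP[d /= d0 h]; exists d => // w wE.
rewrite leNgt; apply/negP => hw; apply: (h w) => //.
by rewrite -ball_normE /ball_ /= distrC.
Qed.

Lemma dist_seg a b x y : sdisj a b x y ->
  exists2 d : R, 0 < d & forall z w, segment a b z -> segment x y w -> d <= `|z - w|.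
Proof.
move=> h; pose S := [set z - w | z in segment a b & w in segment x y].
have cS : compact S.
  have -> : S = (fun p : pt R * pt R => p.1 - p.2) @` (segment a b `*` segment x y).
    apply/seteqP; split=> z; first by case=> s sa [t tb <-]; exists (s, t).
    by case=> -[s t] /= [sa tb] <-; exists s => //; exists t.
  apply: continuous_compact.
    apply: continuous_subspaceT => p; apply: cvgB; [exact: cvg_fst|exact: cvg_snd].
  by apply: compact_setX; exact: segment_compact_pt.
have [|||m Sm hm] := @EVT_min_rV R _ (fun z => `|z|) S.
- by exists (a - x); exists a; [exact: segment_l|exists x => //; exact: segment_l].
- exact: cS.
- by apply: continuous_subspaceT; exact: norm_continuous.
exists `|m|.
  rewrite normr_gt0; apply/eqP => m0; move: Sm; rewrite inE m0 => -[z hz [w hw e]].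
  by apply: (h z) => //; have -> : z = w by apply/eqP; rewrite -subr_eq0 e.
by move=> z w hz hw; apply: hm; rewrite inE; exists z => //; exists w.
Qed.

Definition nbd (r : R) a b : set (pt R) := [set z | exists2 w, segment a b w & `|z - w| <= r].

Lemma nbd_convex r a b x y : nbd r a b x -> nbd r a b y -> segment x y `<=` nbd r a b.
Proof.
move=> [x' sx hx] [y' sy hy] z [t /andP[t0 t1] ->].
exists ((1 - t) *: x' + t *: y').
  by apply: (segment_conv sx sy); exists t; rewrite ?t0.
have -> : (1 - t) *: x + t *: y - ((1 - t) *: x' + t *: y') =
  (1 - t) *: (x - x') + t *: (y - y') by apply: pt_eq; rewrite !pE; ring.
apply: (le_trans (ler_normD _ _)); rewrite !normrZ !ger0_norm//; last by lra.
have : (1 - t) * `|x - x'| <= (1 - t) * r by apply: ler_wpM2l => //; lra.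
have : t * `|y - y'| <= t * r by apply: ler_wpM2l.
lra.
Qed.

Lemma vertical_between a b c d z : px a <= px z -> px z < px b -> px c <= px z -> px z < px d ->
  orient a b z < 0 -> 0 <= orient c d z ->
  exists x y, [/\ segment a b x, segment c d y & segment x y z].
Proof.
move=> az zb cz zd h1 h2.
have [x sx ex] : exists2 x, segment a b x & px x = px z by apply: at_abscissa; lra.
have [y sy ey] : exists2 y, segment c d y & px y = px z by apply: at_abscissa; lra.
exists x, y; split=> //.
have hx : py z < py x.
  have : orient a b z = (px b - px a) * (py z - py x).
    by have := segment_orient0 sx; rewrite /orient ex; lra.
  move=> e; move: h1; rewrite e pmulr_rlt0; lra.
have hy : py y <= py z.
  have : orient c d z = (px d - px c) * (py z - py y).
    by have := segment_orient0 sy; rewrite /orient ey; lra.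
  move=> e; move: h2; rewrite e pmulr_rge0; lra.
rewrite segment_sym; exists ((py z - py y) / (py x - py y)).
  by rewrite divr_ge0 ?ler_pdivrMr; lra.
by apply: pt_eq; rewrite !pE ?ex ?ey; field; lra.
Qed.

Definition tri_par a b c z := ray a b z (+) ray b c z (+) ray c a z.

(** An odd count puts [z] on a vertical segment between two sides, hence in every convex set
    containing the vertices. Degenerate triangles need no separate treatment. *)
Lemma tri_par_nbd r u v a b c z : nbd r u v a -> nbd r u v b -> nbd r u v c ->
  tri_par a b c z -> nbd r u v z.
Proof.
move=> ha hb hc.
have conv a' b' c' d' : nbd r u v a' -> nbd r u v b' -> nbd r u v c' -> nbd r u v d' ->
  (exists x y, [/\ segment a' b' x, segment c' d' y & segment x y z]) -> nbd r u v z.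
  move=> na nb nc_ nd [x [y [sx sy sz]]].
  exact: nbd_convex (nbd_convex na nb sx) (nbd_convex nc_ nd sy) _ sz.
have key a' b' c' d' : nbd r u v a' -> nbd r u v b' -> nbd r u v c' -> nbd r u v d' ->
  px a' <= px z -> px z < px b' -> px c' <= px z -> px z < px d' ->
  (orient a' b' z < 0) (+) (orient c' d' z < 0) -> nbd r u v z.
  move=> na nb nc_ nd h1 h2 h3 h4; have [k1|k1] := ltP (orient a' b' z) 0;
  have [k2|k2] := ltP (orient c' d' z) 0 => // _.
    by apply: (conv a' b' c' d') => //; apply: vertical_between.
  by apply: (conv c' d' a' b') => //; apply: vertical_between.
rewrite /tri_par /ray.
have [ka|ka] := leP (px a) (px z); have [kb|kb] := leP (px b) (px z);
have [kc|kc] := leP (px c) (px z); rewrite /= ?orbF ?addbF ?addFb //=.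
- by rewrite ?addFb; apply: (key b c a c).
- by rewrite ?addbF; apply: (key a b c b).
- by rewrite ?addbF; apply: (key a b a c).
- by rewrite ?addbF; apply: (key b a c a).
- by rewrite ?addbF; apply: (key b a b c).
- by rewrite ?addbF; apply: (key c b c a).
Qed.

Definition edg (p : nat -> pt R) n : seq edge := [seq (p i, p (i.+1 %% n)%N) | i <- iota 0 n].

Lemma ed_mkseq (p : nat -> pt R) n : (0 < n)%N -> ed (mkseq p n) = edg p n.
Proof.
case: n => // n _; rewrite /edg [LHS]/=.
have h : forall k a : nat, pe (p a) (rcons [seq p i | i <- iota a.+1 k] (p 0%N)) =
    rcons [seq (p i, p i.+1) | i <- iota a k] (p (a + k)%N, p 0%N).
  elim=> [|k ih] a /=; first by rewrite addn0.
  by rewrite ih addSnnS.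
rewrite h add0n -[in RHS]/(iota 0 n.+1) -addn1 iotaD map_cat cats1 /= add0n addn1 modnn.
congr rcons; apply/eq_in_map => i; rewrite mem_iota add0n => /= hi.
by rewrite modn_small// ltnS.
Qed.

Lemma mem_edg p n e : e \in edg p n <-> exists2 i, (i < n)%N & e = (p i, p (i.+1 %% n)%N).
Proof.
split=> [/mapP[i]|[i hi ->]]; first by rewrite mem_iota add0n => /andP[_ hi] ->; exists i.
by apply/mapP; exists i; rewrite // mem_iota add0n.
Qed.

Lemma cyc_edg p n : (0 < n)%N -> cyc (edg p n).
Proof. by move=> n0; rewrite -ed_mkseq//; exact: cyc_ed. Qed.

(** An old edge and its new version bound a quadrilateral, split into two triangles by a diagonal.
    Where these have even parity, the two edges differ only by the segments [p i, p' i], whose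
    contributions cancel around the cycle. *)
Lemma par_perturb (p p' : nat -> pt R) n z : (0 < n)%N ->
  (forall i, (i < n)%N -> tri_par (p i) (p (i.+1 %% n)%N) (p' (i.+1 %% n)%N) z = false) ->
  (forall i, (i < n)%N -> tri_par (p i) (p' i) (p' (i.+1 %% n)%N) z = false) ->
  par (edg p n) z = par (edg p' n) z.
Proof.
move=> n0 h1 h2.
have tele (g : nat -> bool) : \big[addb/false]_(i <- iota 0 n) (g i (+) g (i.+1 %% n)%N) = false.
  case: n n0 {h1 h2} => // n _.
  rewrite -[n.+1]addn1 iotaD big_cat /= add0n big_cons big_nil addbF addn1 modnn.
  have -> : \big[addb/false]_(i <- iota 0 n) (g i (+) g (i.+1 %% n.+1)%N) = g 0%N (+) g n.
    have -> : \big[addb/false]_(i <- iota 0 n) (g i (+) g (i.+1 %% n.+1)%N) =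
        \big[addb/false]_(i <- iota 0 n) (g i (+) g i.+1).
      rewrite !big_seq; apply: eq_bigr => i; rewrite mem_iota add0n => /= hi.
      by rewrite modn_small// ltnS.
    elim: n => [|n ih]; first by rewrite big_nil addbb.
    rewrite -[n.+1]addn1 iotaD big_cat ih /= add0n big_cons big_nil addbF addn1.
    by case: (g 0%N); case: (g n); case: (g n.+1).
  by case: (g 0%N); case: (g n).
have := tele (fun i => ray (p i) (p' i) z).
have -> : \big[addb/false]_(i <- iota 0 n)
      (ray (p i) (p' i) z (+) ray (p (i.+1 %% n)%N) (p' (i.+1 %% n)%N) z) =
    par (edg p n) z (+) par (edg p' n) z; last first.
  by case: (par _ _); case: (par _ _).
rewrite /par /edg !big_map -big_split /= !big_seq; apply: eq_bigr => i.
rewrite mem_iota add0n => /= hi; have := h1 i hi; have := h2 i hi; rewrite /tri_par.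
rewrite (rayC (p' (i.+1 %% n)%N) (p i)).
by case: (ray (p i) (p' i) z); case: (ray (p i) (p (i.+1 %% n)%N) z);
   case: (ray (p (i.+1 %% n)%N) _ z); case: (ray (p' i) _ z); case: (ray (p i) _ z).
Qed.

(* Walking out to infinity from a point of [E'], the first of the two curves that is met decides
   on which side of [E] the point lies. *)
Lemma contain_in E E' : cyc E -> cyc E' -> (forall z, on E z -> on E' z -> False) ->
  (forall z, on E' z -> par E z) -> (forall z, on E z -> par E' z = false) ->
  forall z, inner E' z -> ~ on E z /\ par E z.
Proof.
move=> c c' dj h h' z [hz|hz].
  by split; [move=> hE; exact: dj hE hz|exact: h].
have nz : ~ on E z by move=> /h'; rewrite hz.
split=> //; apply/negPn/negP => pz.
have [M M0 hM] := inbox_ex (E ++ E').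
have w0 : (mkpt 1 0 : pt R) != 0.
  by apply/eqP => /(congr1 (@px R)); rewrite px_mk /px mxE => /eqP; rewrite oner_eq0.
have [T T0 hT] := far_along M z w0.
have [ho|[m [sm mE hm]]] := first_hit (E ++ E') z (z + T *: mkpt 1 0).
  move: hz; rewrite (@par_const _ E' _ (z + T *: mkpt 1 0)) ?(@par_far _ M) //.
    by move=> e eE; apply: hM; rewrite mem_cat eE orbT.
  by move=> y hy yE; apply: (ho y hy); apply/on_cat; right.
case/on_cat: mE => mE.
  move: hz; rewrite (@par_const _ E' z m) ?h'// => y hy yE.
  have [ey|ny] := eqVneq y m; first by apply: (dj m mE); rewrite -ey.
  by apply: (hm y hy ny); apply/on_cat; right.
move: pz; rewrite (@par_const _ E z m) ?h// => y hy yE.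
have [ey|ny] := eqVneq y m; first by apply: (dj m _ mE); rewrite -ey.
by apply: (hm y hy ny); apply/on_cat; left.
Qed.

Lemma contain_out E E' : cyc E -> cyc E' -> (forall z, on E z -> on E' z -> False) ->
  (forall z, on E' z -> par E z = false) -> (forall z, on E z -> par E' z) ->
  forall z, outer E' z -> ~ on E z /\ par E z = false.
Proof.
move=> c c' dj h h' z [hz|hz].
  by split; [move=> hE; exact: dj hE hz|exact: h].
have nz : ~ on E z by move=> /h'; rewrite (negbTE hz).
split=> //; apply/negP => pz.
have [M M0 hM] := inbox_ex (E ++ E').
have w0 : (mkpt 1 0 : pt R) != 0.
  by apply/eqP => /(congr1 (@px R)); rewrite px_mk /px mxE => /eqP; rewrite oner_eq0.
have [T T0 hT] := far_along M z w0.
have [ho|[m [sm mE hm]]] := first_hit (E ++ E') z (z + T *: mkpt 1 0).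
  move: pz; rewrite (@par_const _ E _ (z + T *: mkpt 1 0)) ?(@par_far _ M) //.
    by move=> e eE; apply: hM; rewrite mem_cat eE.
  by move=> y hy yE; apply: (ho y hy); apply/on_cat; left.
case/on_cat: mE => mE.
  move: hz; rewrite (@par_const _ E' z m) ?h'// => y hy yE.
  have [ey|ny] := eqVneq y m; first by apply: (dj m mE); rewrite -ey.
  by apply: (hm y hy ny); apply/on_cat; right.
move: pz; rewrite (@par_const _ E z m) ?h// => y hy yE.
have [ey|ny] := eqVneq y m; first by apply: (dj m _ mE); rewrite -ey.
by apply: (hm y hy ny); apply/on_cat; left.
Qed.

Definition detv v w : R := px v * py w - py v * px w.

Lemma detv_continuous w c : continuous (fun x => detv w (x - c)).
Proof.
have -> : (fun x => detv w (x - c)) =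
    (fun x => px w * py x - py w * px x - (px w * py c - py w * px c)).
  by apply/funext => x; rewrite /detv !pE; ring.
move=> x; apply: (cvgB (cvgB (cvgM (cvg_cst _) (@py_continuous R x))
  (cvgM (cvg_cst _) (@px_continuous R x))) (cvg_cst _)).
Qed.

(** Finitely many lines, given by point and direction, do not cover an open set: a point on the
    first line is moved off along the normal, and the other lines are avoided within the smaller
    open set. *)
Lemma avoid_lines O (L : seq edge) : open O -> O !=set0 -> (forall l, l \in L -> l.2 != 0) ->
  exists2 x, O x & forall l, l \in L -> detv l.2 (x - l.1) != 0.
Proof.
elim: L O => [|l L ih] O oO [x Ox] hL; first by exists x.
pose O' := O `&` [set x | detv l.2 (x - l.1) != 0].
have l0 : l.2 != 0 by apply: hL; rewrite mem_head.
have oO' : open O'.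
  apply: openI => //; rewrite (_ : [set x | _] = (fun x => detv l.2 (x - l.1)) @^-1` [set t | t != 0]) //.
  by apply: open_comp; [move=> y _; exact: detv_continuous|exact: open_neq].
have nO' : O' !=set0.
  have [e|ne] := eqVneq (detv l.2 (x - l.1)) 0; last by exists x.
  have [d d0 hd] := @near_line _ O x (mkpt (- py l.2) (px l.2)) (open_nbhs_nbhs (conj oO Ox)).
  exists (x + d *: mkpt (- py l.2) (px l.2)); split.
    by apply: hd; rewrite ger0_norm// ltW.
  rewrite /=; have -> : detv l.2 (x + d *: mkpt (- py l.2) (px l.2) - l.1) =
    detv l.2 (x - l.1) + d * (px l.2 ^+ 2 + py l.2 ^+ 2) by rewrite /detv !pE; ring.
  rewrite e add0r mulf_neq0 ?gt_eqF// lt_def addr_ge0 ?sqr_ge0// andbT.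
  rewrite paddr_eq0 ?sqr_ge0// !sqrf_eq0; apply: contra l0 => /andP[/eqP h1 /eqP h2].
  by apply/eqP/pt_eq; rewrite ?h1 ?h2 /px /py mxE.
have hL' l' : l' \in L -> l'.2 != 0 by move=> h; apply: hL; rewrite inE h orbT.
have [y [Oy hy] hl] := ih O' oO' nO' hL'.
by exists y => // l'; rewrite inE => /orP[/eqP ->|/hl].
Qed.

Lemma gp_choose (O : nat -> set (pt R)) n : (forall i, (i < n)%N -> open (O i) /\ O i !=set0) ->
  exists p : nat -> pt R, [/\ forall i, (i < n)%N -> O i (p i), uniq (mkseq p n) & gp (mkseq p n)].
Proof.
elim: n => [|n ih] hO.
  by exists (fun=> 0); split=> //; split.
have [p [hp up gpp]] := ih (fun i hi => hO i (ltnW hi)).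
set D := mkseq p n in up gpp.
have cD a b c d : cross a b c d = detv (b - a) (d - c) by rewrite /cross /detv !pE.
(* The new vertex avoids the verticals through the old ones and, through each old one, the parallels
   to all lines spanned by old pairs. This also excludes collinear triples. *)
pose L := [seq (c, mkpt 0 1) | c <- D] ++
  [seq l <- [seq (c, ab.2 - ab.1) | c <- D, ab <- [seq (a, b) | a <- D, b <- D]] | l.2 != 0].
have [oO nO] := hO n (ltnSn n).
have [|x Ox hx] := avoid_lines oO nO (L := L).
  move=> l; rewrite mem_cat => /orP[/mapP[c _ ->] /=|]; last by rewrite mem_filter => /andP[].
  by apply/eqP => /(congr1 (@py R)); rewrite py_mk /py mxE => /eqP; rewrite oner_eq0.
have K0 c : c \in D -> px x != px c.
  move=> cD'; have := hx (c, mkpt 0 1); rewrite mem_cat map_f//= => /(_ isT).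
  by apply: contraNneq => e; rewrite /detv !pE e; apply/eqP; ring.
have K1 j k l : j \in D -> k \in D -> l \in D -> k != l -> detv (l - k) (x - j) != 0.
  move=> jD kD lD kl; have := hx (j, l - k); rewrite mem_cat mem_filter; apply.
  rewrite /= subr_eq0 eq_sym kl /=; apply/orP; right.
  apply/allpairsP; exists (j, (k, l)); split=> //=; apply/allpairsP.
  by exists (k, l).
pose p' i := if (i < n)%N then p i else x.
have e' : mkseq p' n.+1 = rcons D x.
  rewrite /mkseq -addn1 iotaD map_cat add0n /= cats1 /p' ltnn; congr rcons.
  by apply/eq_in_map => i; rewrite mem_iota add0n => /= ->.
have xD : x \notin D by apply/negP => /K0; rewrite eqxx.
exists p'; rewrite e'; split.
- move=> i; rewrite ltnS leq_eqVlt /p' => /orP[/eqP ->|hi]; first by rewrite ltnn.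
  by rewrite hi; apply: hp.
- by rewrite rcons_uniq xD.
have mr a : a \in rcons D x -> a = x \/ a \in D.
  by rewrite mem_rcons inE => /orP[/eqP|]; auto.
case: gpp => g1 g2; split.
  move=> a b /mr[->|aD] /mr[->|bD]; rewrite ?eqxx// => ab; first exact: K0.
    by rewrite eq_sym; exact: K0.
  exact: g1.
have ne a : a \in D -> x != a by move=> aD; apply: contraNneq xD => ->.
move=> a b c d ha hb hc hd ab cd h1 h2.
have [N1 N2 N3] : [/\ (a = c -> b != d), (b = d -> a != c) & (a = d -> b != c)].
  split=> e; move: h1 h2; rewrite !xpair_eqE e eqxx ?andbT //=.
have {}N4 : b = c -> a != d.
  by move=> e; move: h2; rewrite xpair_eqE e eqxx ?andbT.
case/mr: ha => [ea|aD]; case/mr: hb => [eb|bD]; case/mr: hc => [ec|cD']; case/mr: hd => [ed'|dD];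
  rewrite cD; try by [rewrite ea eb eqxx in ab|rewrite ec ed' eqxx in cd].
- have := N1 (etrans ea (esym ec)) => bd; have := K1 b b d bD bD dD bd.
  by apply: contraNneq => h; rewrite ea ec in h; rewrite -[X in _ == X]h /detv !pE; apply/eqP; ring.
- have := N3 (etrans ea (esym ed')) => bc; have := K1 b b c bD bD cD' bc.
  by apply: contraNneq => h; rewrite ea ed' in h; rewrite -[X in _ == X]oppr0 -h /detv !pE; apply/eqP; ring.
- have := K1 b c d bD cD' dD cd.
  by apply: contraNneq => h; rewrite ea in h; rewrite -[X in _ == X]h /detv !pE; apply/eqP; ring.
- have := N4 (etrans eb (esym ec)) => ad; have := K1 a a d aD aD dD ad.
  by apply: contraNneq => h; rewrite eb ec in h; rewrite -[X in _ == X]oppr0 -h /detv !pE; apply/eqP; ring.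
- have := N2 (etrans eb (esym ed')) => ac; have := K1 a a c aD aD cD' ac.
  by apply: contraNneq => h; rewrite eb ed' in h; rewrite -[X in _ == X]h /detv !pE; apply/eqP; ring.
- have := K1 a c d aD cD' dD cd.
  by apply: contraNneq => h; rewrite eb in h; rewrite -[X in _ == X]oppr0 -h /detv !pE; apply/eqP; ring.
- have := K1 d a b dD aD bD ab.
  by apply: contraNneq => h; rewrite ec in h; rewrite -[X in _ == X]oppr0 -h /detv !pE; apply/eqP; ring.
- have := K1 c a b cD' aD bD ab.
  by apply: contraNneq => h; rewrite ed' in h; rewrite -[X in _ == X]h /detv !pE; apply/eqP; ring.
- by rewrite -cD; apply: g2.
Qed.
End Perturb.

(** * Replacing a polygon by a nearby one on a given side *)

Section Offset.
Variable R : realType.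
Implicit Types a b c u v w x y z m : pt R.
Local Notation edge := (pt R * pt R)%type.
Implicit Types (E : seq edge) (e f : edge) (Q D : seq (pt R)) (O : set (pt R)).

(** Zero-based form: edge [i] starts at [p i], and successors are taken modulo [n]. Consecutive
    edges have a clause of their own. *)
Definition simple (p : nat -> pt R) n : Prop := [/\ (2 < n)%N,
  forall i j, (i < n)%N -> (j < n)%N -> p i = p j -> i = j,
  forall i j, (i < n)%N -> (j < n)%N -> i != j -> j != (i.+1 %% n)%N -> i != (j.+1 %% n)%N ->
    sdisj (p i) (p (i.+1 %% n)%N) (p j) (p (j.+1 %% n)%N) &
  forall i j k z, (i < n)%N -> j = (i.+1 %% n)%N -> k = (j.+1 %% n)%N ->
    segment (p i) (p j) z -> segment (p j) (p k) z -> z = p j].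

Lemma modS_neq n i : (1 < n)%N -> (i < n)%N -> (i.+1 %% n)%N != i.
Proof.
move=> n1 hi; have [h|h] := ltnP i.+1 n; first by rewrite modn_small//; lia.
have -> : i.+1 = n by lia.
by rewrite modnn; lia.
Qed.

Lemma modSS_neq n i : (2 < n)%N -> (i < n)%N -> ((i.+1 %% n).+1 %% n)%N != i.
Proof.
move=> n1 hi; have [h|h] := ltnP i.+1 n.
  rewrite (modn_small h); have [h'|h'] := ltnP i.+2 n; first by rewrite modn_small//; lia.
  have -> : i.+2 = n by lia.
  by rewrite modnn; lia.
have -> : i.+1 = n by lia.
by rewrite modnn modn_small; lia.
Qed.

Lemma simpleP n (p : nat -> pt R) : (2 < n)%N -> simple_closed_polygon n p <-> simple p n.
Proof.
move=> n2; have n0 : (0 < n)%N by lia.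
have eE i : (i < n)%N -> Defs.edge n p i.+1 = segment (p i) (p (i.+1 %% n)%N).
  by move=> hi; rewrite /Defs.edge /vtx /= modn_small.
have md i : (i.+1 %% n < n)%N by rewrite ltn_mod.
split=> [[h1 h2]|[_ h1 h2 h3]].
  split=> //.
    move=> i j hi hj ij n1 n2' z zi zj.
    have := h2 i.+1 j.+1 hi hj; rewrite !eE// !addn1 !eqSS.
    rewrite (negbTE n1) (negbTE n2') => /(_ _) h.
    have /h e : i.+1 <> j.+1 by move=> [e]; rewrite e eqxx in ij.
    by have : set0 z by rewrite -e.
  move=> i j k z hi ej ek zi zj.
  have hj : (j < n)%N by rewrite ej.
  have nij : i.+1 <> j.+1 by move=> [e]; move: (@modS_neq n i (ltnW n2) hi); rewrite -ej -e eqxx.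
  have := h2 i.+1 j.+1 hi hj nij; rewrite !eE// !addn1 !eqSS -ej eqxx -ek => e.
  by have : [set vtx n p i.+1] z; [rewrite -e|rewrite /= /vtx -ej].
split=> // -[|i] [|j]// /andP[_ hi] /andP[_ hj] /eqP; rewrite eqSS => ij.
rewrite !eE// !addn1 !eqSS.
have core i' j' : (i' < n)%N -> j' = (i'.+1 %% n)%N ->
   segment (p i') (p (i'.+1 %% n)%N) `&` segment (p j') (p (j'.+1 %% n)%N) = [set p j'].
  move=> hi' ->; apply/seteqP; split=> [z [/= z1 z2]|z /= ->].
    exact: (h3 i' _ _ z hi' erefl erefl).
  by split; [exact: segment_r|exact: segment_l].
case: ifPn => [/eqP e|n1]; first by rewrite core// /vtx -e.
case: ifPn => [/eqP e|n2']; first by rewrite setIC core// /vtx -e.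
by apply/seteqP; split=> [z [/= z1 z2]|//]; exact: (h2 i j hi hj ij n1 n2' z z1 z2).
Qed.

Lemma polygonE n (p : nat -> pt R) z : (0 < n)%N -> polygon n p z <-> on (edg p n) z.
Proof.
move=> n0; have eE i : (i < n)%N -> Defs.edge n p i.+1 = segment (p i) (p (i.+1 %% n)%N).
  by move=> hi; rewrite /Defs.edge /vtx /= modn_small.
split=> [[[|i] //= hi]|[e /mem_edg[i hi ->] /= h]].
  by rewrite eE// => h; exists (p i, p (i.+1 %% n)%N) => //; apply/mem_edg; exists i.
by exists i.+1; rewrite //= eE.
Qed.

(** * Properties that survive small perturbations of the vertices *)

Section Stable.
Variables (n : nat) (p : nat -> pt R).

(* [P] holds for all sufficiently small perturbations of the vertices of [p]. *)
Definition stable (P : (nat -> pt R) -> Prop) := exists2 r : R, 0 < r &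
  forall q, (forall i, (i < n)%N -> `|q i - p i| < r) -> P q.

Lemma stable_and P1 P2 : stable P1 -> stable P2 -> stable (fun q => P1 q /\ P2 q).
Proof.
move=> [r r0 h] [s s0 k]; exists (Num.min r s); first by rewrite lt_min r0.
by move=> q hq; split; [apply: h|apply: k] => i /hq; rewrite lt_min => /andP[].
Qed.

Lemma stable_imp (B : Prop) P : (B -> stable P) -> stable (fun q => B -> P q).
Proof.
move=> h; have [b|nb] := pselect B; last by exists 1.
by have [r r0 k] := h b; exists r => // q /k.
Qed.

Lemma stable_sub P1 P2 : stable P1 -> (forall q, P1 q -> P2 q) -> stable P2.
Proof. by move=> [r r0 h] k; exists r => // q /h /k. Qed.

Lemma stable_all N (P : nat -> (nat -> pt R) -> Prop) :
  (forall i, (i < N)%N -> stable (P i)) -> stable (fun q => forall i, (i < N)%N -> P i q).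
Proof.
elim: N => [|N ih] h; first by exists 1.
have k := stable_and (ih (fun i hi => h i (ltnW hi))) (h N (ltnSn N)).
apply: (stable_sub k) => q [h1 h2] i; rewrite ltnS leq_eqVlt => /orP[/eqP ->//|]; exact: h1.
Qed.

Lemma stable_near (P : set (pt R)) i : (i < n)%N -> (\forall z \near p i, P z) ->
  stable (fun q => P (q i)).
Proof.
move=> hi /nbhs_ballP[r /= r0 h]; exists r => // q /(_ i hi) hq; apply: h.
by rewrite -ball_normE /ball_ /= distrC.
Qed.

Lemma orient_near (s : R) a b c : 0 < s * orient a b c -> \forall z \near c, 0 < s * orient a b z.
Proof.
move=> h; have ho : open [set z | 0 < s * orient a b z].
  rewrite (_ : [set z | _] = (fun z => s * detv (b - a) (z - a)) @^-1` [set t | 0 < t]); last first.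
    by apply/funext => z; rewrite /= /detv /orient !pE.
  apply: open_comp; last exact: open_gt.
  by move=> z _; apply: (cvgM (cvg_cst _) (@detv_continuous R _ _ z)).
exact: (open_nbhs_nbhs (conj ho h)).
Qed.

Lemma stable_orient (s : R) a b i : (i < n)%N -> 0 < s * orient a b (p i) ->
  stable (fun q => 0 < s * orient a b (q i)).
Proof.
by move=> hi h; apply: (@stable_near [set z | 0 < s * orient a b z] i) => //; exact: orient_near.
Qed.

Lemma seg_close (r : R) a b a' b' z : `|a' - a| < r -> `|b' - b| < r -> segment a' b' z ->
  exists2 w, segment a b w & `|z - w| <= r.
Proof.
move=> ha hb hz; apply: (@nbd_convex _ r a b a' b') => //.
  by exists a; [exact: segment_l|exact: ltW].
by exists b; [exact: segment_r|exact: ltW].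
Qed.

Lemma stable_sdisj i j x y : (i < n)%N -> (j < n)%N -> sdisj (p i) (p j) x y ->
  stable (fun q => sdisj (q i) (q j) x y).
Proof.
move=> hi hj /dist_seg[d d0 h]; exists (d / 2); first by lra.
move=> q hq z z1 z2; have [w w1 hw] := seg_close (hq i hi) (hq j hj) z1.
by have := h w z w1 z2; rewrite distrC => /le_trans /(_ hw); lra.
Qed.

Lemma stable_sdisj2 i j k l : (i < n)%N -> (j < n)%N -> (k < n)%N -> (l < n)%N ->
  sdisj (p i) (p j) (p k) (p l) -> stable (fun q => sdisj (q i) (q j) (q k) (q l)).
Proof.
move=> hi hj hk hl /dist_seg[d d0 h]; exists (d / 3); first by lra.
move=> q hq z z1 z2; have [w w1 hw] := seg_close (hq i hi) (hq j hj) z1.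
have [v v1 hv] := seg_close (hq k hk) (hq l hl) z2.
have := h w v w1 v1; have -> : w - v = (z - v) - (z - w) by apply: pt_eq; rewrite !pE; ring.
by move=> /le_trans /(_ (ler_normB _ _)); lra.
Qed.

(** The thin quadrilaterals swept by the edges stay within [d / 2] of the old edges, while [z] is at
    least [d] away, so [par_perturb] applies. *)
Lemma stable_par z : (0 < n)%N -> ~ on (edg p n) z ->
  stable (fun q => ~ on (edg q n) z /\ par (edg q n) z = par (edg p n) z).
Proof.
move=> n0 hz; have [d d0 hd] := dist_on hz; exists (d / 2); first by lra.
have md i : (i.+1 %% n < n)%N by rewrite ltn_mod.
move=> q hq; have nn i : (i < n)%N -> ~ nbd (d / 2) (p i) (p (i.+1 %% n)%N) z.
  move=> hi [w sw hw]; have := hd w; rewrite distrC => h.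
  have /h/le_trans/(_ hw) : on (edg p n) w.
    by exists (p i, p (i.+1 %% n)%N) => //; apply/mem_edg; exists i.
  by lra.
have N i : (i < n)%N -> [/\ nbd (d / 2) (p i) (p (i.+1 %% n)%N) (p i),
    nbd (d / 2) (p i) (p (i.+1 %% n)%N) (p (i.+1 %% n)%N),
    nbd (d / 2) (p i) (p (i.+1 %% n)%N) (q i) &
    nbd (d / 2) (p i) (p (i.+1 %% n)%N) (q (i.+1 %% n)%N)].
  move=> hi; split.
  - by exists (p i); [exact: segment_l|rewrite subrr normr0; lra].
  - by exists (p (i.+1 %% n)%N); [exact: segment_r|rewrite subrr normr0; lra].
  - by exists (p i); [exact: segment_l|apply/ltW/hq].
  - by exists (p (i.+1 %% n)%N); [exact: segment_r|apply/ltW/hq].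
split.
  by move=> [e /mem_edg[i hi ->] /= h]; apply: (nn i hi); have [_ _ h3 h4] := N i hi;
     exact: nbd_convex h3 h4 _ h.
apply/esym/par_perturb => // i hi; apply/negP => h; apply: (nn i hi);
  have [h1 h2 h3 h4] := N i hi; [exact: tri_par_nbd h1 h2 h4 h|exact: tri_par_nbd h1 h3 h4 h].
Qed.
End Stable.

(** At a proper corner the difference of the two edge vectors, with the sign of the turn, points to
    the required side of both edges; at a straight corner a normal does. *)
Lemma sector_nonempty (s : R) a b c : s != 0 -> a != b -> b != c ->
  (forall z, segment a b z -> segment b c z -> z = b) ->
  exists v, 0 < s * detv (b - a) v /\ 0 < s * detv (c - b) v.
Proof.
move=> s0 ab bc h; pose D := orient a b c.
have sq (x : R) : x != 0 -> 0 < x * x by move=> x0; rewrite -expr2 lt_def sqrf_eq0 x0 sqr_ge0.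
have [D0|D0] := eqVneq D 0; last first.
  exists (s *: (D *: ((c - b) - (b - a)))); split.
    have -> : s * detv (b - a) (s *: (D *: ((c - b) - (b - a)))) = (s * s) * (D * D).
      by rewrite /detv /D /orient !pE; ring.
    by apply: mulr_gt0; apply: sq.
  have -> : s * detv (c - b) (s *: (D *: ((c - b) - (b - a)))) = (s * s) * (D * D).
    by rewrite /detv /D /orient !pE; ring.
  by apply: mulr_gt0; apply: sq.
pose q := (px b - px a) ^+ 2 + (py b - py a) ^+ 2.
have q0 : 0 < q.
  rewrite lt_def addr_ge0 ?sqr_ge0// andbT paddr_eq0 ?sqr_ge0// !sqrf_eq0 !subr_eq0.
  by apply: contra ab => /andP[/eqP h1 /eqP h2]; apply/eqP/pt_eq.
pose k := ((px b - px a) * (px c - px b) + (py b - py a) * (py c - py b)) / q.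
have hx : px c - px b = k * (px b - px a).
  apply: (mulfI (lt0r_neq0 q0)); rewrite mulrA /k mulrCA divff ?gt_eqF// mulr1.
  have := D0; rewrite /D /orient /q => D0'.
  apply/eqP; rewrite -subr_eq0; apply/eqP.
  transitivity (- (py b - py a) * ((px b - px a) * (py c - py a) - (py b - py a) * (px c - px a))); first by ring.
  by rewrite D0' mulr0.
have hy : py c - py b = k * (py b - py a).
  apply: (mulfI (lt0r_neq0 q0)); rewrite mulrA /k mulrCA divff ?gt_eqF// mulr1.
  have := D0; rewrite /D /orient /q => D0'.
  apply/eqP; rewrite -subr_eq0; apply/eqP.
  transitivity ((px b - px a) * ((px b - px a) * (py c - py a) - (py b - py a) * (px c - px a))); first by ring.
  by rewrite D0' mulr0.
(* With a negative ratio the polygon would turn back on itself, and the two edges would overlap in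
   more than [b]. *)
have k0 : 0 < k.
  rewrite ltNge; apply/negP => kn.
  have kn0 : k != 0.
    by apply: contraNneq bc => e; apply/eqP/pt_eq; move: hx hy; rewrite e; lra.
  have [k1|k1] := leP (-1) k.
    have ec : c = b.
      apply: h; last exact: segment_r.
      by apply/segmentP; exists (1 + k); split; [lra|lra|nra|nra].
    by rewrite ec eqxx in bc.
  have ea : a = b.
    apply: h; first exact: segment_l.
    apply/segmentP; exists (- k^-1); have ki : k * k^-1 = 1 by rewrite divff.
    have kk : k^-1 < 0 by rewrite invr_lt0; lra.
    have e1 : px b - px a = k^-1 * (px c - px b) by rewrite hx mulrA mulVf// mul1r.
    have e2 : py b - py a = k^-1 * (py c - py b) by rewrite hy mulrA mulVf// mul1r.
    have kk1 : -1 <= k^-1 by rewrite -[leLHS]invrN1 lef_nV2 ?qualifE /=; lra.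
    by split; lra.
  by rewrite ea eqxx in ab.
exists (s *: mkpt (- (py b - py a)) (px b - px a)); split.
  have -> : s * detv (b - a) (s *: mkpt (- (py b - py a)) (px b - px a)) = (s * s) * q.
    by rewrite /detv /q !pE; ring.
  by rewrite mulr_gt0// sq.
have -> : s * detv (c - b) (s *: mkpt (- (py b - py a)) (px b - px a)) = (s * s) * (k * q).
  by rewrite /detv /q !pE hx hy; ring.
by rewrite mulr_gt0 ?sq// mulr_gt0.
Qed.

(** Where the polygon turns to the side [s] this is the whole angle on that side, cut to radius [r];
    at other proper corners it is a smaller cone, which is still open and nonempty. *)
Definition sector (s r : R) a b c : set (pt R) :=
  [set x | `|x - b| < r /\ (0 < s * orient a b x /\ 0 < s * orient b c x)].

Lemma sector_open s r a b c : open (sector s r a b c).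
Proof.
rewrite (_ : sector s r a b c = [set x | `|x - b| < r] `&`
  ([set x | 0 < s * orient a b x] `&` [set x | 0 < s * orient b c x]))//.
have oo u v : open [set x | 0 < s * orient u v x].
  by rewrite openE => x hx; rewrite /interior /=; exact: orient_near hx.
apply: openI; last by apply: openI.
rewrite (_ : [set x | _] = (fun x => `|x - b|) @^-1` [set t | t < r]) //.
by apply: open_comp; [move=> y _; exact: norm_sub_continuous|exact: open_lt].
Qed.

Lemma sector_ne (s r : R) a b c : s != 0 -> 0 < r -> a != b -> b != c ->
  (forall z, segment a b z -> segment b c z -> z = b) -> sector s r a b c !=set0.
Proof.
move=> s0 r0 ab bc h; have [v [v1 v2]] := sector_nonempty s0 ab bc h.
have [|d d0 hd] := @near_line _ [set x | `|x - b| < r] b v.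
  by apply/nbhs_ballP; exists r => // x; rewrite -ball_normE /ball_ /= distrC.
exists (b + d *: v); split; first by apply: hd; rewrite ger0_norm// ltW.
have -> : s * orient a b (b + d *: v) = d * (s * detv (b - a) v) by rewrite /detv /orient !pE; ring.
have -> : s * orient b c (b + d *: v) = d * (s * detv (c - b) v) by rewrite /detv /orient !pE; ring.
by split; apply: mulr_gt0.
Qed.

Lemma orient_seg_sgt0 (s : R) u v a b x : 0 < s * orient u v a -> 0 < s * orient u v b ->
  segment a b x -> 0 < s * orient u v x.
Proof.
move=> ha hb [t /andP[t0 t1] ->]; rewrite orient_conv.
have -> : s * ((1 - t) * orient u v a + t * orient u v b) =
  (1 - t) * (s * orient u v a) + t * (s * orient u v b) by ring.
have [->|tn] := eqVneq t 0; first by lra.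
have h1 : 0 < t * (s * orient u v b) by rewrite mulr_gt0// lt_def tn.
have h2 : 0 <= (1 - t) * (s * orient u v a) by rewrite mulr_ge0//; lra.
by lra.
Qed.

Lemma orient_seg_sle0 (s : R) u v a b x : s * orient u v a <= 0 -> s * orient u v b <= 0 ->
  segment a b x -> s * orient u v x <= 0.
Proof.
move=> ha hb [t /andP[t0 t1] ->]; rewrite orient_conv.
have -> : s * ((1 - t) * orient u v a + t * orient u v b) =
  (1 - t) * (s * orient u v a) + t * (s * orient u v b) by ring.
have h1 : t * (s * orient u v b) <= 0 by rewrite mulr_ge0_le0.
have h2 : (1 - t) * (s * orient u v a) <= 0 by rewrite mulr_ge0_le0//; lra.
by lra.
Qed.

(** * The new polygon runs beside the old one *)

Section Collar.
Variables (n : nat) (p q : nat -> pt R) (s : R).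
Hypothesis sp : simple p n.
Hypothesis far_edges : forall i j, (i < n)%N -> (j < n)%N -> i != j ->
  j != (i.+1 %% n)%N -> i != (j.+1 %% n)%N ->
  sdisj (q i) (q (i.+1 %% n)%N) (p j) (p (j.+1 %% n)%N).
Hypothesis turn : forall i j k, (i < n)%N -> j = (i.+1 %% n)%N -> k = (j.+1 %% n)%N ->
  0 < s * orient (p i) (p j) (p k) ->
  0 < s * orient (p j) (p k) (q i) /\ 0 < s * orient (p i) (p j) (q k).
Hypothesis left : forall i, (i < n)%N ->
  0 < s * orient (p i) (p (i.+1 %% n)%N) (q i) /\
  0 < s * orient (p i) (p (i.+1 %% n)%N) (q (i.+1 %% n)%N).

(** An old and a new edge with equal or neighbouring indices are separated by a line: for neighbours
    at a corner turning to the side [s] it is the line of the old edge, otherwise the line of the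
    old edge with the index of the new one. All remaining pairs are disjoint by closeness. *)
Lemma collar_disjoint z : on (edg p n) z -> on (edg q n) z -> False.
Proof.
move=> [e /mem_edg[j hj ->] /= zj] [f /mem_edg[i hi ->] /= zi].
have n0 : (0 < n)%N by case: sp => h _ _ _; exact: ltn_trans h.
have md k : (k.+1 %% n < n)%N by rewrite ltn_mod.
have ori u v : s * orient u v u <= 0 by rewrite orient_aba mulr0.
have orj u v : s * orient u v v <= 0 by rewrite orient_abb mulr0.
have leftz : 0 < s * orient (p i) (p (i.+1 %% n)%N) z.
  by have [l1 l2] := left hi; exact: orient_seg_sgt0 l1 l2 zi.
have no u v : 0 < s * orient u v z -> segment u v z -> False.
  by move=> h /segment_orient0 e0; move: h; rewrite e0 mulr0 ltxx.
have [ij|ij] := eqVneq i j; first by apply: (no _ _ leftz); rewrite ij.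
have [ej|nj] := eqVneq j (i.+1 %% n)%N.
  rewrite ej in zj hj; have [tp|tn] := ltP 0 (s * orient (p i) (p (i.+1 %% n)%N) (p ((i.+1 %% n).+1 %% n)%N)).
    have [t1 _] := turn hi erefl erefl tp; have [t2 _] := left hj.
    exact: (no _ _ (orient_seg_sgt0 t1 t2 zi) zj).
  by have := orient_seg_sle0 (orj _ _) tn zj; lra.
have [ei|ni] := eqVneq i (j.+1 %% n)%N.
  rewrite -ei in zj.
  have [tp|tn] := ltP 0 (s * orient (p j) (p i) (p (i.+1 %% n)%N)).
    have [_ t1] := turn hj ei erefl tp; have [_ t2] := left hj; rewrite -ei in t2.
    exact: (no _ _ (orient_seg_sgt0 t2 t1 zi) zj).
  rewrite orient_cyc in tn.
  by have := orient_seg_sle0 tn (ori _ _) zj; lra.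
exact: (far_edges hi hj ij nj ni zi zj).
Qed.
End Collar.

Lemma edg_const E (q : nat -> pt R) n : cyc E -> (0 < n)%N ->
  (forall z, on E z -> on (edg q n) z -> False) ->
  forall y z, on (edg q n) y -> on (edg q n) z -> par E y = par E z.
Proof.
move=> cE n0 h; have [a [t e]] : exists a t, edg q n = pe a t.
  rewrite -ed_mkseq//; case: n n0 {h} => // n _; rewrite /mkseq /=.
  by exists (q 0%N), (rcons [seq q i | i <- iota 1 n] (q 0%N)).
rewrite e in h *; have k := chain_const cE (s := t) (a := a) _.
have {}k : forall z, on (pe a t) z -> par E z = par E a.
  by apply: k => f fe z fz zE; apply: (h z zE); exists f.
by move=> y z /k -> /k ->.
Qed.

(** Two points close to the midpoint of edge 0, on either side of it, tell which parity belongs to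
    which side. *)
Lemma edge0_probe (p : nat -> pt R) n : simple p n -> exists m x y,
  [/\ segment (p 0%N) (p 1%N) m, 0 < orient (p 0%N) (p 1%N) x, orient (p 0%N) (p 1%N) y < 0,
    segment x y m & par (edg p n) x != par (edg p n) y] /\
  forall i, (0 < i)%N -> (i < n)%N -> sdisj (p i) (p (i.+1 %% n)%N) x y.
Proof.
move=> sp; have [n2 inj dj adj] := sp; have n0 : (0 < n)%N by lia.
have p01 : p 0%N != p 1%N by apply/eqP => /inj e; have := e n0 (ltnW n2).
have m1 : (1 %% n = 1)%N by rewrite modn_small//; lia.
pose E1 := [seq (p i, p (i.+1 %% n)%N) | i <- iota 1 n.-1].
have eE : edg p n = (p 0%N, p 1%N) :: E1.
  by rewrite /edg /E1 -[X in iota 0 X](prednK n0) /= m1.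
have h2 : 0 < (2^-1 : R) < 1 by lra.
set m := (1 - 2^-1) *: p 0%N + 2^-1 *: p 1%N.
have sm : segment (p 0%N) (p 1%N) m by exists 2^-1; rewrite //; lra.
have mp0 : m <> p 0%N.
  by move=> e; move/eqP: p01; apply; apply: pt_eq; [have := congr1 (@px R) e|have := congr1 (@py R) e];
     rewrite /m !pE; lra.
have mp1 : m <> p 1%N.
  by move=> e; move/eqP: p01; apply; apply: pt_eq; [have := congr1 (@px R) e|have := congr1 (@py R) e];
     rewrite /m !pE; lra.
have nm : ~ on E1 m.
  move=> [e /mapP[i]]; rewrite mem_iota => /andP[i0 hi] -> /= h.
  have {}hi : (i < n)%N by lia.
  have [ei|ni] := eqVneq i 1%N.
    by apply: mp1; apply: (adj 0%N 1%N (1.+1 %% n)%N); rewrite ?m1//; move: h; rewrite ei.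
  have [e0|n0'] := eqVneq (i.+1 %% n)%N 0%N.
    by apply: mp0; apply: (adj i 0%N 1%N) => //; rewrite -?e0.
  apply: (dj 0%N i n0 hi _ _ _ m); rewrite ?m1// eq_sym//; lia.
set w : pt R := mkpt (py (p 0%N) - py (p 1%N)) (px (p 1%N) - px (p 0%N)).
have [d d0 hd] := near_line w (off_near nm).
have [c1 c2 c3] := pcross_normal p01 h2 d0.
rewrite -/m -/w in c1 c2 c3.
have sxy z : segment (m + d *: w) (m - d *: w) z -> ~ on E1 z.
  move=> [t /andP[t0 t1] ->].
  have -> : (1 - t) *: (m + d *: w) + t *: (m - d *: w) = m + ((1 - 2 * t) * d) *: w.
    by apply: pt_eq; rewrite !pE; ring.
  apply: hd; rewrite normrM (gtr0_norm d0).
  have h1 : `|1 - 2 * t| <= 1 by rewrite ler_norml; lra.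
  by have := ler_wpM2r (ltW d0) h1; rewrite mul1r.
exists m, (m + d *: w), (m - d *: w); split.
  split=> //.
    exists 2^-1; first by lra.
    by apply: pt_eq; rewrite !pE; field.
  have -> := par_flip (cyc_edg p n0) (e := (p 0%N, p 1%N)) (E' := E1) _ c1 sxy.
    by case: (par _ _).
  by rewrite eE.
move=> i i0 hi z z1 z2; apply: (sxy z z2); exists (p i, p (i.+1 %% n)%N) => //.
by apply/mapP; exists i => //; rewrite mem_iota; lia.
Qed.

Definition prevm n i := (if i == 0 then n.-1 else i.-1)%N.

Lemma prevmP n : (0 < n)%N -> [/\ forall i, (i < n)%N -> (prevm n i < n)%N,
  forall i, (i < n)%N -> ((prevm n i).+1 %% n)%N = i &
  forall i, (i < n)%N -> prevm n (i.+1 %% n)%N = i].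
Proof.
move=> n0; split=> i hi; rewrite /prevm.
- by case: eqP; lia.
- case: eqP => [->|i0]; first by rewrite prednK// modnn.
  by rewrite prednK ?modn_small//; lia.
have [h|h] := ltnP i.+1 n; first by rewrite modn_small.
have -> : i.+1 = n by lia.
by rewrite modnn /=; lia.
Qed.

(** The side [s] is read off at edge 0 only, and every vertex is moved to this side of its two
    edges. The new polygon then misses the old one; being connected, it has constant parity with
    respect to it, found to be [g] near edge 0. *)
Theorem offset (p : nat -> pt R) n (g : bool) a b : simple p n ->
  ~ on (edg p n) a -> ~ on (edg p n) b -> par (edg p n) a = g -> par (edg p n) b = g ->
  exists Q, [/\ sp Q, size Q = n & let C := if g then inner (ed Q) else outer (ed Q) in
    [/\ C a, C b & forall z, C z -> ~ on (edg p n) z /\ par (edg p n) z = g]].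
Proof.
move=> sp na nb pa pb; have [n2 inj dj adj] := sp; have n0 : (0 < n)%N by lia.
have m1 : (1 %% n = 1)%N by rewrite modn_small//; lia.
have md k : (k.+1 %% n < n)%N by rewrite ltn_mod.
have [m [x [y [[sm s0 gx gy smxy] oth]]]] : exists m x y,
  [/\ segment (p 0%N) (p 1%N) m, exists2 s : R, s != 0 & 0 < s * orient (p 0%N) (p 1%N) x /\
    s * orient (p 0%N) (p 1%N) y < 0, par (edg p n) x = g, par (edg p n) y = ~~ g &
    segment x y m] /\
  forall i, (0 < i)%N -> (i < n)%N -> sdisj (p i) (p (i.+1 %% n)%N) x y.
  have [m [x [y [[h1 h2 h3 h4 h5] h6]]]] := edge0_probe sp.
  have [ex|nx] := eqVneq (par (edg p n) x) g.
    exists m, x, y; split=> //; split=> //.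
      by exists (1 : R); [exact: oner_neq0|rewrite !mul1r].
    by move: h5; rewrite ex; case: (g); case: (par _ y).
  exists m, y, x; split.
    split=> //; last by rewrite segment_sym.
    - by exists (-1 : R); [rewrite oppr_eq0 oner_neq0|lra].
    - by move: h5 nx; case: (g); case: (par _ y); case: (par _ x).
    - by move: h5 nx; case: (g); case: (par _ y); case: (par _ x).
  by move=> i i0 hi; apply/sdisj_swapr/h6.
have {s0} [s s0 [sx sy]] := s0.
have off0 z : on (edg p n) z -> segment x y z -> segment (p 0%N) (p 1%N) z.
  move=> [e /mem_edg[i hi ->] /= h] hz; case: i hi h => [|i] hi h; first by rewrite m1 in h.
  by case: (oth i.+1 isT hi z h hz).
have sgt u v z : 0 < s * orient u v z -> segment u v z -> False.
  by move=> h /segment_orient0 e; move: h; rewrite e mulr0 ltxx.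
have nx : ~ on (edg p n) x by move=> h; apply: (sgt _ _ _ sx); apply: off0 => //; exact: segment_l.
have ny : ~ on (edg p n) y.
  move=> h; have /segment_orient0 e : segment (p 0%N) (p 1%N) y.
    by apply: off0 => //; exact: segment_r.
  by move: sy; rewrite e mulr0 ltxx.
have st1 : stable n p (fun q => forall i, (i < n)%N -> forall j, (j < n)%N ->
    [&& i != j, j != (i.+1 %% n)%N & i != (j.+1 %% n)%N] ->
    sdisj (q i) (q (i.+1 %% n)%N) (p j) (p (j.+1 %% n)%N) /\
    sdisj (q i) (q (i.+1 %% n)%N) (q j) (q (j.+1 %% n)%N)).
  apply: stable_all => i hi; apply: stable_all => j hj; apply: stable_imp => /and3P[h1 h2 h3].
  have dd := dj i j hi hj h1 h2 h3.
  by apply: stable_and; [exact: stable_sdisj|exact: stable_sdisj2].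
have st2 : stable n p (fun q => forall i, (i < n)%N ->
    0 < s * orient (p i) (p (i.+1 %% n)%N) (p ((i.+1 %% n).+1 %% n)%N) ->
    0 < s * orient (p (i.+1 %% n)%N) (p ((i.+1 %% n).+1 %% n)%N) (q i) /\
    0 < s * orient (p i) (p (i.+1 %% n)%N) (q ((i.+1 %% n).+1 %% n)%N)).
  apply: stable_all => i hi; apply: stable_imp => h; apply: stable_and.
    by apply: (stable_orient hi); rewrite -orient_cyc.
  by exact: stable_orient (md _) h.
have st3 : stable n p (fun q => forall i, (i < n)%N -> (0 < i)%N -> sdisj (q i) (q (i.+1 %% n)%N) x y).
  apply: stable_all => i hi; apply: stable_imp => i0.
  exact: (stable_sdisj hi (md i) (oth i i0 hi)).
have st4 z : ~ on (edg p n) z -> stable n p (fun q => ~ on (edg q n) z /\ par (edg q n) z = par (edg p n) z).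
  by move=> ?; apply: stable_par.
(* One radius for all conditions, including the parities of [a], [b] and both probes. *)
have [r r0 hr] := stable_and (stable_and st1 st2) (stable_and st3
  (stable_and (stable_and (st4 a na) (st4 b nb)) (stable_and (st4 x nx) (st4 y ny)))).
have [pvn pvK nxpv] := prevmP n0.
have pne i : (i < n)%N -> p i != p (i.+1 %% n)%N.
  move=> hi; apply/eqP => /inj => /(_ hi (md i)) e.
  by have := modS_neq (ltnW n2) hi; rewrite -e eqxx.
have [i hi|q [hq uq gq]] := @gp_choose _ (fun i => sector s r (p (prevm n i)) (p i) (p (i.+1 %% n)%N)) n.
  split; first exact: sector_open.
  apply: sector_ne => //; [by have := pne _ (pvn i hi); rewrite pvK|exact: pne|].
  by move=> z; apply: (adj (prevm n i) i) => //; [exact: pvn|rewrite pvK].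
have close i : (i < n)%N -> `|q i - p i| < r by move=> /hq[].
have [[k1 k2] [k3 [[[na' ea] [nb' eb]] [[nx' ex] [ny' ey]]]]] := hr q close.
have left i : (i < n)%N ->
  0 < s * orient (p i) (p (i.+1 %% n)%N) (q i) /\
  0 < s * orient (p i) (p (i.+1 %% n)%N) (q (i.+1 %% n)%N).
  move=> hi; split; first by have [_ []] := hq i hi.
  by have [_ []] := hq _ (md i); rewrite (nxpv i hi).
have dis z : on (edg p n) z -> on (edg q n) z -> False.
  apply: (collar_disjoint (s := s)) => //.
    by move=> i j hi hj h1 h2 h3; have [|] := k1 i hi j hj; rewrite ?h1 ?h2 ?h3.
  by move=> i j k hi -> ->; exact: k2.
have cp := cyc_edg p n0; have cq := cyc_edg q n0.
(* The probes still have different parities for the new polygon, so it crosses [x, y]; only its edge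
   0 can do so, and that edge lies on the side [s]. *)
have [z zq sz] : exists2 z, on (edg q n) z & segment x y z.
  apply: contrapT => h; have : par (edg q n) x = par (edg q n) y.
    by apply: par_const => // z hz zq; apply: h; exists z.
  by rewrite ex ey gx gy; case: (g).
have z0 : segment (q 0%N) (q 1%N) z.
  case: zq => e /mem_edg[[|i] hi ->] /= h; first by rewrite m1 in h.
  by case: (k3 i.+1 hi isT z).
have lz : 0 < s * orient (p 0%N) (p 1%N) z.
  by have [] := left 0%N n0; rewrite m1 => l1 l2; exact: orient_seg_sgt0 l1 l2 z0.
have pz : par (edg p n) z = g.
  rewrite -gx; apply: par_const => // w sw wp.
  apply: (sgt _ _ _ (orient_seg_sgt0 lz sx sw)); apply: off0 => //.
  by apply: (segment_conv sz (segment_l _ _) sw).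
have pm : par (edg q n) m = ~~ g.
  rewrite -gy -ey; apply: par_const => // w sw [e /mem_edg[[|i] hi ->] /= h]; last first.
    by apply: (k3 i.+1 hi isT w) => //; apply: (segment_conv smxy (segment_r _ _) sw).
  have [] := left 0%N n0; rewrite m1 in h * => l1 l2.
  have := orient_seg_sgt0 l1 l2 h.
  have : s * orient (p 0%N) (p 1%N) w <= 0.
    by apply: orient_seg_sle0 sw; [rewrite (segment_orient0 sm) mulr0|exact: ltW].
  by lra.
have h1 w : on (edg q n) w -> par (edg p n) w = g.
  by move=> hw; rewrite -pz; exact: (edg_const cp n0 dis).
have dis' w : on (edg q n) w -> on (edg p n) w -> False by move=> ? ?; apply: dis; eassumption.
have h2 w : on (edg p n) w -> par (edg q n) w = ~~ g.
  move=> hw; rewrite -pm; apply: (edg_const cq n0 dis') => //.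
  by exists (p 0%N, p (1 %% n)%N); [apply/mem_edg; exists 0%N|rewrite m1].
exists (mkseq q n); rewrite size_mkseq ed_mkseq//; split=> //.
  split; rewrite ?size_mkseq// ed_mkseq// => e f /mem_edg[i hi ->] /mem_edg[j hj ->] /= n1 n2' n3 n4.
  suff /(k1 i hi j hj)[_] : [&& i != j, j != (i.+1 %% n)%N & i != (j.+1 %% n)%N] by [].
  apply/and3P; split.
  - by apply: contraNneq n1 => ->.
  - by apply: contraNneq n3 => ->.
  - by apply: contraNneq n2' => ->.
case: (g) pa pb h1 h2 => pa pb h1 h2 /=.
  split; [by right; rewrite ea pa|by right; rewrite eb pb|].
  exact: contain_in.
split; [by right; rewrite ea pa|by right; rewrite eb pb|].
exact: contain_out.
Qed.
End Offset.

(** * Interior, exterior and the upper bounds *)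

Section Regions.
Variable R : realType.
Implicit Types a b c u v w x y z m : pt R.
Local Notation edge := (pt R * pt R)%type.
Implicit Types (E : seq edge) (e f : edge) (Q D : seq (pt R)) (O S : set (pt R)).

Definition region (g : bool) E : set (pt R) := [set z | ~ on E z /\ par E z = g].

(** The polygon given by [offset] has as many vertices, and its closed region lies in the open
    one. *)
Lemma region_links (p : nat -> pt R) n (g : bool) a b : simple p n ->
  region g (edg p n) a -> region g (edg p n) b ->
  lk (region g (edg p n)) a b (if g then n./2 else n.+1./2).
Proof.
move=> sp [na pa] [nb pb]; have [Q [spQ sQ [Ca Cb sub]]] := offset sp na nb pa pb.
apply: (lk_mono sub); rewrite -sQ; case: (g) Ca Cb => Ca Cb /=.
  by have [_ _] := int_linksP spQ; apply.
by have [h _ _] := ext_linksP spQ; apply: h.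
Qed.

Lemma par_near E z : cyc E -> ~ on E z -> \forall w \near z, ~ on E w /\ par E w = par E z.
Proof.
move=> cE /off_near /nbhs_ballP[d /= d0 h].
apply/nbhs_ballP; exists d => //= w hw; split; first exact: h.
apply: par_const => // y [t /andP[t0 t1] ->]; apply: h; move: hw.
rewrite -!ball_normE /ball_ /= !(distrC z) => hw.
have -> : (1 - t) *: w + t *: z - z = (1 - t) *: (w - z) by apply: pt_eq; rewrite !pE; ring.
rewrite normrZ ger0_norm; last by lra.
by apply: le_lt_trans hw; rewrite ler_piMl//; lra.
Qed.

Lemma region_open (g : bool) E : cyc E -> open (region g E).
Proof.
move=> cE; rewrite openE => z [nz pz]; rewrite /interior; apply: filterS (par_near cE nz) => w [nw ew].
by split=> //; rewrite ew.
Qed.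

(** Both parity classes are open off [E], so a connected set lies in one of them. *)
Lemma connected_region E C x : cyc E -> connected C -> C `<=` ~` (on E) -> C x ->
  C `<=` region (par E x) E.
Proof.
move=> cE cC sC Cx.
suff <- : C `&` region (par E x) E = C by move=> z [].
apply: cC.
- by exists x; split=> //; split=> //; exact: sC.
- by exists (region (par E x) E) => //; exact: region_open.
exists (~` region (~~ par E x) E); first by apply: open_closedC; exact: region_open.
apply/seteqP; split=> z [Cz].
  by case=> nz ez; split=> // -[_]; rewrite ez; case: (par E x).
move=> h; split=> //; split; first exact: sC.
apply: contrapT => nh; apply: h; split; first exact: sC.
by move: nh; case: (par E x); case: (par E z).
Qed.

Lemma segment_conn a b : connected (segment a b : set (pt R)).
Proof.
have -> : segment a b = (fun t : R => (1 - t) *: a + t *: b) @` `[0, 1].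
  apply/seteqP; split=> z.
    by move=> [t t01 ->]; exists t => //; rewrite /= in_itv.
  by move=> [t]; rewrite /= in_itv => t01 <-; exists t.
apply: connected_continuous_connected; first exact: segment_connected.
apply: continuous_subspaceT => t.
apply: cvgD; apply: cvgZr_tmp; [apply: cvgB; [exact: cvg_cst|exact: cvg_id]|exact: cvg_id].
Qed.

Lemma lk_component O S a b k : O `<=` S -> lk O a b k -> connected_component S a b.
Proof.
move=> sO; elim: k b => [b [-> Ob]|k ih b [c /ih h1 h2]].
  by apply: connected_component_refl; exact: sO.
apply: connected_component_trans h1 _.
apply: (@connected_component_max _ _ (segment c b)); [exact: segment_l| |exact: segment_conn|exact: segment_r].
by move=> z /h2 /sO.
Qed.

Lemma boundedP S : bounded_set S <-> exists M : R, forall z, S z -> `|z| <= M.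
Proof.
split=> [[M [_ h]]|[M h]].
  by exists (M + 1) => z Sz; apply: (h (M + 1)) => //; lra.
by exists M; split; [exact: num_real|move=> N MN z /h /le_trans; apply; exact: ltW].
Qed.

(** The component of an odd point is confined to a box outside which the parity is even. An even
    point is linked to arbitrarily distant points by [region_links]: the upper bound doubles as
    connectedness of the exterior. *)
Lemma component_bounded (p : nat -> pt R) n x : simple p n -> ~ on (edg p n) x ->
  bounded_set (connected_component (~` polygon n p) x) <-> par (edg p n) x.
Proof.
move=> sp nx; have [n2 _ _ _] := sp; have n0 : (0 < n)%N by lia.
have cE := cyc_edg p n0; have [M M0 hM] := inbox_ex (edg p n).
have nP : ~` polygon n p = ~` (on (edg p n)).
  by apply/seteqP; split=> z; apply: contra_not => /(polygonE p z n0).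
rewrite nP boundedP; split=> [[N hN]|px'].
  apply/negPn/negP => /negbTE px'.
  pose y : pt R := mkpt (Num.max M N + 1) 0.
  have My : M < `|px y|.
    rewrite ger0_norm /y !pE; last by rewrite addr_ge0// le_max ltW.
    by rewrite ltr_pwDr// le_max lexx.
  have py' : par (edg p n) y = false by apply: (par_far cE hM); left.
  have ny : ~ on (edg p n) y.
    move=> [e /hM[h1 _ h2 _]] /segmentP[t [t0 t1 e1 _]]; move: My; rewrite e1.
    move: h1 h2; rewrite !ler_norml ltNge => h1 h2 /negP; apply; rewrite ler_norml.
    have [k1 k2] := andP h1; have [k3 k4] := andP h2.
    have t2 : 0 <= 1 - t by lra.
    have i1 := ler_wpM2l t2 k1; have i2 := ler_wpM2l t2 k2.
    have i3 := ler_wpM2l t0 k3; have i4 := ler_wpM2l t0 k4.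
    by apply/andP; split; lra.
  have l := region_links sp (conj nx px') (conj ny py').
  have := hN y (lk_component (fun z (h : region false (edg p n) z) => h.1) l).
  move=> /(le_trans (norm_px y)); rewrite /y !pE ger0_norm; last by rewrite addr_ge0// le_max ltW.
  by apply/negP; rewrite -ltNge ltr_pwDr// le_max lexx orbT.
exists M => z hz.
have := connected_region cE (@component_connected _ _ x) (@connected_component_sub _ _ x)
  (connected_component_refl nx) hz.
rewrite px' => -[_ pz].
apply: norm_le; rewrite leNgt; apply/negP => h.
  by rewrite (par_far cE hM) // in pz; left.
by rewrite (par_far cE hM) // in pz; right.
Qed.

Lemma int_polyE (p : nat -> pt R) n : simple p n ->
  int_poly (polygon n p) = region true (edg p n).
Proof.
move=> sp; have [n2 _ _ _] := sp; have n0 : (0 < n)%N by lia.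
apply/seteqP; split=> z [h1].
  have nz : ~ on (edg p n) z by move=> /(polygonE p z n0).
  by move/(component_bounded sp nz).
by move=> h2; split; [move=> /(polygonE p z n0)|apply/(component_bounded sp h1)].
Qed.

Lemma ext_polyE (p : nat -> pt R) n : simple p n ->
  ext_poly (polygon n p) = region false (edg p n).
Proof.
move=> sp; have [n2 _ _ _] := sp; have n0 : (0 < n)%N by lia.
apply/seteqP; split=> z [h1].
  have nz : ~ on (edg p n) z by move=> /(polygonE p z n0).
  by move=> /(component_bounded sp nz) h; split=> //; apply/negP.
by move=> h2; split; [move=> /(polygonE p z n0)|rewrite (component_bounded sp h1) h2].
Qed.

Lemma poldiam_le S (k : nat) : (forall a b, S a -> S b -> polygonal_path S a b k) ->
  (poldiam S <= k%:R%:E)%E.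
Proof.
move=> h; apply: ge_ereal_sup => _ [a Sa [b Sb <-]]; apply: ereal_inf_lbound.
by exists k => //; exact: h.
Qed.

Lemma poldiam_ge S (k : nat) a b : S a -> S b ->
  (forall j, polygonal_path S a b j -> (k <= j)%N) -> (k%:R%:E <= poldiam S)%E.
Proof.
move=> Sa Sb h; apply: (@le_trans _ _ (polpi S a b)).
  by apply: le_ereal_inf_tmp => _ [j /h kj <-]; rewrite lee_fin ler_nat.
by apply: ereal_sup_ubound; exists a => //; exists b.
Qed.

Theorem poldiam_upper (p : nat -> pt R) n : simple p n ->
  (poldiam (int_poly (polygon n p)) <= (n./2%:R)%:E)%E /\
  (poldiam (ext_poly (polygon n p)) <= (n.+1./2%:R)%:E)%E.
Proof.
move=> sp; rewrite int_polyE// ext_polyE//; split; apply: poldiam_le => a b Sa Sb; apply: lk_path.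
  exact: (region_links sp Sa Sb).
exact: (region_links sp Sa Sb).
Qed.
End Regions.

(** * The spiral *)

Section Spiral.
Variable R : realType.
Implicit Types a b c u v w x y z m : pt R.
Local Notation edge := (pt R * pt R)%type.
Implicit Types (E : seq edge) (e f : edge) (O S : set (pt R)).

(** The edge crosses the vertical axis properly at height [h]; the equation is cleared of
    denominators. *)
Definition cuts a b (h : R) : Prop :=
  px a * px b < 0 /\ h * (px b - px a) = px b * py a - px a * py b.

Lemma cutsC a b h : cuts a b h -> cuts b a h.
Proof. by move=> [h1 h2]; split; [rewrite mulrC|lra]. Qed.

Lemma cuts_orient a b h t : cuts a b h -> orient a b (mkpt 0 t) = (px b - px a) * (t - h).
Proof. move=> [_ h2]; rewrite /orient !pE.
have -> : (px b - px a) * (t - h) = (px b - px a) * t - h * (px b - px a) by ring.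
rewrite h2; ring. Qed.

Lemma cuts_ray a b h t : cuts a b h -> ray a b (mkpt 0 t) = (t < h).
Proof.
have key a' b' : px a' < 0 -> 0 < px b' -> cuts a' b' h -> ray a' b' (mkpt 0 t) = (t < h).
  move=> a0 b0 c; rewrite /ray (cuts_orient t c) !pE b0 (ltW a0) /=.
  rewrite [px b' <= 0]leNgt b0 /= orbF pmulr_rlt0; first by rewrite subr_lt0.
  by lra.
move=> c; have [h1 _] := c; case: (ltgtP (px a) 0) => a0.
- by apply: key => //; move: h1; rewrite nmulr_rlt0.
- by rewrite rayC; apply: key (cutsC c) => //; move: h1; rewrite pmulr_rlt0.
- by move: h1; rewrite a0 mul0r ltxx.
Qed.

Lemma cuts_on a b h t : cuts a b h -> segment a b (mkpt 0 t) <-> t = h.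
Proof.
have key a' b' : px a' < 0 -> 0 < px b' -> cuts a' b' h -> segment a' b' (mkpt 0 t) <-> t = h.
  move=> a0 b0 c; split=> [/segment_orient0|->].
    rewrite (cuts_orient t c) => /eqP; rewrite mulf_eq0 => /orP[/eqP|/eqP]; last by lra.
    by lra.
  apply: on_segment; rewrite ?(cuts_orient h c) ?pE; [lra|by rewrite subrr mulr0|lra|lra].
move=> c; have [h1 _] := c; case: (ltgtP (px a) 0) => a0.
- by apply: key => //; move: h1; rewrite nmulr_rlt0.
- by rewrite segment_sym; apply: key (cutsC c) => //; move: h1; rewrite pmulr_rlt0.
- by move: h1; rewrite a0 mul0r ltxx.
Qed.

(** By the half-open convention of [ray], an edge ending on the axis counts there only if it comes
    from the right. *)
Lemma ray_half a h t : px a != 0 -> ray a (mkpt 0 h) (mkpt 0 t) = (0 < px a) && (t < h).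
Proof.
move=> a0; rewrite /ray !pE lexx ltxx /= andbF /=.
case: ltP => //= p; rewrite /orient !pE.
have -> : (px a - 0) * (t - h) - (py a - h) * (0 - 0) = px a * (t - h) by ring.
by rewrite pmulr_rlt0// subr_lt0.
Qed.

Definition sg (i : nat) : R := (-1) ^+ uphalf i.
Definition U (i : nat) : R := sg i * 2 ^+ i.
(* On the cubic, orientation is a Vandermonde determinant times the sum of the three
   parameters; the largest parameter dominates that sum, so the sign only depends on the two
   largest ones. *)
Definition W (i : nat) : pt R := mkpt (U i ^+ 3) (U i).

Lemma sg_SS i : sg i.+2 = - sg i. Proof. by rewrite /sg /= exprS mulN1r. Qed.
Lemma U_SS i : U i.+2 = - 4 * U i.
Proof. rewrite /U sg_SS !exprS; ring. Qed.
Lemma U0 : U 0 = 1. Proof. by rewrite /U /sg expr0 mulr1. Qed.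
Lemma U1 : U 1 = - 2. Proof. by rewrite /U /sg /= !expr1 mulN1r. Qed.
Lemma sg_cases i : sg i = 1 \/ sg i = -1.
Proof. by rewrite /sg -signr_odd; case: (odd _); [right|left]; rewrite ?expr1 ?expr0. Qed.

Lemma U_half i j : (i < j)%N -> 2 * `|U i| <= `|U j|.
Proof.
move=> ij; rewrite /U !normrM; have n1 k : `|sg k| = 1.
  by case: (sg_cases k) => ->; rewrite ?normrN normr1.
rewrite !n1 !mul1r !ger0_norm ?exprn_ge0// -exprS.
by apply: ler_weXn2l => //; lra.
Qed.

Lemma U_neq0 i : U i != 0.
Proof. by rewrite /U mulf_neq0 ?expf_neq0// /sg expf_neq0// oppr_eq0 oner_neq0. Qed.

Lemma U_orient i j k : (i < j)%N -> (j < k)%N -> 0 < U k * U j * orient (W k) (W j) (W i).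
Proof.
move=> /U_half ij /U_half jk; have := U_neq0 i; have := U_neq0 j; have := U_neq0 k.
rewrite /orient /W !pE; move: (U i) (U j) (U k) ij jk => w v u ij jk u0 v0 w0.
(* Vandermonde factorisation, grouped so that each group is positive: parameters at least double in
   absolute value, and the largest one dominates. *)
have -> : u * v * ((v ^+ 3 - u ^+ 3) * (w - u) - (v - u) * (w ^+ 3 - u ^+ 3)) =
  ((u - v) * (u - w)) * ((v * (v - w)) * (u * (u + v + w))) by ring.
have [vw1 vw2] : - (`|v| / 2) <= w /\ w <= `|v| / 2.
  have : `|w| <= `|v| / 2 by lra.
  by rewrite ler_norml => /andP[].
have [uv1 uv2] : - (`|u| / 2) <= v /\ v <= `|u| / 2.
  have : `|v| <= `|u| / 2 by lra.
  by rewrite ler_norml => /andP[].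
have a1 : 0 < v * (v - w).
  case: (ltgtP v 0) v0 vw1 vw2 => // h _; [rewrite ltr0_norm//|rewrite gtr0_norm//] => h1 h2.
    by rewrite nmulr_rgt0//; lra.
  by rewrite pmulr_rgt0//; lra.
have [b1 b2] : - (`|u| / 4) <= w /\ w <= `|u| / 4.
  have : `|w| <= `|u| / 4 by lra.
  by rewrite ler_norml => /andP[].
have a2 : 0 < u * (u + v + w) /\ 0 < (u - v) * (u - w).
  case: (ltgtP u 0) u0 uv1 uv2 b1 b2 => // h _; [rewrite ltr0_norm//|rewrite gtr0_norm//] => h1 h2 h3 h4.
    by rewrite !nmulr_rgt0//; lra.
  by rewrite !pmulr_rgt0//; lra.
by case: a2 => a2 a3; apply: mulr_gt0 => //; apply: mulr_gt0.
Qed.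

Lemma W_inj i j : W i = W j -> i = j.
Proof.
move=> /(congr1 (@py R)); rewrite !pE => e; apply/eqP; apply: contraT; rewrite neq_ltn => /orP[] /U_half;
  rewrite e; have := U_neq0 i; have := U_neq0 j; rewrite e -normr_gt0; lra.
Qed.

(** Edges as increasing index pairs: the innermost, the arms with index difference 2, and the
    outermost. *)
Definition adj n (e : nat * nat) := [|| e == (0, 1), (e.2 == e.1.+2) && (e.2 < n) | e == (n.-2, n.-1)]%N.

Lemma adj_lt n (e : nat * nat) : (1 < n)%N -> adj n e -> (e.1 < e.2)%N /\ (e.2 <= e.1.+2)%N /\ (e.2 < n)%N.
Proof.
case: e => a b n1 /or3P[/eqP[-> ->]|/andP[/= /eqP -> h]|/eqP[-> ->]] /=; lia.
Qed.

Lemma adj_long n (a b : nat) : adj n (a, b) -> (a.+1 < b)%N -> b = a.+2.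
Proof. by move=> /or3P[/eqP[-> ->]//|/andP[/= /eqP -> _]//|/eqP[-> ->]]; lia. Qed.

Lemma sg_prod (a b c x y : R) : 0 < a * b * x -> 0 < a * c * y -> 0 < b * c -> a != 0 -> 0 < x * y.
Proof.
move=> h1 h2 h3 a0; have a2 : 0 < a * a by rewrite -expr2 lt_def sqrf_eq0 a0 sqr_ge0.
have : 0 < (a * b * x) * (a * c * y) by rewrite mulr_gt0.
have -> : (a * b * x) * (a * c * y) = ((a * a) * (b * c)) * (x * y) by ring.
by rewrite pmulr_rgt0// mulr_gt0.
Qed.

(** Index intervals of edges without a common vertex are separate or interleaved, having length at
    most 2. In both cases one edge lies on one side of the line of the other; the interleaved case
    uses that [U c'] and [U c'.+2] have opposite signs. *)
Lemma W_sdisj n (a b c d : nat) : (1 < n)%N -> adj n (a, b) -> adj n (c, d) ->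
  a != c -> a != d -> b != c -> b != d -> sdisj (W a) (W b) (W c) (W d).
Proof.
move=> n1.
have sep (a' b' c' d' : nat) : (a' < b')%N -> (b' < c')%N -> (c' < d')%N ->
    sdisj (W a') (W b') (W c') (W d').
  move=> ab bc cd; apply: same_side_sdisj.
  rewrite (orient_swap (W d') (W c') (W a')) (orient_swap (W d') (W c') (W b')) mulrNN.
  have h1 := U_orient (ltn_trans ab bc) cd; have h2 := U_orient bc cd.
  apply: (sg_prod (a := U d') (b := U c') (c := U c')) => //; last exact: U_neq0.
  by rewrite -expr2 lt_def sqrf_eq0 U_neq0 sqr_ge0.
have inter (a' b' c' d' : nat) : adj n (a', b') -> adj n (c', d') -> (a' < c')%N -> (c' < b')%N -> (b' < d')%N ->
    sdisj (W a') (W b') (W c') (W d').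
  move=> h1 h2 ac cb bd; have eb := adj_long h1 (leq_ltn_trans ac cb).
  have ed' := adj_long h2 (leq_ltn_trans cb bd).
  apply/sdisjC/same_side_sdisj.
  have k1 := U_orient ac cb.
  have k2 := U_orient (ltn_trans ac cb) bd.
  rewrite orient_cyc (_ : orient (W a') (W b') (W d') = - orient (W d') (W b') (W a')); last first.
    by rewrite -orient_swap orient_cyc orient_swap -orient_swapr orient_cyc.
  apply: (sg_prod (a := U b') (b := U c') (c := - U d')) => //.
  - by have -> : U b' * - U d' * - orient (W d') (W b') (W a') =
      U d' * U b' * orient (W d') (W b') (W a') by ring.
  - rewrite ed' U_SS; have -> : U c' * - (- 4 * U c') = 4 * (U c' ^+ 2) by ring.
    by rewrite mulr_gt0// lt_def sqrf_eq0 U_neq0 sqr_ge0.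
  - exact: U_neq0.
move=> h1 h2 ac ad bc bd.
have [/= l1 [m1 _]] := adj_lt n1 h1; have [/= l2 [m2 _]] := adj_lt n1 h2.
have [bc'|bc'] := ltnP b c; first exact: sep.
have [da|da] := ltnP d a; first by apply/sdisjC/sep.
have [ac'|ac'] := ltnP a c.
  by apply: inter => //; lia.
by apply/sdisjC/inter => //; lia.
Qed.

Lemma W_orient (i j k : nat) : i != j -> j != k -> i != k -> orient (W i) (W j) (W k) != 0.
Proof.
pose X (a b c : nat) := orient (W a) (W b) (W c) != 0.
have cy (a b c : nat) : X a b c = X b c a by rewrite /X orient_cyc.
have sw (a b c : nat) : X a b c = X b a c by rewrite /X orient_swap oppr_eq0.
have P (a b c : nat) : (a < b)%N -> (b < c)%N -> X c b a.
  by move=> h1 h2; have := U_orient h1 h2; rewrite /X; apply: contraTneq => ->; rewrite mulr0 ltxx.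
rewrite -/(X i j k); case: (ltngtP i j) => // h1 _; case: (ltngtP j k) => // h2 _ ik.
- by rewrite sw -cy; apply: P.
- case: (ltngtP i k) ik => // h3 _; first by rewrite cy; apply: P.
  by rewrite sw; apply: P.
- case: (ltngtP i k) ik => // h3 _; first by rewrite -cy; apply: P.
  by rewrite cy sw -cy; apply: P.
- exact: P.
Qed.

Lemma W_corner (i j k : nat) z : i != j -> j != k -> i != k ->
  segment (W i) (W j) z -> segment (W j) (W k) z -> z = W j.
Proof.
move=> ij jk ik; rewrite segment_sym; apply: meet_common.
by apply: W_orient => //; rewrite eq_sym.
Qed.

(* The cyclic order 0, 2, 4, ..., 5, 3, 1 of the vertices, numbered from the inside. *)
Definition idx n i := if (i.*2 < n)%N then i.*2 else (n.*2 - i.*2).-1.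
Definition srt (e : nat * nat) := if (e.1 < e.2)%N then e else (e.2, e.1).
(** [epairs] lists the edges from the inside outwards, as crossing counts need them; [cpairs] lists
    them in the cyclic order of the polygon. *)
Definition epairs n := (0%N, 1%N) :: rcons [seq (i, i.+2) | i <- iota 0 n.-2] (n.-2, n.-1).
Definition cpairs n := [seq srt (idx n i, idx n (i.+1 %% n)%N) | i <- iota 0 n].

Lemma idx_inj n i j : (i < n)%N -> (j < n)%N -> idx n i = idx n j -> i = j.
Proof. by rewrite /idx; case: ifP; case: ifP; lia. Qed.

Lemma epairs_uniq n : (2 < n)%N -> uniq (epairs n).
Proof.
move=> n2; rewrite /= rcons_uniq mem_rcons inE negb_or; apply/and3P; split.
- apply/andP; split; first by apply/eqP => -[]; lia.
  by apply/mapP => -[i _ []]; lia.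
- by apply/mapP => -[i _ []]; lia.
- by rewrite map_inj_uniq ?iota_uniq// => i j [].
Qed.

Lemma mem_epairs n (e : nat * nat) : (2 < n)%N -> (e \in epairs n) = adj n e.
Proof.
move=> n2; rewrite /epairs inE mem_rcons inE /adj; congr orb; rewrite orbC; congr orb.
apply/mapP/andP => [[i]|[/eqP h1 h2]].
  by rewrite mem_iota add0n => /andP[_ hi] ->; rewrite eqxx; split=> //=; lia.
exists e.1; first by rewrite mem_iota; lia.
by rewrite -h1; case: (e).
Qed.

Lemma cpairs_sub n : (2 < n)%N -> {subset epairs n <= cpairs n}.
Proof.
move=> n2 [a b]; rewrite mem_epairs// => h; apply/mapP.
have w (k a' b' : nat) : (k < n)%N -> (a', b') = srt (idx n k, idx n (k.+1 %% n)%N) ->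
    exists2 x, x \in iota 0 n & (a', b') = srt (idx n x, idx n (x.+1 %% n)%N).
  by move=> hk e; exists k; rewrite // mem_iota.
case/or3P: h => [/eqP[-> ->]|/andP[/= /eqP -> h]|/eqP[-> ->]].
- apply: (w n.-1); first by lia.
  rewrite prednK ?modnn; last by lia.
  by rewrite /srt /idx /=; do ![case: ifP => /=]; move=> *; congr (_, _); lia.
- case: (boolP (odd a)) => oa.
    apply: (w (n - 1 - (a.+2)./2)%N); first by lia.
    rewrite modn_small; last by lia.
    by rewrite /srt /idx /=; do ![case: ifP => /=]; move=> *; congr (_, _); lia.
  apply: (w a./2); first by lia.
  rewrite modn_small; last by lia.
  by rewrite /srt /idx /=; do ![case: ifP => /=]; move=> *; congr (_, _); lia.
apply: (w (n.-1)./2); first by lia.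
rewrite modn_small; last by lia.
by rewrite /srt /idx /=; do ![case: ifP => /=]; move=> *; congr (_, _); lia.
Qed.

Lemma cpairs_perm n : (2 < n)%N -> perm_eq (epairs n) (cpairs n).
Proof.
move=> n2; have sz : (size (cpairs n) <= size (epairs n))%N.
  by rewrite /epairs /cpairs /= size_rcons !size_map !size_iota; lia.
have ue := epairs_uniq n2; have sub := cpairs_sub n2.
have uc := leq_size_uniq ue sub sz.
apply: uniq_perm => //; by have [] := uniq_min_size ue sub sz.
Qed.

Lemma modS_inj n i j : (i < n)%N -> (j < n)%N -> (i.+1 %% n)%N = (j.+1 %% n)%N -> i = j.
Proof.
move=> hi hj e; have [h1|h1] := ltnP i.+1 n; have [h2|h2] := ltnP j.+1 n.
- by move: e; rewrite !modn_small// => -[].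
- have ej : j.+1 = n by lia.
  by move: e; rewrite ej modnn modn_small.
- have ei : i.+1 = n by lia.
  by move: e; rewrite ei modnn modn_small.
- lia.
Qed.

Definition spiral n i : pt R := W (idx n i).
Definition chain (l : seq (nat * nat)) : seq edge := [seq (W i.1, W i.2) | i <- l].

Lemma srt_cases (e : nat * nat) : srt e = e \/ srt e = (e.2, e.1).
Proof. by rewrite /srt; case: ifP; auto. Qed.

Lemma spiral_par n z : (2 < n)%N -> par (edg (spiral n) n) z = par (chain (epairs n)) z.
Proof.
move=> n2; rewrite /par /edg /chain !big_map (perm_big _ (cpairs_perm n2)) /= big_map.
apply: eq_bigr => i _; set e := (idx n i, _).
by case: (srt_cases e) => ->; rewrite //= rayC.
Qed.

Lemma spiral_on n z : (2 < n)%N -> on (edg (spiral n) n) z <-> on (chain (epairs n)) z.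
Proof.
move=> n2; have pm := perm_mem (cpairs_perm n2).
split=> [[e /mem_edg[i hi ->] /= h]|[_ /mapP[e eE ->] /= h]].
  pose e' := (idx n i, idx n (i.+1 %% n)%N).
  have m : srt e' \in epairs n by rewrite pm; apply/mapP; exists i; rewrite // mem_iota.
  exists (W (srt e').1, W (srt e').2); first exact: (map_f (fun i => (W i.1, W i.2)) m).
  by case: (srt_cases e') => -> //=; rewrite segment_sym.
move: eE; rewrite pm => /mapP[i]; rewrite mem_iota add0n => /andP[_ hi] ee.
exists (spiral n i, spiral n (i.+1 %% n)%N); first by apply/mem_edg; exists i.
by move: h; rewrite ee; case: (srt_cases (idx n i, idx n (i.+1 %% n)%N)) => -> //=; rewrite segment_sym.
Qed.

Lemma spiral_simple n : (2 < n)%N -> simple (spiral n) n.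
Proof.
move=> n2; have n0 : (0 < n)%N by lia.
have md k : (k.+1 %% n < n)%N by rewrite ltn_mod.
have ix i j : (i < n)%N -> (j < n)%N -> i != j -> idx n i != idx n j.
  by move=> hi hj; apply: contra_neq; apply: idx_inj.
have ad i : (i < n)%N -> adj n (srt (idx n i, idx n (i.+1 %% n)%N)).
  move=> hi; rewrite -mem_epairs// (perm_mem (cpairs_perm n2)).
  by apply/mapP; exists i; rewrite // mem_iota.
split=> //.
- by move=> i j hi hj /W_inj; apply: idx_inj.
- move=> i j hi hj ij nj ni.
  have := ad i hi; have := ad j hj; rewrite /spiral.
  have e1 : idx n i != idx n j by apply: ix.
  have e2 : idx n i != idx n (j.+1 %% n)%N by apply: ix.
  have e3 : idx n (i.+1 %% n)%N != idx n j by apply: ix; rewrite // eq_sym.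
  have e4 : idx n (i.+1 %% n)%N != idx n (j.+1 %% n)%N.
    by apply: ix => //; apply: contra_neq ij; exact: modS_inj.
  move: e1 e2 e3 e4; move: (idx n i) (idx n (i.+1 %% n)%N) (idx n j) (idx n (j.+1 %% n)%N).
  move=> a b c d ac ad' bc bd h2 h1; have n1 : (1 < n)%N by lia.
  case: (srt_cases (a, b)) h1 => -> /= h1; case: (srt_cases (c, d)) h2 => -> /= h2.
  + exact: W_sdisj h1 h2 _ _ _ _.
  + by apply/sdisj_swapr; apply: W_sdisj h1 h2 _ _ _ _.
  + by apply/sdisj_swapl; apply: W_sdisj h1 h2 _ _ _ _.
  + by apply/sdisj_swapl/sdisj_swapr; apply: W_sdisj h1 h2 _ _ _ _.
move=> i j k z hi ej ek; have hj : (j < n)%N by rewrite ej.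
have hk : (k < n)%N by rewrite ek.
apply: W_corner; apply: ix => //.
- by rewrite ej eq_sym modS_neq//; lia.
- by rewrite ek eq_sym modS_neq//; lia.
- by rewrite ek ej eq_sym modSS_neq.
Qed.
End Spiral.

(** * Gates on the axis *)

Section Gates.
Variable R : realType.
Implicit Types a b c u v w x y z m : pt R.
Local Notation edge := (pt R * pt R)%type.
Implicit Types (E K P C : seq edge) (h k s t : R).

Lemma path_hits C (q : nat -> pt R) (j : nat) : cyc C -> par C (q 0%N) != par C (q j) ->
  exists2 l, (l < j)%N & exists2 z, segment (q l) (q l.+1) z & on C z.
Proof.
move=> cC; elim: j => [|j ih]; first by rewrite eqxx.
have [e|ne _] := eqVneq (par C (q 0%N)) (par C (q j)); last first.
  by have [l lj h] := ih ne; exists l => //; exact: leqW.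
rewrite e => ne; exists j => //; apply: contrapT => h; move/eqP: ne; apply.
by apply: par_const => // z sz zC; apply: h; exists z.
Qed.

(** Pigeonhole. In case of equality every link hits a gate; with the last gate and link removed,
    this yields information on the penultimate link of a path that would be too short. *)
Lemma gates_bound (g j : nat) (hit : nat -> nat -> Prop) :
  (forall i, (i < g)%N -> exists2 l, (l < j)%N & hit i l) ->
  (forall i i' l, (i < i')%N -> (i' < g)%N -> hit i l -> hit i' l -> False) ->
  (g <= j)%N /\ (g = j -> forall l, (l < j)%N -> exists2 i, (i < g)%N & hit i l).
Proof.
move=> h ex.
have [|f hf] := @choice _ _ (fun (i : 'I_g) (l : 'I_j) => hit i l).
  by move=> i; have [l lj hl] := h i (ltn_ord i); exists (Ordinal lj).
have fi : injective f.
  move=> i i' e; apply: val_inj => /=; have := hf i; have := hf i'; rewrite e => h1 h2.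
  case: (ltngtP i i') => // lt; [case: (ex _ _ _ lt (ltn_ord i') h2 h1)|case: (ex _ _ _ lt (ltn_ord i) h1 h2)].
split; first by have := leq_card f fi; rewrite !card_ord.
move=> e l lj; have : Ordinal lj \in codom f by apply: inj_card_onto => //; rewrite !card_ord e.
by move=> /codomP[i ei]; exists i => //; have := hf i; rewrite -ei.
Qed.

(** An interval of the axis between two walls on one side of the origin; absolute values treat both
    sides alike. *)
Definition gate h k t : Prop := [/\ `|h| < `|t|, `|t| < `|k| & 0 < h * t].

Lemma gate_between h k t : 0 < h * k -> `|h| < `|k| -> t != h -> t != k ->
  (h <= t <= k \/ k <= t <= h) -> gate h k t.
Proof.
move=> hk; have [h0|h0|h0] := ltgtP h 0; last by move: hk; rewrite h0 mul0r ltxx.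
  have k0 : k < 0 by move: hk; rewrite nmulr_rgt0.
  rewrite (ltr0_norm h0) (ltr0_norm k0) => lt n1 n2 bt.
  have t1 : k < t by rewrite lt_def n2; lra.
  have t2 : t < h by rewrite lt_def eq_sym n1; lra.
  have t0 : t < 0 by lra.
  by rewrite /gate !ltr0_norm// nmulr_rgt0//; split; lra.
have k0 : 0 < k by move: hk; rewrite pmulr_rgt0.
rewrite (gtr0_norm h0) (gtr0_norm k0) => lt n1 n2 bt.
have t1 : t < k by rewrite lt_def eq_sym n2; lra.
have t2 : h < t by rewrite lt_def n1; lra.
have t0 : 0 < t by lra.
by rewrite /gate !gtr0_norm// pmulr_rgt0//; split; lra.
Qed.

Lemma vertical_segment s t k : (s <= k <= t \/ t <= k <= s) -> segment (mkpt 0 s) (mkpt 0 t) (mkpt 0 k).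
Proof.
have key (p q : R) : p <= k <= q -> segment (mkpt 0 p) (mkpt 0 q) (mkpt 0 k).
  have [e|ne] := eqVneq p q.
    by rewrite e => kk; rewrite (_ : k = q); [exact: segment_l|lra].
  move=> /andP[h1 h2]; have lt : p < q by rewrite lt_def eq_sym ne; lra.
  apply/segmentP; exists ((k - p) / (q - p)); rewrite !pE; split; last by field; lra.
  - by rewrite divr_ge0; lra.
  - by rewrite ler_pdivrMr; lra.
  - by rewrite !mulr0 addr0.
by case=> h; [exact: key|rewrite segment_sym; exact: key].
Qed.

Lemma on_vertical s t z : segment (mkpt 0 s) (mkpt 0 t) z ->
  exists2 k, z = mkpt 0 k & (s <= k <= t \/ t <= k <= s).
Proof.
case=> r /andP[r0 r1] ->; exists ((1 - r) * s + r * t).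
  by apply: pt_eq; rewrite !pE; ring.
have r2 : 0 <= 1 - r by lra.
have [st|ts] := leP s t; [left|right].
  have h1 := ler_wpM2l r0 st; have h2 := ler_wpM2l r2 st; lra.
have {}ts := ltW ts; have h1 := ler_wpM2l r0 ts; have h2 := ler_wpM2l r2 ts; lra.
Qed.

Lemma axis_separated P x y s t k : (forall z, segment x y z -> ~ on P z) ->
  segment x y (mkpt 0 s) -> segment x y (mkpt 0 t) -> on P (mkpt 0 k) ->
  (s <= k <= t \/ t <= k <= s) -> False.
Proof. by move=> h h1 h2 hP hk; apply: (h (mkpt 0 k)) => //; apply: segment_conv h1 h2 _ (vertical_segment hk). Qed.

Lemma between_abs s t k : (`|s| < `|k| \/ s * k <= 0) -> `|k| < `|t| -> 0 < k * t ->
  (s <= k <= t \/ t <= k <= s).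
Proof.
have [k0|k0|k0] := ltgtP k 0; last by rewrite k0 mul0r ltxx.
  rewrite nmulr_rgt0// (ltr0_norm k0) nmulr_lle0// => h1 + t0; rewrite ltr0_norm// => h2; right.
  by case: h1; [rewrite ltr_norml|]; lra.
rewrite pmulr_rgt0// (gtr0_norm k0) pmulr_lle0// => h1 + t0; rewrite gtr0_norm// => h2; left.
by case: h1; [rewrite ltr_norml|]; lra.
Qed.

(* The walls [K], closed up by a chord of the axis, form a cycle meeting the free space only in
   that chord. *)
Lemma separator P K a b a' b' h k : cuts a a' h -> cuts b b' k ->
  segment a a' `<=` on P -> segment b b' `<=` on P -> on K `<=` on P ->
  (forall g : pt R -> bool, \big[addb/false]_(e <- K) (g e.1 (+) g e.2) = g a (+) g b) ->
  0 < px a * px b -> 0 < h * k -> `|h| < `|k| ->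
  exists C, [/\ cyc C, forall z, on C z -> on P z \/ exists2 t, z = mkpt 0 t & gate h k t &
    forall t, (t < h) = (t < k) -> par C (mkpt 0 t) = par K (mkpt 0 t)].
Proof.
move=> ca cb sa sb sK bK ab hk lt.
exists (K ++ [:: (a, mkpt 0 h); (mkpt 0 h, mkpt 0 k); (mkpt 0 k, b)]); split.
- move=> g; rewrite big_cat bK /= !big_cons big_nil /=.
  by case: (g a); case: (g b); case: (g _); case: (g _).
- have ha : segment a a' (mkpt 0 h) by apply/(cuts_on h ca).
  have hb : segment b b' (mkpt 0 k) by apply/(cuts_on k cb).
  move=> z /on_cat[/sK|]; first by left.
  case/on_cons => /= [hz|]; first by left; apply/sa/(segment_conv (segment_l _ _) ha).
  case/on_cons => /= [hz|]; last first.
    case/on_cons => /= [hz|/on_nil//]; left; apply: sb.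
    exact: (segment_conv hb (segment_l _ _)).
  have [t -> ht] := on_vertical hz.
  have [->|n1] := eqVneq t h; first by left; exact: sa.
  have [->|n2] := eqVneq t k; first by left; exact: sb.
  by right; exists t => //; apply: gate_between.
move=> t e; have a0 : px a != 0 by apply: contraTneq ab => ->; rewrite mul0r ltxx.
have b0 : px b != 0 by apply: contraTneq ab => ->; rewrite mulr0 ltxx.
rewrite par_cat; suff -> : par [:: (a, mkpt 0 h); (mkpt 0 h, mkpt 0 k); (mkpt 0 k, b)] (mkpt 0 t) = false.
  by rewrite addbF.
rewrite !par_cons /= (rayC (mkpt 0 k) b) (@ray_half _ a h t a0) (@ray_half _ b k t b0) e.
have -> : (0 < px a) = (0 < px b).
  case: (ltgtP (px a) 0) ab a0 => // s0; first by rewrite nmulr_rgt0// => ? _; apply/esym; lra.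
  by rewrite pmulr_rgt0// => ->.
rewrite /ray !pE ltxx /= !andbF /par big_nil.
by case: (_ && _).
Qed.

(** The share of a family of crossings with heights [f] in the parity at the point [t] of the
    axis. *)
Definition hs (f : nat -> R) (m : nat) t : bool := \big[addb/false]_(i <- iota 0 m) (t < f i).

Lemma hs0 f t : hs f 0 t = false. Proof. by rewrite /hs big_nil. Qed.
Lemma hsS f (m : nat) t : hs f m.+1 t = hs f m t (+) (t < f m).
Proof. by rewrite /hs -addn1 iotaD big_cat /= add0n big_cons big_nil addbF. Qed.

Lemma hs_pairs f (m : nat) t :
  (forall i, (i < m)%N -> (t < f i.*2.+1) = (t < f i.*2.+2)) -> hs f m.*2.+1 t = (t < f 0%N).
Proof.
elim: m => [|m ih] h; first by rewrite hsS hs0.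
by rewrite doubleS 2!hsS ih ?h ?addbK// => i im; apply: h; exact: ltnW.
Qed.

Lemma hs_const f (m : nat) t (d : bool) : (forall i, (i < m)%N -> (t < f i) = d) -> hs f m t = odd m && d.
Proof.
elim: m => [|m ih] h; first by rewrite hs0.
by rewrite hsS ih ?h// => [|i im]; [rewrite /=; case: (odd m); case: (d)|apply/h/ltnW].
Qed.

Lemma lt_small t h : `|t| < `|h| -> (t < h) = (0 < h).
Proof.
have [h0|h0|->] := ltgtP h 0; last by rewrite normr0 normr_lt0.
  by rewrite (ltr0_norm h0) ltr_norml => ?; apply/negbTE; rewrite -leNgt; lra.
by rewrite (gtr0_norm h0) ltr_norml => ?; lra.
Qed.

Lemma lt_big t h : `|h| < `|t| -> (t < h) = (t < 0).
Proof.
have [t0|t0|->] := ltgtP t 0; last by rewrite normr0 normr_lt0.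
  by rewrite (ltr0_norm t0) ltr_norml => ?; lra.
by rewrite (gtr0_norm t0) ltr_norml => ?; apply/negbTE; rewrite -leNgt; lra.
Qed.
End Gates.

(** * Crossings of the spiral with the axis *)

Section Heights.
Variable R : realType.
Implicit Types a b c u v w x y z m : pt R.
Local Notation edge := (pt R * pt R)%type.
Implicit Types (E K P C : seq edge) (h k s t : R).
Local Notation U := (U R).
Local Notation W := (W R).
Local Notation sg := (sg R).

(* The edge from [W i] meets the axis at height [12/13 * U i] if it leads to [W i.+2] and at
   [2/3 * U i] if it is the last one, leading to [W i.+1]. *)
Definition ratio (n i : nat) : R := if i == n.-2 then 2 / 3 else 12 / 13.
Definition hgt (n i : nat) : R := U i * ratio n i.

Lemma absU i : `|U i| = 2 ^+ i.
Proof.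
rewrite /U normrM [`|2 ^+ i|]ger0_norm ?exprn_ge0//.
by case: (sg_cases R i) => ->; rewrite ?normrN normr1 mul1r.
Qed.

Lemma ratio_bounds n i : 2 / 3 <= ratio n i /\ ratio n i <= 12 / 13.
Proof. by rewrite /ratio; case: ifP => _; split; lra. Qed.

Lemma hgt_ge n i : 2 / 3 * 2 ^+ i <= `|hgt n i|.
Proof.
have [h1 h2] := ratio_bounds n i; rewrite /hgt normrM absU (@ger0_norm _ (ratio n i)); last by lra.
by rewrite mulrC ler_wpM2l// exprn_ge0.
Qed.

Lemma hgt_le n i : `|hgt n i| <= 12 / 13 * 2 ^+ i.
Proof.
have [h1 h2] := ratio_bounds n i; rewrite /hgt normrM absU (@ger0_norm _ (ratio n i)); last by lra.
by rewrite [leRHS]mulrC ler_wpM2l// exprn_ge0.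
Qed.

Lemma exp2_lt i j : (i < j)%N -> 2 * 2 ^+ i <= 2 ^+ j :> R.
Proof. by move=> ij; rewrite -exprS; apply: ler_weXn2l => //; lra. Qed.

Lemma exp2_gt0 i : 0 < 2 ^+ i :> R. Proof. by rewrite exprn_gt0. Qed.

(** Heights grow with the index since 12/13 is less than twice 2/3. *)
Lemma hgt_lt n i j : (i < j)%N -> `|hgt n i| < `|hgt n j|.
Proof. by move=> /exp2_lt; have := hgt_le n i; have := hgt_ge n j; have := exp2_gt0 i; lra. Qed.

Lemma hgt_mono n i j : (i <= j)%N -> `|hgt n i| <= `|hgt n j|.
Proof. by rewrite leq_eqVlt => /orP[/eqP ->//|/(hgt_lt n)/ltW]. Qed.

Lemma hgt0 n : (2 < n)%N -> hgt n 0 = 12 / 13.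
Proof. by move=> n2; rewrite /hgt /ratio U0 mul1r; case: eqP => //; lia. Qed.

Lemma hgt_inner n i : (i.+2 < n)%N -> hgt n i = U i * (12 / 13).
Proof. by move=> h; rewrite /hgt /ratio; case: eqP => //; lia. Qed.

Lemma U_S i : U i.+1 = (if odd i then 2 else - 2) * U i.
Proof.
rewrite /U /sg (_ : uphalf i.+1 = i./2.+1)// uphalf_half.
by case: (odd i); rewrite /= ?add1n ?add0n ?exprS; ring.
Qed.

Lemma U_odd i : U i.*2.+2 = 2 * U i.*2.+1.
Proof. by rewrite U_S /= odd_double. Qed.

Lemma U_gap i : U i.*2.+3 = 8 * U i.*2.
Proof. by rewrite U_SS (U_S i.*2) odd_double; ring. Qed.

Lemma same_odd i : 0 < U i.*2.+1 * U i.*2.+2.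
Proof. by rewrite U_odd mulrCA -expr2 mulr_gt0// lt_def sqrf_eq0 U_neq0 sqr_ge0. Qed.

Lemma same_gap i : 0 < U i.*2 * U i.*2.+3.
Proof. by rewrite U_gap mulrCA -expr2 mulr_gt0// lt_def sqrf_eq0 U_neq0 sqr_ge0. Qed.

Lemma same_hgt n i j : 0 < U i * U j -> 0 < hgt n i * hgt n j.
Proof.
have [h1 _] := ratio_bounds n i; have [h2 _] := ratio_bounds n j => h; rewrite /hgt mulrACA mulr_gt0//.
by apply: mulr_gt0; lra.
Qed.

Lemma same_px i j : 0 < U i * U j -> 0 < px (W i) * px (W j).
Proof. by rewrite !pE -exprMn => h; rewrite exprn_gt0. Qed.

Lemma same_pos n i j : 0 < U i * U j -> (0 < hgt n i) = (0 < hgt n j).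
Proof.
move=> /(same_hgt n); case: (ltgtP (hgt n i) 0) => [h|h|->]; last by rewrite mul0r ltxx.
  by rewrite nmulr_rgt0// => ?; apply/esym; lra.
by rewrite pmulr_rgt0.
Qed.

Lemma cuts01 : cuts (W 0) (W 1) (2 / 3 : R).
Proof. by rewrite /W U0 U1; split; rewrite !pE; [lra|field]. Qed.

Lemma U3_neg i j (d : R) : 0 < d -> U j = - d * U i -> px (W i) * px (W j) < 0.
Proof.
move=> d0 e; rewrite !pE e; have -> : U i ^+ 3 * (- d * U i) ^+ 3 = - (d ^+ 3 * (U i ^+ 3) ^+ 2) by ring.
rewrite oppr_lt0; apply: mulr_gt0; first by rewrite exprn_gt0.
by rewrite lt_def sqrf_eq0 expf_neq0 ?U_neq0// sqr_ge0.
Qed.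

Lemma cuts_step i : cuts (W i) (W i.+2) (U i * (12 / 13)).
Proof. by split; [apply: (U3_neg (d := 4)) => //; exact: U_SS|rewrite !pE U_SS; field]. Qed.

Lemma cuts_last i : ~~ odd i -> cuts (W i) (W i.+1) (U i * (2 / 3)).
Proof.
move=> oi; have e : U i.+1 = - 2 * U i by rewrite U_S (negbTE oi).
by split; [apply: (U3_neg (d := 2))|rewrite !pE e; field].
Qed.

Lemma hgt_U (n i : nat) : 0 < hgt n i * U i.
Proof.
rewrite /hgt mulrAC; have [r1 _] := ratio_bounds n i.
rewrite pmulr_rgt0 -?expr2; last by rewrite lt_def sqrf_eq0 U_neq0 sqr_ge0.
by lra.
Qed.

Section Fixed.
Variable n : nat.
Hypothesis n2 : (2 < n)%N.
Local Notation P := (edg (spiral R n) n).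
Local Notation H := (hgt n).
(** The number of axis crossings besides the innermost edge: [n - 1] for even [n], and [n - 2] for
    odd [n], when the outermost edge stays on one side of the axis. *)
Local Notation N := (n./2.*2.-1).

Lemma adj_on (i j : nat) : adj n (i, j) -> segment (W i) (W j) `<=` on P.
Proof.
move=> h z hz; apply/spiral_on => //; exists (W i, W j) => //.
by apply: (map_f (fun e : nat * nat => (W e.1, W e.2)) (x := (i, j))); rewrite mem_epairs.
Qed.

Lemma step_on i : (i.+2 < n)%N -> segment (W i) (W i.+2) `<=` on P.
Proof. by move=> h; apply: adj_on; rewrite /adj /= eqxx h orbT. Qed.

Lemma inner_on : segment (W 0) (W 1) `<=` on P.
Proof. exact: adj_on. Qed.

Lemma hgt_cases i : (i < N)%N ->
  (i.+2 < n)%N \/ [/\ i = n.-2, ~~ odd i & n = i.+2].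
Proof.
move=> h; case: (ltnP i.+2 n) => h'; [by left|right].
have e := odd_double_half n; case: (boolP (odd n)) e => o1 /= e; first by lia.
have ei : n = i.+2 by lia.
by split=> //; [rewrite ei|move: o1; rewrite ei /= negbK].
Qed.

Lemma hgt_on i : (i < N)%N -> on P (mkpt 0 (H i)).
Proof.
move=> /hgt_cases[h|[ei oi en]].
  by apply: (step_on h); apply/(cuts_on _ (cuts_step i)); rewrite hgt_inner.
have : segment (W i) (W i.+1) (mkpt 0 (H i)).
  by apply/(cuts_on _ (cuts_last oi)); rewrite /hgt /ratio ei eqxx.
by apply: adj_on; rewrite /adj en /= eqxx !orbT.
Qed.

(** An initial piece of the spiral, to be read as one chain from [W m] through the innermost edge to
    [W m.+1]. *)
Definition arms (m : nat) : seq edge := chain R ((0%N, 1%N) :: [seq (i, i.+2) | i <- iota 0 m]).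

Lemma arms_par (m : nat) t : (m.+1 < n)%N -> par (arms m) (mkpt 0 t) = (t < 2 / 3) (+) hs H m t.
Proof.
move=> mn; rewrite par_cons /= (cuts_ray t cuts01); congr addb.
rewrite /par /hs !big_map !big_seq; apply: eq_bigr => i; rewrite mem_iota add0n => /= hi.
by rewrite (cuts_ray t (cuts_step i)) hgt_inner//; lia.
Qed.

Lemma arms_on (m : nat) : (m.+1 < n)%N -> on (arms m) `<=` on P.
Proof.
move=> mn z [_ /mapP[e he ->] /=]; move: he; rewrite inE => /orP[/eqP -> /=|]; first exact: inner_on.
by move=> /mapP[i]; rewrite mem_iota add0n => /= hi -> /=; apply: step_on; lia.
Qed.

Lemma arms_ends (m : nat) (g : pt R -> bool) :
  \big[addb/false]_(e <- arms m) (g e.1 (+) g e.2) = g (W m) (+) g (W m.+1).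
Proof.
rewrite /arms big_map big_cons big_map /=; elim: m => [|m ih]; first by rewrite big_nil addbF.
rewrite -[X in iota 0 X]addn1 iotaD big_cat /= add0n big_cons big_nil addbF addbA ih.
by case: (g _); case: (g _); case: (g _).
Qed.

Lemma P_split : chain R (epairs n) = arms n.-2 ++ [:: (W n.-2, W n.-1)].
Proof. by rewrite /chain /epairs /arms /chain /= map_rcons -cats1. Qed.

(** For odd [n] the last two vertices have parameters of the same sign, so the blunt outer end does
    not reach the axis. *)
Lemma last_odd t : odd n -> ~ segment (W n.-2) (W n.-1) (mkpt 0 t) /\
  ray (W n.-2) (W n.-1) (mkpt 0 t) = false.
Proof.
move=> on_; have [m en] : exists m : nat, n = m.*2.+3.
  by exists (n - 3)./2; have := odd_double_half (n - 3); rewrite oddB ?on_ /=; lia.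
rewrite en /=; have := same_px (same_odd m).
move: (W m.*2.+1) (W m.*2.+2) => a b ab; split.
  move=> sz; case: (ltgtP (px a) 0) ab => [h|h|->]; last by rewrite mul0r ltxx.
    rewrite nmulr_rgt0// => hb.
    have := @px_seg_le R (Num.max (px a) (px b)) a b (mkpt 0 t).
    rewrite !pE !le_max !lexx orbT => /(_ isT isT sz).
    by rewrite orbC leNgt hb leNgt h.
  rewrite pmulr_rgt0// => hb.
  have := @px_seg_ge R (Num.min (px a) (px b)) a b (mkpt 0 t).
  rewrite !pE !ge_min !lexx orbT => /(_ isT isT sz).
  by rewrite orbC leNgt hb leNgt h.
apply/negbTE; rewrite /ray !pE; apply/negP => /orP[] /and3P[h1 h2 _]; move: ab; apply/negP; rewrite -leNgt.
  by apply: mulr_le0_ge0 => //; exact: ltW.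
by apply: mulr_ge0_le0 => //; exact: ltW.
Qed.

Lemma N_odd : odd n -> N = n.-2.
Proof. by move=> o1; have := odd_double_half n; rewrite o1; lia. Qed.
Lemma N_even : ~~ odd n -> N = n.-2.+1.
Proof. by move=> o1; have := odd_double_half n; rewrite (negbTE o1); lia. Qed.

Lemma P_par t : par P (mkpt 0 t) = (t < 2 / 3) (+) hs H N t.
Proof.
rewrite spiral_par// P_split par_cat arms_par; last by lia.
rewrite par_cons /= /par big_nil addbF -addbA; congr addb.
case: (boolP (odd n)) => o1; first by rewrite (last_odd t o1).2 addbF N_odd.
have o2 : ~~ odd n.-2 by case: (n) n2 o1 => [|[|m]]//= _; rewrite negbK.
rewrite N_even// hsS; congr addb.
have -> : n.-1 = n.-2.+1 by lia.
by rewrite (cuts_ray t (cuts_last o2)) /hgt /ratio eqxx.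
Qed.

Lemma P_off t : t != 2 / 3 -> (forall i, (i < N)%N -> t != H i) -> ~ on P (mkpt 0 t).
Proof.
move=> t0 h /(spiral_on _ n2) [_ /mapP[[a b] he ->] /=]; move: he; rewrite mem_epairs//.
case/or3P => [/eqP[-> ->]|/andP[/= /eqP -> hi]|/eqP[-> ->]].
- by move/(cuts_on _ cuts01) => e; rewrite e eqxx in t0.
- have ai : (a < N)%N by have := odd_double_half n; case: (odd n); lia.
  by move/(cuts_on _ (cuts_step a)) => e; move: (h a ai); rewrite hgt_inner// e eqxx.
case: (boolP (odd n)) => o1; first by have [] := last_odd t o1.
have o2 : ~~ odd n.-2 by case: (n) n2 o1 => [|[|m]]//= _; rewrite negbK.
have ai : (n.-2 < N)%N by rewrite N_even.
have -> : n.-1 = n.-2.+1 by lia.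
by move/(cuts_on _ (cuts_last o2)) => e; move: (h _ ai); rewrite /hgt /ratio eqxx e eqxx.
Qed.
End Fixed.
End Heights.

(** * Lower bound for the interior *)

Local Opaque hgt U.

Section Lower.
Variable R : realType.
Implicit Types a b c u v w x y z m : pt R.
Local Notation edge := (pt R * pt R)%type.
Implicit Types (E K P C : seq edge) (h k s t : R).
Local Notation U := (U R).
Local Notation W := (W R).
Local Notation sg := (sg R).

Lemma gate_lt h k t : 0 < h * k -> gate h k t -> (t < h) (+) (t < k).
Proof.
move=> hk [h1 h2 h3]; rewrite (lt_big h1) (lt_small h2).
have [t0|t0|t0] := ltgtP t 0; last by move: h3; rewrite t0 mulr0 ltxx.
  have h0 : h < 0 by move: h3; rewrite nmulr_lgt0.
  by move: hk; rewrite nmulr_rgt0//= => k0; rewrite ltNge ltW.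
have h0 : 0 < h by move: h3; rewrite pmulr_lgt0.
by move: hk; rewrite pmulr_rgt0.
Qed.

Section Fixed.
Variable n : nat.
Hypothesis n2 : (2 < n)%N.
Local Notation P := (edg (spiral R n) n).
Local Notation H := (hgt R n).
Local Notation N := (n./2.*2.-1).

Lemma hgt_gt (l : nat) : (0 < l)%N -> 12 / 13 < `|H l|.
Proof.
move=> /(hgt_lt R n); rewrite hgt0//.
suff -> : `|12 / 13 : R| = 12 / 13 by [].
by apply: ger0_norm; lra.
Qed.

Lemma small_side (l : nat) t : 0 <= t -> t <= 12 / 13 -> (0 < l)%N -> `|t| < `|H l|.
Proof. by move=> t0 t1 /hgt_gt h; rewrite (ger0_norm t0); exact: le_lt_trans h. Qed.

Lemma arm_small (l : nat) t : 0 <= t -> t <= 12 / 13 -> (t < H l.*2.+1) = (t < H l.*2.+2).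
Proof.
move=> t0 t1; rewrite (lt_small (small_side t0 t1 (ltn0Sn _))) (lt_small (small_side t0 t1 (ltn0Sn _))).
exact: same_pos (same_odd R l).
Qed.

Lemma big_inner t : `|H 0| < `|t| -> `|2 / 3 : R| < `|t|.
Proof.
rewrite hgt0// => h; apply: lt_trans h.
have e1 : `|12 / 13 : R| = 12 / 13 by apply: ger0_norm; lra.
have e2 : `|2 / 3 : R| = 2 / 3 by apply: ger0_norm; lra.
by rewrite e1 e2; lra.
Qed.

Lemma path_link (g : bool) (q : nat -> pt R) (j : nat) :
  (forall i, (1 <= i <= j)%N -> segment (q i.-1) (q i) `<=` region g P) ->
  forall l z, (l < j)%N -> segment (q l) (q l.+1) z -> ~ on P z.
Proof. by move=> h l z lj hz; have [] := h l.+1 lj z hz. Qed.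

(* Gate [i] lies between the two walls of the [i]-th arm of the spiral. *)
Definition igate (i : nat) t := if i is i'.+1 then gate (H i'.*2.+1) (H i'.*2.+2) t else t = 4 / 5.

(** The inner wall of the later gate lies between the two points. *)
Lemma igate_between (i i' : nat) s t : (i < i')%N -> (i' < n./2)%N -> igate i s -> igate i' t ->
  exists2 k, on P (mkpt 0 k) & s <= k <= t \/ t <= k <= s.
Proof.
case: i' => // i' ii ig hs ht; exists (H i'.*2.+1); first by apply: hgt_on => //; lia.
case: ht => h1 _ h2; apply: between_abs => //; left.
case: i ii hs => [_ ->|i ii [_ h _]]; first by apply: small_side; [lra|lra|].
by apply: lt_le_trans h _; apply: hgt_mono; lia.
Qed.

Lemma spiral_separator K (i j : nat) : (i.+2 < n)%N -> (j.+2 < n)%N -> (i < j)%N ->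
  0 < U i * U j -> on K `<=` on P ->
  (forall g : pt R -> bool, \big[addb/false]_(e <- K) (g e.1 (+) g e.2) = g (W i) (+) g (W j)) ->
  exists C, [/\ cyc C, forall z, on C z -> on P z \/ exists2 t, z = mkpt 0 t & gate (H i) (H j) t &
    forall t, `|t| < `|H i| \/ `|H j| < `|t| -> par C (mkpt 0 t) = par K (mkpt 0 t)].
Proof.
move=> hi hj ij uu sK bK.
have cut l : (l.+2 < n)%N -> cuts (W l) (W l.+2) (H l).
  by move=> hl; rewrite hgt_inner//; exact: cuts_step.
have lt := hgt_lt R n ij.
have [C [c1 c2 c3]] := separator (cut i hi) (cut j hj) (step_on n2 hi) (step_on n2 hj) sK bK
  (same_px uu) (same_hgt n uu) lt.
exists C; split; [exact: c1|exact: c2|move=> t ht; apply: c3; case: ht => ht].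
  by rewrite (lt_small ht) (lt_small (lt_trans ht lt)) (same_pos n uu).
by rewrite (lt_big ht) (lt_big (lt_trans lt ht)).
Qed.

(** The initial piece of the spiral up to the walls of the gate, closed by a chord across the gate,
    encloses the starting point but not a point further out. *)
Lemma int_separated (i : nat) t : (i.+2 < n./2)%N -> `|H i.*2.+2| < `|t| ->
  exists C, [/\ cyc C, par C (mkpt 0 (4 / 5)) != par C (mkpt 0 t) &
    forall z, on C z -> on P z \/ exists2 t, z = mkpt 0 t & igate i.+1 t].
Proof.
move=> ik ht; have [||//||||C [c1 c2 c3]] := @spiral_separator (arms R i.*2.+1) i.*2.+1 i.*2.+2.
- by lia.
- by lia.
- exact: same_odd.
- by apply: arms_on => //; lia.
- exact: arms_ends.
have big l : (l <= i.*2.+2)%N -> `|H l| < `|t|.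
  by move=> /(hgt_mono R n) hl; exact: le_lt_trans hl ht.
have t23 := big_inner (big 0%N isT).
exists C; split; [exact: c1| |exact: c2].
rewrite c3; last by left; apply: small_side => //; lra.
rewrite c3; last by right; exact: big.
have im : (i.*2.+2 < n)%N by lia.
rewrite !(arms_par n2 _ im).
rewrite hs_pairs; last by move=> l _; apply: arm_small; lra.
rewrite hs_pairs; last first.
  by move=> l li; rewrite (lt_big (big l.*2.+1 _)) ?(lt_big (big l.*2.+2 _))//; lia.
rewrite (lt_big t23) (lt_big (big 0%N isT)) addbb hgt0//.
(* The starting height 4/5 is chosen between the innermost crossing at 2/3 and the next one at
   12/13. *)
have -> : (4 / 5 < 2 / 3 :> R) = false by apply/negbTE; rewrite -leNgt; lra.
by have -> : (4 / 5 < 12 / 13 :> R) = true by lra.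
Qed.

Lemma int_lower : exists a b, [/\ region true P a, region true P b &
  forall j, polygonal_path (region true P) a b j -> (n./2 <= j)%N].
Proof.
have [k ek] : exists k : nat, n./2 = k.+1 by exists n./2.-1; lia.
have Ra t : 2 / 3 < t -> t < 12 / 13 -> region true P (mkpt 0 t).
  move=> t1 t2; have t0 : 0 <= t by lra.
  have sm l : (0 < l)%N -> `|t| < `|H l| by apply: small_side => //; exact: ltW.
  split.
    apply: P_off => //; first by rewrite gt_eqF.
    case=> [|i] hi; first by rewrite hgt0// lt_eqF.
    by apply: contraTneq (sm i.+1 isT) => ->; rewrite ltxx.
  rewrite P_par// ek doubleS /= hs_pairs; last by move=> l _; apply: arm_small => //; exact: ltW.
  by rewrite hgt0// t2 ltNge (ltW t1).
have Ra0 : region true P (mkpt 0 (4 / 5)) by apply: Ra; lra.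
(* For [n./2 = 1] it suffices that two different points need at least one link. *)
case: k ek => [|k] ek.
  exists (mkpt 0 (4 / 5)), (mkpt 0 (3 / 4)); split=> //; first by apply: Ra; lra.
  move=> [|j] [q [q0 q1 _]]; rewrite ek //.
  have := congr1 (@py R) (etrans (esym q0) q1); rewrite !pE; lra.
(* In absolute value the walls of the last gate are at most 12/13 and at least 4/3 times
   [2 ^+ k.*2.+1], so [t] falls between them. *)
pose t := U k.*2.+1.
have big l : (l <= k.*2.+1)%N -> `|H l| < `|t|.
  move=> /(hgt_mono R n) hl; apply: le_lt_trans hl _.
  by apply: le_lt_trans (hgt_le _ _ _) _; rewrite absU; have := exp2_gt0 R k.*2.+1; lra.
have top : `|t| < `|H k.*2.+2|.
  apply: lt_le_trans (hgt_ge _ _ _); rewrite absU (exprS _ k.*2.+1); have := exp2_gt0 R k.*2.+1; lra.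
have tt : 0 < H k.*2.+1 * t by exact: hgt_U.
have gt : gate (H k.*2.+1) (H k.*2.+2) t by split=> //; exact: big.
have t23 := big_inner (big 0%N isT).
exists (mkpt 0 (4 / 5)), (mkpt 0 t); split=> //.
  split.
    apply: P_off => //; first by apply: contraTneq t23 => ->; rewrite ltxx.
    move=> i hi; have [ik|ik] := leqP i k.*2.+1.
      by apply: contraTneq (big i ik) => ->; rewrite ltxx.
    have -> : i = k.*2.+2 by lia.
    by apply: contraTneq top => ->; rewrite ltxx.
  rewrite P_par// ek !doubleS /= 2!hsS hs_pairs; last first.
    by move=> l li; rewrite (lt_big (big l.*2.+1 _)) ?(lt_big (big l.*2.+2 _))//; lia.
  rewrite (lt_big t23) (lt_big (big 0%N isT)) -addbA (gate_lt (same_hgt n (same_odd R k)) gt).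
  by rewrite addbA addbb.
move=> j [q [q0 qj hq]].
have off_ := path_link hq.
have j0 : (0 < j)%N.
  case: j qj {hq off_} => // qj.
  have := congr1 (@py R) (etrans (esym q0) qj); rewrite !pE => e.
  by move: (big 1%N isT); rewrite -e ltNge ltW//; apply: small_side => //; lra.
pose hit i l := (l < j)%N /\ exists2 s, igate i s & segment (q l) (q l.+1) (mkpt 0 s).
suff hh : forall i, (i < n./2)%N -> exists2 l, (l < j)%N & hit i l.
  have [] // := @gates_bound n./2 j hit hh.
  move=> i i' l ii ik [lj [s gs ss]] [_ [s' gs' ss']].
  have [h hP hb] := igate_between ii ik gs gs'.
  exact: axis_separated (fun z => off_ l z lj) ss ss' hP hb.
move=> [|i] ik.
  by exists 0%N => //; split=> //; exists (4 / 5) => //; rewrite q0; exact: segment_l.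
have [ik'|ik'] := ltnP i.+2 n./2.
  have [C [c1 c2 c3]] := int_separated ik' (big i.*2.+2 (ltac:(lia))).
  rewrite -q0 -qj in c2; have [l lj [z sz /c3[zP|[s ez gs]]]] := path_hits c1 c2.
    by case: (off_ l z lj sz zP).
  by exists l => //; split=> //; exists s => //; rewrite -ez.
have -> : i = k by lia.
exists j.-1; first by lia.
split; first by lia.
by exists t => //; rewrite prednK// qj; exact: segment_r.
Qed.
End Fixed.
End Lower.

(** * The last two links outside an odd spiral *)

Section ExtLower.
Variable R : realType.
Implicit Types a b c u v w x y z m : pt R.
Local Notation edge := (pt R * pt R)%type.
Implicit Types (E K P C : seq edge) (h k s t : R).
Local Notation U := (U R).
Local Notation W := (W R).
Local Notation sg := (sg R).

Lemma sub_sdisj a b c d x y : sdisj a b c d -> segment a b x -> segment a b y -> sdisj x y c d.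
Proof. by move=> h hx hy z hz; apply: h; exact: segment_conv hx hy _ hz. Qed.

Lemma stays_below a b m z : px a < px b -> px a <= px m -> px m <= px b -> px a <= px z -> px z <= px b ->
  sdisj m z a b -> orient a b m < 0 -> orient a b z < 0.
Proof.
move=> ab h1 h2 h3 h4 dj om; rewrite ltNge; apply/negP => oz.
by have [y] := segment_meet ab h1 h2 h3 h4 (ltW om) oz; exact: dj.
Qed.

Lemma stays_above a b m z : px a < px b -> px a <= px m -> px m <= px b -> px a <= px z -> px z <= px b ->
  sdisj m z a b -> 0 < orient a b m -> 0 < orient a b z.
Proof.
move=> ab h1 h2 h3 h4 dj om; rewrite ltNge; apply/negP => oz.
by have [y] := segment_meet ab h3 h4 h1 h2 oz (ltW om); rewrite segment_sym; exact: dj.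
Qed.

Definition at_pt z (x y : R) : Prop := px z = x /\ py z = y.

(** The conclusion places (X, Y) below the line through (0, -1) and (-64, -4), the lowest admissible
    gate point and the tip of a wall; [p] is the ordinate at abscissa -64 on the segment from (0,
    e). *)
Lemma block_arith (X Y e p : R) : X < -64 -> -1 <= e -> 65 * p - 5 * -64 - 60 < 0 ->
  (X - 0) * (p - e) - (Y - e) * (-64 - 0) = 0 -> 64 * Y < 3 * X - 64.
Proof.
move=> h1 h2 h3 h4; have p1 : 0 < X * (p + 4) by rewrite nmulr_rgt0; lra.
have p2 : (e + 1) * (X + 64) <= 0 by rewrite mulr_ge0_le0; lra.
clear h1 h2 h3; lra.
Qed.

Lemma block_arith2 (X Y p : R) : X < -512 -> 64 * Y < 3 * X - 64 ->
  0 < 520 * p - 10 * -512 - 960 -> (0 - X) * (p - Y) - (4 - Y) * (-512 - X) = 0 -> False.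
Proof.
move=> h1 h2 h3 h4; have p1 : X * (p + 8) < 0 by rewrite nmulr_rlt0; lra.
clear h3; lra.
Qed.

Lemma block_arith3 (X Y : R) : -512 <= X -> 64 * Y < 3 * X - 64 -> X < -64 ->
  0 < 520 * Y - 10 * X - 960 -> False.
Proof. move=> *; lra. Qed.

Lemma block_arith4 (Y a : R) : 65 * Y - 5 * 1 - 60 < 0 -> 0 < (1 - a) * (Y - 1) -> a < 0 -> False.
Proof. move=> h1 h2 h3; move: h2; rewrite pmulr_rgt0; lra. Qed.

(** The [u0], ..., [u3] have parameters -8, -4, 2, 1 on the cubic. As [m] is below and [w] above the
    wall [u1 u3], the point [q] is not over that wall. To the right, the wall [r u3] stops [m, q];
    to the left, [q] is so low that the wall [u0 u2] hides [w]. *)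
Lemma outer_block_unit (e : R) (r q m w u0 u1 u2 u3 : pt R) : -1 <= e -> e < 12 / 13 ->
  px r < 0 -> at_pt m 0 e -> at_pt w 0 4 -> at_pt u3 1 1 -> at_pt u2 8 2 ->
  at_pt u1 (-64) (-4) -> at_pt u0 (-512) (-8) ->
  0 < orient r u3 m -> sdisj m q u1 u3 -> sdisj m q r u3 -> sdisj q w u1 u3 ->
  sdisj q w u0 u2 -> False.
Proof.
move=> e1 e2 r0 [mx my] [wx wy] [x3 y3] [x2 y2] [x1 y1] [x0 y0] om d1 d2 d3 d4.
have o13 z : orient u1 u3 z = 65 * py z - 5 * px z - 60.
  by rewrite /orient x1 y1 x3 y3; ring.
have o02 z : orient u0 u2 z = 520 * py z - 10 * px z - 960.
  by rewrite /orient x0 y0 x2 y2; ring.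
have below z : segment m q z -> -64 <= px z -> px z <= 1 -> 65 * py z - 5 * px z - 60 < 0.
  move=> sz h1 h2; rewrite -o13; apply: (@stays_below _ _ m).
  - by rewrite x1 x3; lra.
  - by rewrite x1 mx; lra.
  - by rewrite x3 mx; lra.
  - by rewrite x1.
  - by rewrite x3.
  - by apply: sub_sdisj d1 _ sz; exact: segment_l.
  - by rewrite o13 mx my; lra.
have above z : segment q w z -> -64 <= px z -> px z <= 1 -> 0 < 65 * py z - 5 * px z - 60.
  move=> sz h1 h2; rewrite -o13; apply: (@stays_above _ _ w).
  - by rewrite x1 x3; lra.
  - by rewrite x1 wx; lra.
  - by rewrite x3 wx; lra.
  - by rewrite x1.
  - by rewrite x3.
  - by apply: sub_sdisj d3 _ sz; exact: segment_r.
  - by rewrite o13 wx wy; lra.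
have above' z : segment q w z -> -512 <= px z -> px z <= 8 -> 0 < 520 * py z - 10 * px z - 960.
  move=> sz h1 h2; rewrite -o02; apply: (@stays_above _ _ w).
  - by rewrite x0 x2; lra.
  - by rewrite x0 wx; lra.
  - by rewrite x2 wx; lra.
  - by rewrite x0.
  - by rewrite x2.
  - by apply: sub_sdisj d4 _ sz; exact: segment_r.
  - by rewrite o02 wx wy; lra.
clear o13 o02 d1 d3 d4 x0 y0 x1 y1 x2 y2.
have [X1|X1] := ltP 1 (px q).
  have [z sz ez] : exists2 z, segment m q z & px z = 1.
    by apply: at_abscissa; rewrite ?mx ?ler01 ?(ltW X1)// (lt_trans ltr01 X1).
  have h1 := below z sz; rewrite ez in h1.
  have h2 : 0 < orient r u3 z.
    apply: (@stays_above _ _ m); rewrite ?ez ?x3 ?mx ?ler01 ?(ltW r0) ?(lt_trans r0 ltr01) ?(ltW (lt_trans r0 ltr01)) //.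
    by apply: sub_sdisj d2 _ sz; exact: segment_l.
  have e0 : orient r u3 z = (1 - px r) * (py z - 1) by rewrite /orient x3 y3 ez; ring.
  rewrite e0 in h2; apply: block_arith4 (h1 _ (lexx _)) h2 r0.
  by rewrite (le_trans _ ler01)// oppr_le0.
have [X2|X2] := leP (-64) (px q).
  have := lt_trans (above q (segment_l _ _) X2 X1) (below q (segment_r _ _) X2 X1).
  by rewrite ltxx.
have n64 : -64 <= 0 :> R by rewrite oppr_le0 ler0n.
have [z sz ez] : exists2 z, segment q m z & px z = -64.
  by apply: at_abscissa; rewrite ?mx ?(ltW X2)// (lt_le_trans X2).
have sz' := sz; rewrite segment_sym in sz'; have := below z sz'; rewrite ez => /(_ (lexx _) (le_trans n64 ler01)) hz.
have := segment_orient0 sz'; rewrite /orient mx my ez => cz.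
have hq : 64 * py q < 3 * px q - 64 by exact: block_arith X2 e1 hz cz.
have [X3|X3] := leP (-512) (px q).
  by apply: block_arith3 X3 hq X2 (above' q (segment_l _ _) X3 (le_trans (ltW X2) (le_trans n64 (ler0n _ 8)))).
have n512 : -512 <= 0 :> R by rewrite oppr_le0 ler0n.
have [y sy ey] : exists2 z, segment q w z & px z = -512.
  by apply: at_abscissa; rewrite ?wx ?(ltW X3)// (lt_le_trans X3).
have := above' y sy; rewrite ey => /(_ (lexx _) (le_trans n512 (ler0n _ 8))) hy.
have := segment_orient0 sy; rewrite /orient wx wy ey => cy.
exact: block_arith2 X3 hq hy cy.
Qed.

Definition dil (p q : R) z : pt R := mkpt (p * px z) (q * py z).

Lemma dil_segment p q a b z : segment a b z -> segment (dil p q a) (dil p q b) (dil p q z).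
Proof. by case=> t t01 ->; exists t => //; apply: pt_eq; rewrite /dil !pE; ring. Qed.

Lemma dil_sdisj p q a b c d : sdisj (dil p q a) (dil p q b) (dil p q c) (dil p q d) -> sdisj a b c d.
Proof. by move=> h z h1 h2; exact: h (dil_segment _ _ h1) (dil_segment _ _ h2). Qed.

(* Seen from a gate [m], a point [q] outside lies beyond the mouth and below the line from [m] to
   the outer end; from there the outermost arm hides [w]. *)
Lemma outer_block (v e : R) (r q : pt R) : v != 0 -> - v ^+ 2 <= v * e -> v * e < 12 / 13 * v ^+ 2 ->
  v * px r < 0 ->
  let W3 (x : R) := mkpt (x ^+ 3) x in let m := mkpt 0 e in let w := mkpt 0 (4 * v) in
  0 < orient r (W3 v) m -> sdisj m q (W3 (-4 * v)) (W3 v) -> sdisj m q r (W3 v) ->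
  sdisj q w (W3 (-4 * v)) (W3 v) -> sdisj q w (W3 (-8 * v)) (W3 (2 * v)) -> False.
Proof.
move=> v0 e1 e2 r0 W3 m w om d1 d2 d3 d4.
have v20 : 0 < v ^+ 2 by rewrite lt_def sqrf_eq0 v0 sqr_ge0.
have v30 : v ^+ 3 != 0 by rewrite expf_neq0.
(* This dilation preserves the cubic; its inverse divides parameters by [v] and so reduces the claim
   to [v = 1]. *)
pose D := dil (v ^+ 3) v; pose D' := dil (v ^+ 3)^-1 v^-1.
have DK z : D (D' z) = z by apply: pt_eq; rewrite /D /D' /dil !pE mulVKf.
have ev : e / v = v * e / v ^+ 2 by field.
have vK (x : R) : v^-1 * (x * v) = x by rewrite mulrC mulfK.
have D3 (x : R) : at_pt (D' (W3 (x * v))) (x ^+ 3) x by split; rewrite /D' /dil !pE ?vK// exprMn mulrC mulfK.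
have to a b c d : sdisj a b c d -> sdisj (D' a) (D' b) (D' c) (D' d).
  by move=> h; apply: (dil_sdisj (p := v ^+ 3) (q := v)); rewrite -/D !DK.
have at_eq z (x x' y : R) : x = x' -> at_pt z x y -> at_pt z x' y by move=> ->.
apply: (@outer_block_unit (e / v) (D' r) (D' q) (D' m) (D' w) (D' (W3 (-8 * v)))
  (D' (W3 (-4 * v))) (D' (W3 (2 * v))) (D' (W3 v))).
- by rewrite ev ler_pdivlMr//; lra.
- by rewrite ev ltr_pdivrMr//; lra.
- rewrite /D' /dil !pE; have -> : (v ^+ 3)^-1 * px r = (v ^+ 2)^-1 ^+ 2 * (v * px r) by field.
  by rewrite pmulr_rlt0// exprn_gt0// invr_gt0.
- by split; rewrite /D' /dil !pE ?mulr0// mulrC.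
- by split; rewrite /D' /dil !pE ?mulr0// vK.
- by have := D3 1; rewrite mul1r expr1n.
- by apply: at_eq (D3 2); ring.
- by apply: at_eq (D3 (-4)); ring.
- by apply: at_eq (D3 (-8)); ring.
- have : orient r (W3 v) m = v ^+ 2 ^+ 2 * orient (D' r) (D' (W3 v)) (D' m).
    by rewrite /D' /dil /orient !pE; field.
  by move: om => /[swap] ->; rewrite pmulr_rgt0// exprn_gt0.
- exact: to.
- exact: to.
- exact: to.
- exact: to.
Qed.
End ExtLower.

(** * Lower bound for the exterior *)

Section ExtFixed.
Variable R : realType.
Implicit Types a b c u v w x y z m : pt R.
Local Notation edge := (pt R * pt R)%type.
Implicit Types (E K P C : seq edge) (h k s t : R).
Local Notation U := (U R).
Local Notation W := (W R).
Local Notation sg := (sg R).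

Lemma opp_side h k t : 0 < h * t -> k = - 4 * h -> t * k <= 0.
Proof.
move=> ht ->; have -> : t * (- 4 * h) = - (4 * (h * t)) by ring.
by rewrite oppr_le0 mulr_ge0 // ltW.
Qed.

Variable n : nat.
Hypothesis n2 : (2 < n)%N.
Local Notation P := (edg (spiral R n) n).
Local Notation H := (hgt R n).
Local Notation N := (n./2.*2.-1).
(** The number of gates; the maximum makes a difference for [n = 3], where two links are
    required. *)
Local Notation G := (maxn 2 n./2).
(** Its absolute value [2 ^+ (n - 2)] exceeds every crossing height, and its sign puts the wall at
    height [H (n - 3)] between it and all other gates. *)
Local Notation top := (2 * U (n - 3)).

(* The gates from the centre outwards: the centre itself, the gaps between consecutive arms on
   the same side, and a point beyond the whole spiral. *)
Definition egate (i : nat) t := if i is i'.+1 then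
  if i == G.-1 then t = top else gate (H i'.*2) (H i'.*2.+3) t else t = 0.

Lemma N_gt : (n - 3 < N)%N.
Proof. by have := odd_double_half n; case: (odd n); lia. Qed.

Lemma top_big (i : nat) : (i < N)%N -> `|H i| < `|top|.
Proof.
move=> hi; have ii : (i <= (n - 3).+1)%N by have := odd_double_half n; case: (odd n); lia.
apply: le_lt_trans (hgt_mono R n ii) _; apply: le_lt_trans (hgt_le _ _ _) _.
rewrite normrM absU exprS (ger0_norm (ler0n _ 2)).
have := exp2_gt0 R (n - 3); lra.
Qed.

Lemma egate_between (i i' : nat) s t : (i < i')%N -> (i' < G)%N -> egate i s -> egate i' t ->
  exists2 k, on P (mkpt 0 k) & s <= k <= t \/ t <= k <= s.
Proof.
case: i' => // i' ii ig; rewrite /(egate i'.+1); case: eqP => [eg hs ->|ng hs [h1 _ h2]].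
  exists (H (n - 3)); first by apply: hgt_on => //; exact: N_gt.
  apply: between_abs; [|exact: top_big N_gt|]; last first.
    by rewrite mulrCA mulr_gt0// hgt_U.
  case: i ii hs => [_ ->|i ii]; first by right; rewrite mul0r.
  rewrite /egate; case: eqP => [|_ [_ h _]]; first by lia.
  by left; apply: lt_le_trans h _; apply: hgt_mono; have := odd_double_half n; case: (odd n); lia.
exists (H i'.*2); first by apply: hgt_on => //; lia.
apply: between_abs => //; case: i ii hs => [_ ->|i ii]; first by right; rewrite mul0r.
rewrite /egate; case: eqP => [|_ [_ h h3]]; first by lia.
(* Consecutive gates lie on opposite sides of the centre; otherwise the earlier one is closer to the
   centre than the wall. *)
have [e|ne] := eqVneq i.+1 i'; last by left; apply: lt_le_trans h _; apply: hgt_mono; lia.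
right; apply: opp_side h3 _; rewrite -e doubleS.
by rewrite !hgt_inner ?U_SS; [ring|lia|lia].
Qed.

(** [H i.*2] and [H i.*2.+3] have the same sign, so the sum telescopes. *)
Lemma hs_center (i : nat) : hs H i.*2 0 = (0 < H i.*2.+1).
Proof.
elim: i => [|i ih].
  rewrite hs0; apply/esym/negbTE; rewrite -leNgt; have := hgt_U R n 1; rewrite U1.
  by move=> h; rewrite -oppr_ge0; apply: ltW; move: h; lra.
rewrite doubleS !hsS ih -(same_pos n (same_gap R i)) addbC addbA addbC addbA.
by case: (0 < H i.*2); case: (0 < H i.*2.+1).
Qed.

Lemma top_inner : `|2 / 3 : R| < `|top|.
Proof. by apply: (@big_inner R n n2); apply: top_big; have := N_gt; lia. Qed.

(** The piece from [W i.*2] through the innermost edge to [W i.*2.+3], closed by a chord across the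
    gap between its walls, encloses the centre. *)
Lemma ext_separated (i : nat) : (i.+2 < n./2)%N ->
  exists C, [/\ cyc C, par C (mkpt 0 0) != par C (mkpt 0 top) &
    forall z, on C z -> on P z \/ exists2 t, z = mkpt 0 t & gate (H i.*2) (H i.*2.+3) t].
Proof.
move=> ik; pose K := arms R i.*2 ++ [:: (W i.*2.+1, W i.*2.+3)].
have [||||||C [c1 c2 c3]] := @spiral_separator R n n2 K i.*2 i.*2.+3.
- by lia.
- by lia.
- by lia.
- exact: same_gap.
- move=> z /on_cat[|/on_cons[|/on_nil//]]; first by apply: arms_on => //; lia.
  by apply: step_on => //; lia.
- move=> g; rewrite big_cat arms_ends /= big_cons big_nil /=.
  by case: (g _); case: (g _); case: (g _).
have parK t : par K (mkpt 0 t) = (t < 2 / 3) (+) hs H i.*2 t (+) (t < H i.*2.+1).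
  rewrite par_cat (arms_par n2); last by lia.
  by rewrite par_cons /par big_nil addbF /= (cuts_ray t (cuts_step R i.*2.+1)) hgt_inner//; lia.
exists C; split; [exact: c1| |exact: c2].
have H0 l : 0 < `|H l|.
  by rewrite normr_gt0; apply: contraTneq (hgt_U R n l) => ->; rewrite mul0r ltxx.
rewrite c3; last by left; rewrite normr0.
rewrite c3; last by right; apply: top_big; lia.
rewrite !parK hs_center addbK (lt_big top_inner).
rewrite (hs_const (d := top < 0)); last by move=> l li; apply: lt_big; apply: top_big; lia.
have iN : (i.*2.+1 < N)%N by lia.
rewrite odd_double /= addbF (lt_big (top_big iN)).
by rewrite addbb; have -> : 0 < 2 / 3 :> R by lra.
Qed.

Lemma ext_center : region false P (mkpt 0 0).
Proof.
have H0 l : 0 != H l.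
  by rewrite eq_sym; apply: contraTneq (hgt_U R n l) => ->; rewrite mul0r ltxx.
split; first by apply: P_off => //; rewrite lt_eqF//; lra.
rewrite P_par//; have -> : N = n./2.-1.*2.+1 by lia.
rewrite hs_pairs ?hgt0//.
  have -> : 0 < 2 / 3 :> R by lra.
  by have -> : 0 < 12 / 13 :> R by lra.
by move=> l _; exact: same_pos (same_odd R l).
Qed.

Lemma ext_top : region false P (mkpt 0 top).
Proof.
split.
  apply: P_off => //; first by apply: contraTneq top_inner => ->; rewrite ltxx.
  by move=> i hi; apply: contraTneq (top_big hi) => ->; rewrite ltxx.
rewrite P_par// (lt_big top_inner) (hs_const (d := top < 0)); last first.
  by move=> l li; apply: lt_big; exact: top_big.
have -> : N = n./2.-1.*2.+1 by lia.
by rewrite /= odd_double /= addbb.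
Qed.

Definition ehit (q : nat -> pt R) (i l : nat) : Prop :=
  exists2 s, egate i s & segment (q l) (q l.+1) (mkpt 0 s).

(** * A path from the centre to a point beyond the spiral *)

Section Path.
Variables (q : nat -> pt R) (j : nat).
Hypotheses (q0 : q 0%N = mkpt 0 0) (qj : q j = mkpt 0 top).
Hypothesis off_ : forall l z, (l < j)%N -> segment (q l) (q l.+1) z -> ~ on P z.

Lemma top_neq0 : top != 0.
Proof. by rewrite mulf_neq0// U_neq0. Qed.

Lemma path_gt0 : (0 < j)%N.
Proof.
rewrite lt0n; apply: contraTneq top_neq0 => j0.
by have := congr1 (@py R) (etrans (esym q0) (etrans (congr1 q (esym j0)) qj)); rewrite !pE => <-; rewrite eqxx.
Qed.

Lemma ehit_last : ehit q G.-1 j.-1.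
Proof.
exists top; last by rewrite prednK ?path_gt0// qj; exact: segment_r.
case e : G.-1 => [|g]; first by lia.
by rewrite /egate e eqxx.
Qed.

Lemma ehit_ex (i : nat) : (i < G)%N -> exists2 l, (l < j)%N & ehit q i l.
Proof.
case: i => [|i] ig.
  by exists 0%N; [exact: path_gt0|exists 0 => //; rewrite q0; exact: segment_l].
have [e|ne] := eqVneq i.+1 G.-1.
  by exists j.-1; [have := path_gt0; lia|rewrite e; exact: ehit_last].
have ik : (i.+2 < n./2)%N by lia.
have [C [c1 c2 c3]] := ext_separated ik.
rewrite -q0 -qj in c2; have [l lj [z sz /c3[zP|[s ez gs]]]] := path_hits c1 c2.
  by case: (off_ lj sz zP).
by exists l => //; exists s; rewrite /egate ?(negbTE ne)// -ez.
Qed.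

Lemma ehit_excl (i i' l : nat) : (l < j)%N -> (i < i')%N -> (i' < G)%N ->
  ehit q i l -> ehit q i' l -> False.
Proof.
move=> lj ii ig [s gs ss] [t gt st]; have [k kP hk] := egate_between ii ig gs gt.
exact: axis_separated (fun z => off_ (z := z) lj) ss st kP hk.
Qed.

Lemma ext_links_ge : (G <= j)%N.
Proof.
have [] // := @gates_bound G j (fun i l => (l < j)%N /\ ehit q i l).
  by move=> i /ehit_ex[l lj h]; exists l.
by move=> i i' l ii ig [lj h] [_ h']; exact: ehit_excl lj ii ig h h'.
Qed.

Hypothesis on_ : odd n.
Hypothesis n4 : (4 < n)%N.

Lemma norm_mul_lt (d v t : R) : v != 0 -> `|t| < d * `|v| -> - (d * v ^+ 2) < v * t /\ v * t < d * v ^+ 2.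
Proof.
move=> v0 h; have : `|v * t| < d * v ^+ 2.
  by rewrite normrM -(real_normK (num_real v)) expr2 mulrA [ltLHS]mulrC ltr_pM2r// normr_gt0.
by rewrite ltr_norml => /andP.
Qed.

(** Supplies the hypotheses of [outer_block] with [v = U (n - 4)] for a point of any gate but the
    last. The point [r] is the inner end of the arm leading to [W (n - 4)], or [W 0] for [n = 5]. *)
Lemma egate_odd (i : nat) t : (i < G.-1)%N -> egate i t ->
  [/\ - U (n - 4) ^+ 2 <= U (n - 4) * t, U (n - 4) * t < 12 / 13 * U (n - 4) ^+ 2 &
   exists r, [/\ segment r (W (n - 4)) `<=` on P, U (n - 4) * px r < 0 & 0 < orient r (W (n - 4)) (mkpt 0 t)]].
Proof.
have en : n = n./2.*2.+1 by rewrite -[LHS]odd_double_half on_.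
have GE : G = n./2 by lia.
have [k ek] : exists k : nat, n./2 = k.+2 by exists (n./2 - 2)%N; lia.
have e4 : (n - 4 = k.*2.+1)%N by rewrite en ek; lia.
have v0 := U_neq0 R (n - 4); have v2 : 0 < U (n - 4) ^+ 2 by rewrite lt_def sqrf_eq0 v0 sqr_ge0.
have absH l : (l.+2 < n)%N -> `|H l| = 12 / 13 * `|U l|.
  by move=> hl; rewrite hgt_inner// normrM mulrC (@ger0_norm _ (12 / 13)); lra.
move=> ig gt.
have [t1 t2] : - U (n - 4) ^+ 2 <= U (n - 4) * t /\ U (n - 4) * t < 12 / 13 * U (n - 4) ^+ 2.
  case: i ig gt => [_ ->|i ig]; first by rewrite mulr0; split; lra.
  rewrite /egate; case: eqP => [|_ [_ h _]]; first by lia.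
  have h' : `|t| < 12 / 13 * `|U (n - 4)|.
    by rewrite -absH; [apply: lt_le_trans h _; apply: hgt_mono; lia|lia].
  by have [a1 a2] := norm_mul_lt v0 h'; split=> //; lra.
split=> //; case: k ek e4 => [|k] ek e4.
  have i0 : i = 0%N by lia.
  rewrite i0 in gt; rewrite e4 (_ : 0.*2.+1 = 1)%N// gt.
  exists (W 0); split; first exact: inner_on.
    by rewrite /W U0 U1 !pE; lra.
  by rewrite (cuts_orient 0 (cuts01 R)) /W U0 U1 !pE; lra.
have e6 : (n - 4 = (n - 6).+2)%N by lia.
have U6 : U (n - 4) = - 4 * U (n - 6) by rewrite e6 U_SS.
(* The arm from [W (n - 6)] to [W (n - 4)] crosses the axis at [- 3 / 13 * U (n - 4)]; the gate
   point has to lie on the side of this crossing given by the sign of [U (n - 4)]. *)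
have t3 : - (3 / 13 * U (n - 4) ^+ 2) < U (n - 4) * t.
  case: i ig gt => [_ ->|i ig]; first by rewrite mulr0; lra.
  rewrite /egate; case: eqP => [|_ [_ h h3]]; first by lia.
  have [e|ne] := eqVneq i.*2.+3 (n - 4)%N.
    rewrite -e U_gap; have : 0 < U i.*2 * t.
      have h5 : 0 < H i.*2 ^+ 2 * (U i.*2 * t).
        have -> : H i.*2 ^+ 2 * (U i.*2 * t) = (H i.*2 * U i.*2) * (H i.*2 * t) by ring.
        by apply: mulr_gt0 => //; exact: hgt_U.
      have Hn : H i.*2 != 0 by apply: contraTneq h3 => ->; rewrite mul0r ltxx.
      by move: h5; rewrite pmulr_rgt0// lt_def sqrf_eq0 Hn sqr_ge0.
    have := sqr_ge0 (8 * U i.*2); lra.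
  have h' : `|t| < 12 / 13 * `|U (n - 6)|.
    by rewrite -absH; [apply: lt_le_trans h _; apply: hgt_mono; lia|lia].
  have h4 : `|t| < 3 / 13 * `|U (n - 4)|.
    by rewrite U6 normrM normrN (@ger0_norm _ 4); lra.
  by have [] := norm_mul_lt v0 h4.
exists (W (n - 6)); split.
- by rewrite e6; apply: step_on => //; lia.
- rewrite U6 !pE; have -> : -4 * U (n - 6) * U (n - 6) ^+ 3 = - (4 * (U (n - 6) ^+ 2) ^+ 2) by ring.
  by rewrite oppr_lt0 mulr_gt0// exprn_gt0// lt_def sqrf_eq0 U_neq0 sqr_ge0.
have c := cuts_step R (n - 6); rewrite -e6 in c.
rewrite (cuts_orient t c) !pE.
move: t3 v2; rewrite U6; set u := U (n - 6) => t3 v2.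
have -> : ((-4 * u) ^+ 3 - u ^+ 3) * (t - u * (12 / 13)) =
  65 / 64 * (-4 * u) ^+ 2 * (-4 * u * t + 3 / 13 * (-4 * u) ^+ 2) by field.
by rewrite mulr_gt0//; [rewrite mulr_gt0//; lra|lra].
Qed.

(** With as many links as gates each link would hit exactly one gate, the last link the final one.
    The penultimate link would then hit an earlier gate and end at a point from which [top] is
    visible, contrary to [outer_block]. *)
Lemma ext_links_gt : (G < j)%N.
Proof.
rewrite ltn_neqAle ext_links_ge andbT; apply/eqP => eG.
have j1 : (0 < j)%N := path_gt0.
have [||_ /(_ _ G.-2)[]] := @gates_bound G.-1 j.-1 (fun i l => (l < j)%N /\ ehit q i l).
- move=> i ig; have [l lj h] := ehit_ex (leq_trans ig (leq_pred _)); exists l => //.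
  suff : l != j.-1 by lia.
  apply/eqP => el; rewrite el in h lj.
  by apply: ehit_excl lj ig _ h ehit_last; lia.
- by move=> i i' l ii ig [lj h] [_ h']; apply: ehit_excl lj ii _ h h'; lia.
- by lia.
- by lia.
move=> i ig [lj [t gt st]].
have [e1 e2 [r [rP r0 ro]]] := egate_odd ig gt.
have ej : G.-2.+1 = j.-1 by lia.
have ejj : j.-1.+1 = j by lia.
have o4 : odd (n - 4) by rewrite oddB ?on_//; exact: ltnW.
have e3 : W (n - 3) = mkpt ((2 * U (n - 4)) ^+ 3) (2 * U (n - 4)).
  rewrite /W; have -> : (n - 3 = (n - 4).+1)%N by lia.
  by rewrite U_S o4.
have U3 : U (n - 3) = 2 * U (n - 4) by have := congr1 (@py R) e3; rewrite !pE.
have off1 z : segment (mkpt 0 t) (q j.-1) z -> ~ on P z.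
  move=> sz; apply: (off_ lj); rewrite ej in st *; exact: segment_conv st (segment_r _ _) _ sz.
have off2 z : segment (q j.-1) (mkpt 0 (4 * U (n - 4))) z -> ~ on P z.
  have -> : 4 * U (n - 4) = top by rewrite U3; ring.
  by rewrite -qj -[in q j]ejj; apply: off_; lia.
have D a b c d : segment c d `<=` on P -> (forall z, segment a b z -> ~ on P z) -> sdisj a b c d.
  by move=> h1 h2 z /h2 h /h1.
have S1 : segment (mkpt ((-4 * U (n - 4)) ^+ 3) (-4 * U (n - 4))) (W (n - 4)) `<=` on P.
  have -> : mkpt ((-4 * U (n - 4)) ^+ 3) (-4 * U (n - 4)) = W (n - 4).+2 by rewrite /W U_SS.
  by rewrite segment_sym; apply: step_on => //; lia.
have S2 : segment (mkpt ((-8 * U (n - 4)) ^+ 3) (-8 * U (n - 4)))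
    (mkpt ((2 * U (n - 4)) ^+ 3) (2 * U (n - 4))) `<=` on P.
  have e8 : -8 * U (n - 4) = U (n - 3).+2 by rewrite U_SS U3; ring.
  rewrite -e3 e8 -/(W (n - 3).+2) segment_sym; apply: step_on => //; lia.
apply: (@outer_block R (U (n - 4)) t r (q j.-1)) => //.
- exact: U_neq0.
- exact: D S1 off1.
- exact: D rP off1.
- exact: D S1 off2.
- exact: D S2 off2.
Qed.
End Path.

Lemma ext_lower (j : nat) :
  polygonal_path (region false P) (mkpt 0 0) (mkpt 0 top) j -> (n.+1./2 <= j)%N.
Proof.
move=> [q [q0 qj hq]]; have hoff := path_link hq.
have ge := ext_links_ge q0 qj hoff.
have e := odd_double_half n; have [iodd|iodd] := boolP (odd n); last by rewrite (negbTE iodd) in e; lia.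
rewrite iodd in e; have [n4|n4] := ltnP 4 n; last by lia.
by have := ext_links_gt q0 qj hoff iodd n4; lia.
Qed.
End ExtFixed.

Theorem theorem4p1 (R : realType) :
  (forall (n : nat) (p : nat -> pt R), (3 <= n)%N ->
     simple_closed_polygon n p ->
     (poldiam (int_poly (polygon n p)) <= ((n %/ 2)%N%:R)%:E)%E /\
     (poldiam (ext_poly (polygon n p)) <= ((n.+1 %/ 2)%N%:R)%:E)%E) /\
  (forall n : nat, (3 <= n)%N ->
     exists p : nat -> pt R, simple_closed_polygon n p /\
     poldiam (int_poly (polygon n p)) = ((n %/ 2)%N%:R)%:E /\
     poldiam (ext_poly (polygon n p)) = ((n.+1 %/ 2)%N%:R)%:E).
Proof.
split=> [n p n2 /(simpleP p n2) sp|n n2].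
  by rewrite !divn2; exact: poldiam_upper.
have sp := spiral_simple R n2; exists (spiral R n); split; first exact/simpleP.
have [hi he] := poldiam_upper sp; rewrite !divn2; split; apply/eqP; rewrite eq_le ?hi ?he /=.
  rewrite int_polyE//; have [a [b [Ra Rb h]]] := int_lower R n2.
  exact: poldiam_ge Ra Rb h.
rewrite ext_polyE//; exact: poldiam_ge (ext_center R n2) (ext_top R n2) (ext_lower n2).
Qed.
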